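(* Let $\{D_n\}$ be a sequence of simply connected domains with $0 \in D_n \subset \mathbb{C}$, $n = 1, 2, \ldots$. Let $f_n$ be analytic and univalent in the unit disk $\mathbb{D}$ with $f_n(\mathbb{D}) = D_n$, $f_n(0) = 0$ and $f_n'(0) > 0$. Let $D$ be the kernel of $\{D_n\}$. Then $f_n \to f$ uniformly on each compact subset of $\mathbb{D}$ if and only if $D_n \to D \ne \mathbb{C}$. Furthermore, if $D = \{0\}$, then $f(z) \equiv 0$; otherwise, $f(\mathbb{D}) = D$.
   Context: Kernel of a sequence of domains $D_n$ all containing the origin. Case I: if $0$ is an interior point for all the $D_n$, that is, if a disk $|z| < r$ is contained in all the domains, then the kernel is the largest domain $D$ (containing $0$) such that every compact subset of $D$ is contained in all but a finite number of the $D_n$. Case II: if no matter how large $n_0$ is chosen there is no disk $|z| < r$ contained in all the domains $D_n$ with $n > n_0$, then the kernel is defined to be the origin itself, $\{0\}$. In either case, convergence of the sequence to its kernel $D$ is denoted by $D_n \to D$. *)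

(* Defs.v *)
From HB Require Import structures.
From mathcomp Require Import all_boot all_order all_algebra.
From mathcomp Require Import complex.
From mathcomp Require Import all_classical all_reals all_analysis.

Set Implicit Arguments.
Unset Strict Implicit.
Unset Printing Implicit Defensive.

Import Order.TTheory GRing.Theory Num.Theory.
Import numFieldNormedType.Exports.

Local Open Scope classical_set_scope.
Local Open Scope ring_scope.
Local Open Scope complex_scope.

(* [R[i]] with the topology of the modulus, and as a normed module over itself:
   [derivable] and [derive1] on it are complex differentiation. *)
HB.instance Definition _ (R : rcfType) := PseudoPointedMetric.copy R[i] R[i]^o.
HB.instance Definition _ (R : rcfType) := NormedModule.copy R[i] R[i]^o.

Section Kernel.
Variable R : realType.
Notation C := R[i].

(* The radius is a real number, embedded in [C] because balls of a
   [numFieldType] have their radius in the field itself. *)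
Definition disk (r : R) : set C := ball (0 : C) r%:C.

Definition domain (U : set C) : Prop := [/\ U !=set0, open U & connected U].

(* Every closed curve in [U] is homotopic in [U], with fixed base point, to a
   constant curve; [H (s, t)] is the point with parameter [t] of the curve at
   time [s]. *)
Definition simply_connected (U : set C) : Prop :=
  forall g : R -> C,
    {within `[0, 1], continuous g} -> g @` `[0, 1] `<=` U -> g 0 = g 1 ->
  exists H : R * R -> C,
    [/\ {within `[0, 1] `*` `[0, 1], continuous H},
        H @` (`[0, 1] `*` `[0, 1]) `<=` U,
        (forall t : R, 0 <= t <= 1 -> H (0, t) = g t /\ H (1, t) = g 0) &
        (forall s : R, 0 <= s <= 1 -> H (s, 0) = g 0 /\ H (s, 1) = g 0)].

Definition analytic_on (U : set C) (f : C -> C) : Prop :=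
  forall z, U z -> derivable f z 1.

Definition eventually_covers_compacts (Dn : nat -> set C) (U : set C) : Prop :=
  forall K : set C, compact K -> K `<=` U -> \forall n \near \oo, K `<=` Dn n.

Definition kernel_candidate (Dn : nat -> set C) (U : set C) : Prop :=
  [/\ domain U, U 0 & eventually_covers_compacts Dn U].

(* For open sets [Dn n] containing 0 the two alternatives are exclusive and
   exhaustive: finitely many of them always contain a common disk. *)
Definition is_kernel (Dn : nat -> set C) (D : set C) : Prop :=
  ((exists2 r : R, 0 < r & forall n, disk r `<=` Dn n) /\
   kernel_candidate Dn D /\ forall U, kernel_candidate Dn U -> U `<=` D)
  \/
  ((forall n0 : nat, ~ exists2 r : R, 0 < r &
      forall n, (n0 < n)%N -> disk r `<=` Dn n) /\
   D = [set 0]).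

(* Convergence to the kernel: every subsequence has the same kernel. *)
Definition kernel_converges (Dn : nat -> set C) (D : set C) : Prop :=
  forall phi : nat -> nat, {homo phi : m n / (m < n)%N} ->
    is_kernel (fun k => Dn (phi k)) D.

Definition locally_uniform_cvg (U : set C) (fn : nat -> C -> C) (f : C -> C) :
    Prop :=
  forall K : set C, compact K -> K `<=` U -> {uniform K, fn @ \oo --> f}.

End Kernel.

(* Main.v *)
(* The engine is one inequality: if f is univalent on the unit disk and omits w,
   then |f'(z)| (1 - |z|) <= A |f(z) - w|. Indeed a logarithm L of f - w is
   univalent modulo the period of exp, so by Bloch's theorem its image contains
   no large disk and L' is controlled. This yields a Koebe theorem, a growth
   bound, and a quantitative separation of values, hence univalence of limits.

   If f_n -> f with f'(0) <> 0, Koebe's theorem makes every compact subset of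
   f(D) eventually contained in D_n, and the Schwarz-Pick bound for the inverses
   of f_n shows that a larger domain cannot have this property; if f'(0) = 0 the
   growth bound gives f = 0 and the inradii of the D_n tend to 0. Conversely
   D <> C bounds f_n'(0), so (f_n) is normal, and all its subsequential limits
   coincide since each is the normalized conformal map onto D.

   Complex analysis is derived without circle integrals: Goursat's theorem on
   triangles gives primitives, the maximum principle holds for twice
   differentiable functions by a second derivative test and passes to the limit
   of difference quotients, and everything else follows from it. *)

Require Import Defs.
From HB Require Import structures.
From mathcomp Require Import all_boot all_order all_algebra.
From mathcomp Require Import complex.
From mathcomp Require Import all_classical all_reals all_analysis.
From mathcomp Require Import ring lra.

Set Implicit Arguments.
Unset Strict Implicit.
Unset Printing Implicit Defensive.

Import Order.TTheory GRing.Theory Num.Theory.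
Import numFieldNormedType.Exports.

Local Open Scope classical_set_scope.
Local Open Scope ring_scope.
Local Open Scope complex_scope.

(** With no circle integrals there is no argument principle to count zeros, so each argument that
    would count them is replaced by an inequality that survives a limit. Hurwitz's theorem becomes a
    Harnack inequality between the moduli of a zero-free function at neighbouring points.
    Injectivity of a limit becomes a lower bound for [|f_n(z1) - f_n(z2)|]: on a ball about [z1]
    that misses [z2], the value [f_n(z2)] is omitted. Openness of images and continuity of inverses
    come from the explicit radius in Koebe's theorem.

    Bloch's theorem enters because a disk of radius larger than [2 pi] contains, with its centre,
    the translate of the centre by the period of the exponential; two points of the domain with such
    logarithms would have the same value under a univalent function. Its denominator 128 times
    [2 pi] gives the constant [A = 256 pi]. The value is far from sharp, and no later estimate
    depends on its size.

    Limit points are taken along one ultrafilter on the integers, which serves all points of the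
    disk at once. *)

Local Notation N := Normc.normc.
Local Notation Re := complex.Re.
Local Notation Im := complex.Im.

(** * The modulus *)

Section Modulus.
Variable R : realType.
Notation C := R[i].
Implicit Types (z w : C) (x : R).

(** The norm of the library takes its values in [C] itself. Estimates are carried out with the
    real-valued [N], where linear real arithmetic applies. *)
Lemma normCE z : `|z| = (N z)%:C. Proof. by []. Qed.
Lemma N_ge0 z : 0 <= N z. Proof. by case: z => a b /=; exact: sqrtr_ge0. Qed.
Lemma N0 : N (0 : C) = 0. Proof. exact: ComplexField.Normc.normc0. Qed.
Lemma N1 : N (1 : C) = 1. Proof. exact: ComplexField.Normc.normc1. Qed.
Lemma NM z w : N (z * w) = N z * N w. Proof. exact: ComplexField.Normc.normcM. Qed.
Lemma NN z : N (- z) = N z. Proof. by case: z => a b; rewrite /= !sqrrN. Qed.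
Lemma NV z : N (z^-1) = (N z)^-1. Proof. exact: ComplexField.Normc.normcV. Qed.
Lemma NB z w : N (z - w) = N (w - z). Proof. by rewrite -NN opprB. Qed.
Lemma ND z w : N (z + w) <= N z + N w.
Proof. by rewrite -lecR rmorphD /= -!normCE; exact: ler_normD. Qed.
Lemma NDB z w v : N (z - w) <= N (z - v) + N (v - w).
Proof. have -> : z - w = (z - v) + (v - w) by ring. exact: ND. Qed.
Lemma N_eq0 z : (N z == 0) = (z == 0).
Proof.
apply/eqP/eqP => [|->]; last exact: N0.
exact: ComplexField.Normc.eq0_normc.
Qed.
Lemma N_gt0 z : (0 < N z) = (z != 0).
Proof. by rewrite lt_neqAle N_ge0 andbT eq_sym N_eq0. Qed.
Lemma NX z n : N (z ^+ n) = N z ^+ n.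
Proof. by elim: n => [|n IH]; rewrite ?expr0 ?N1// !exprS NM IH. Qed.
Lemma Nr x : N x%:C = `|x|. Proof. by rewrite /= expr0n addr0 sqrtr_sqr. Qed.
Lemma Nsq z : N z ^+ 2 = Re z ^+ 2 + Im z ^+ 2.
Proof. by case: z => a b /=; rewrite sqr_sqrtr// addr_ge0 ?sqr_ge0. Qed.
Lemma Ni : N ('i : C) = 1.
Proof. by rewrite /= expr0n add0r expr1n sqrtr1. Qed.
Lemma le_Re z : `|Re z| <= N z.
Proof.
rewrite -(ler_pXn2r (n := 2)) ?nnegrE ?N_ge0// Nsq real_normK ?num_real//.
by rewrite lerDl sqr_ge0.
Qed.
Lemma le_Im z : `|Im z| <= N z.
Proof.
rewrite -(ler_pXn2r (n := 2)) ?nnegrE ?N_ge0// Nsq real_normK ?num_real//.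
by rewrite lerDr sqr_ge0.
Qed.
Lemma N_le_ReIm z : N z <= `|Re z| + `|Im z|.
Proof.
rewrite {1}(complexE z); apply: le_trans (ND _ _) _.
by rewrite NM Ni mul1r !Nr.
Qed.
Lemma NBr z w : N z - N w <= N (z - w).
Proof. have := ND (z - w) w; rewrite subrK; lra. Qed.
Lemma NJ z : N (z^*) = N z. Proof. by case: z => a b /=; rewrite sqrrN. Qed.

Lemma diskE (r : R) z : disk r z <-> N z < r.
Proof.
rewrite /disk /ball /= sub0r normrN normCE; split; last by move=> h; rewrite ltcR.
by rewrite ltcR.
Qed.

End Modulus.

(** * Complex differentiation *)

Section Calculus.
Variable R : realType.
Notation C := R[i].
Implicit Types (f g : C -> C) (z w a b d : C) (r e : R).

Definition contc f z := forall e, 0 < e -> exists2 r, 0 < r &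
  forall w, N (w - z) < r -> N (f w - f z) < e.

(* Caratheodory's form of [f'(z) = d]: the difference quotient extends
   continuously to [z]; algebraic rules and removable singularities become
   one-line computations. *)
Definition hasd f z d := exists2 phi : C -> C, contc phi z /\ phi z = d &
  forall w, f w - f z = phi w * (w - z).

Lemma contc_cst d z : contc (fun=> d) z.
Proof. by move=> e e0; exists 1 => // w _; rewrite subrr N0. Qed.

Lemma contc_id z : contc id z.
Proof. by move=> e e0; exists e. Qed.

Lemma contcD f g z : contc f z -> contc g z -> contc (fun w => f w + g w) z.
Proof.
move=> cf cg e e0; have e20 : 0 < e / 2 by lra.
have [r1 r10 h1] := cf _ e20; have [r2 r20 h2] := cg _ e20.
exists (Num.min r1 r2); first by rewrite lt_min r10.
move=> w; rewrite lt_min => /andP[/h1 k1 /h2 k2].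
have -> : f w + g w - (f z + g z) = (f w - f z) + (g w - g z) by ring.
apply: le_lt_trans (ND _ _) _; lra.
Qed.

Lemma contc_bound f z : contc f z -> exists2 r, 0 < r &
  forall w, N (w - z) < r -> N (f w) < N (f z) + 1.
Proof.
move=> /(_ 1 ltr01)[r r0 h]; exists r => // w /h.
have := NBr (f w) (f z); lra.
Qed.

Lemma contcM f g z : contc f z -> contc g z -> contc (fun w => f w * g w) z.
Proof.
move=> cf cg e e0.
pose A := N (f z) + 1; pose oball := N (g z) + 1.
have A0 : 0 < A by have := N_ge0 (f z); rewrite /A; lra.
have B0 : 0 < oball by have := N_ge0 (g z); rewrite /oball; lra.
have e1 : 0 < e / 2 / oball by rewrite !divr_gt0.
have e2 : 0 < e / 2 / A by rewrite !divr_gt0.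
have [r1 r10 h1] := cf _ e1; have [r2 r20 h2] := cg _ e2.
have [r3 r30 h3] := contc_bound cf.
exists (Num.min r1 (Num.min r2 r3)); first by rewrite !lt_min r10 r20.
move=> w; rewrite !lt_min => /and3P[/h1 k1 /h2 k2 /h3 k3].
have -> : f w * g w - f z * g z = f w * (g w - g z) + (f w - f z) * g z by ring.
apply: le_lt_trans (ND _ _) _; rewrite !NM.
have h4 : N (f w) * N (g w - g z) <= A * (e / 2 / A).
  by rewrite ler_pM ?N_ge0// ltW.
have h5 : N (f w - f z) * N (g z) < e / 2 / oball * oball.
  apply: le_lt_trans (_ : e / 2 / oball * N (g z) < _).
    by rewrite ler_pM ?N_ge0// ltW.
  by rewrite ltr_pM2l// /oball ltrDl.
have E1 : A * (e / 2 / A) = e / 2 by field; lra.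
have E2 : e / 2 / oball * oball = e / 2 by field; lra.
lra.
Qed.

Lemma contcN f z : contc f z -> contc (fun w => - f w) z.
Proof. by move=> cf e /cf[r r0 h]; exists r => // w /h; rewrite -opprB opprK NN addrC. Qed.

Lemma contcB f g z : contc f z -> contc g z -> contc (fun w => f w - g w) z.
Proof. by move=> cf cg; apply: contcD => //; exact: contcN. Qed.

Lemma contc_comp f g z : contc g z -> contc f (g z) -> contc (fun w => f (g w)) z.
Proof. by move=> cg cf e /cf[r /cg[r1 r10 h1] h]; exists r1 => // w /h1/h. Qed.

Lemma contc_inv z : z != 0 -> contc (fun w => w^-1) z.
Proof.
move=> z0 e e0; have Nz : 0 < N z by rewrite N_gt0.
exists (Num.min (N z / 2) (e * N z ^+ 2 / 2)).
  by rewrite lt_min; apply/andP; split; rewrite divr_gt0// mulr_gt0// exprn_gt0.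
move=> w; rewrite lt_min => /andP[h1 h2].
have Nw : N z / 2 < N w.
  have := NBr z w; rewrite NB; lra.
have w0 : w != 0 by rewrite -N_gt0; lra.
have -> : w^-1 - z^-1 = (z - w) * (w^-1 * z^-1) by field; apply/andP.
rewrite !NM !NV NB -invfM ltr_pdivrMr; last by rewrite mulr_gt0//; lra.
apply: lt_le_trans h2 _.
have -> : e * N z ^+ 2 / 2 = e * (N z / 2 * N z) by ring.
by rewrite ler_pM2l// ler_pM2r// ltW.
Qed.

Lemma contcV f z : f z != 0 -> contc f z -> contc (fun w => (f w)^-1) z.
Proof. by move=> f0 cf; apply: (contc_comp (f := fun w => w^-1)) => //; exact: contc_inv. Qed.

Lemma contcX f z n : contc f z -> contc (fun w => f w ^+ n) z.
Proof.
move=> cf; elim: n => [|n IH]; first exact: contc_cst.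
under eq_fun do rewrite exprS; exact: contcM.
Qed.

Lemma contc_near f g z r : 0 < r -> (forall w, N (w - z) < r -> g w = f w) ->
  contc f z -> contc g z.
Proof.
move=> r0 E cf e /cf[r1 r10 h]; exists (Num.min r r1); first by rewrite lt_min r0.
by move=> w; rewrite lt_min => /andP[/E -> /h]; rewrite E// subrr N0.
Qed.

Lemma hasd_contc f z d : hasd f z d -> contc f z.
Proof.
move=> [phi [cphi _] E]; suff : contc (fun w => phi w * (w - z) + f z) z.
  by apply: (@contc_near _ _ _ 1) => // w _; rewrite -E subrK.
apply: contcD; last exact: contc_cst.
by apply: contcM => //; apply: contcB; [exact: contc_id|exact: contc_cst].
Qed.

Lemma contc_lim_unique f g z : contc f z -> contc g z ->
  (forall w, w != z -> f w = g w) -> f z = g z.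
Proof.
move=> cf cg E; apply/eqP; rewrite -subr_eq0 -N_eq0; apply/eqP/le_anti.
rewrite N_ge0 andbT; apply/ler_addgt0Pr => e e0; rewrite add0r.
have [r r0 h] := contcB cf cg e0.
have /h : N (z + (r / 2)%:C - z) < r.
  by rewrite addrC addKr Nr ger0_norm; lra.
rewrite E ?subrr ?sub0r ?NN; first exact: ltW.
by rewrite -subr_eq0 addrC addKr -N_gt0 Nr normr_gt0; lra.
Qed.

Lemma hasd_unique f z d d' : hasd f z d -> hasd f z d' -> d = d'.
Proof.
move=> [p [cp <-] Ep] [q [cq <-] Eq]; apply: contc_lim_unique => // w wz.
by apply: (mulIf (x := w - z)); rewrite ?subr_eq0// -Ep -Eq.
Qed.

(** The identity in [hasd] is required for every [w], so the witness for [g] is its own difference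
    quotient completed by [d] at [z]; near [z] it agrees with the witness of [f]. *)
Lemma hasd_near f g z d r : 0 < r -> (forall w, N (w - z) < r -> g w = f w) ->
  hasd f z d -> hasd g z d.
Proof.
move=> r0 E [p [cp pz] Ep]; have gz : g z = f z by rewrite E// subrr N0.
exists (fun w => if w == z then d else (g w - g z) / (w - z)).
  split; last by rewrite eqxx.
  apply: contc_near r0 _ cp => w /E ->; case: eqVneq => [->//|wz].
  by rewrite gz Ep mulfK// subr_eq0.
move=> w; case: eqVneq => [->|wz]; first by rewrite !subrr mulr0.
by rewrite mulfVK// subr_eq0.
Qed.

Lemma hasd_cst d z : hasd (fun=> d) z 0.
Proof. by exists (fun=> 0) => [|w]; [split => //; exact: contc_cst|rewrite subrr mul0r]. Qed.

Lemma hasd_id z : hasd id z 1.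
Proof. by exists (fun=> 1) => [|w]; [split => //; exact: contc_cst|rewrite mul1r]. Qed.

Lemma hasdD f g z a b : hasd f z a -> hasd g z b -> hasd (fun w => f w + g w) z (a + b).
Proof.
move=> [p [cp <-] Ep] [q [cq <-] Eq]; exists (fun w => p w + q w).
  by split => //; exact: contcD.
by move=> w; rewrite mulrDl -Ep -Eq; ring.
Qed.

Lemma hasdN f z a : hasd f z a -> hasd (fun w => - f w) z (- a).
Proof.
move=> [p [cp <-] Ep]; exists (fun w => - p w).
  by split => //; exact: contcN.
by move=> w; rewrite mulNr -Ep; ring.
Qed.

Lemma hasdB f g z a b : hasd f z a -> hasd g z b -> hasd (fun w => f w - g w) z (a - b).
Proof. by move=> fa gb; apply: hasdD => //; exact: hasdN. Qed.

Lemma hasdM f g z a b : hasd f z a -> hasd g z b ->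
  hasd (fun w => f w * g w) z (a * g z + f z * b).
Proof.
move=> fa gb; have cf := hasd_contc fa.
move: fa gb => [p [cp <-] Ep] [q [cq <-] Eq]; exists (fun w => p w * g z + f w * q w).
  split => //; apply: contcD; apply: contcM => //; exact: contc_cst.
move=> w; rewrite mulrDl mulrAC -Ep -[f w * _ * _]mulrA -Eq; ring.
Qed.

Lemma hasdZ f z a c : hasd f z a -> hasd (fun w => c * f w) z (c * a).
Proof. by move=> fa; have := hasdM (hasd_cst c z) fa; rewrite mul0r add0r. Qed.

Lemma hasd_comp f g z a b : hasd g z b -> hasd f (g z) a ->
  hasd (fun w => f (g w)) z (a * b).
Proof.
move=> gb; have cg := hasd_contc gb; move: gb => [q [cq <-] Eq] [p [cp <-] Ep].
exists (fun w => p (g w) * q w).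
  by split => //; apply: contcM => //; exact: contc_comp.
by move=> w; rewrite -mulrA -Eq -Ep.
Qed.

Lemma hasdV f z a : f z != 0 -> hasd f z a -> hasd (fun w => (f w)^-1) z (- a / f z ^+ 2).
Proof.
move=> f0 fa; have cf := hasd_contc fa; have [r r0 hr] : exists2 r, 0 < r & forall w, N (w - z) < r -> f w != 0.
  have Nf : 0 < N (f z) by rewrite N_gt0.
  have [r r0 h] := cf _ Nf; exists r => // w /h; apply: contraTneq => ->.
  by rewrite sub0r NN ltxx.
move: fa => [p [cp <-] Ep].
(* Zeros of [f] far from [z] would spoil the global identity; there [g] repeats its value at [z] and
   the slope is 0. *)
pose g w := if f w == 0 then (f z)^-1 else (f w)^-1.
suff : hasd g z (- p z / f z ^+ 2).
  apply: hasd_near r0 _ => w /hr fw; by rewrite /g (negPf fw).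
have cg : contc g z.
  apply: (contc_near (f := fun w => (f w)^-1)) r0 _ _; last exact: contcV.
  by move=> w /hr fw; rewrite /g (negPf fw).
exists (fun w => if f w == 0 then 0 else - p w * (g w * (f z)^-1)).
  split; last by rewrite (negPf f0) /g (negPf f0) -invfM.
  apply: (contc_near (f := fun w => - p w * (g w * (f z)^-1))) r0 _ _.
    by move=> w /hr fw; rewrite (negPf fw).
  apply: contcM; first exact: contcN.
  by apply: contcM => //; exact: contc_cst.
move=> w; rewrite /g (negPf f0); case: eqVneq => fw; first by rewrite subrr mul0r.
rewrite mulrAC mulNr -Ep; field; exact/andP.
Qed.

Lemma hasdX f z a n : hasd f z a ->
  hasd (fun w => f w ^+ n) z (n%:R * f z ^+ n.-1 * a).
Proof.
move=> fa; elim: n => [|n IH].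
  by rewrite mul0r mul0r; under eq_fun do rewrite expr0; exact: hasd_cst.
under eq_fun do rewrite exprS.
have := hasdM fa IH; congr (hasd _ _ _).
case: n {IH} => [|n]; first by rewrite /= expr0; ring.
by rewrite /= !exprS -[n.+2%:R]natr1; ring.
Qed.

Lemma hasd_eps f z d : hasd f z d -> forall e, 0 < e -> exists2 r, 0 < r &
  forall w, N (w - z) < r -> N (f w - f z - d * (w - z)) <= e * N (w - z).
Proof.
move=> [p [cp <-] E] e /cp[r r0 h]; exists r => // w wr.
by rewrite E -mulrBl NM ler_wpM2r ?N_ge0// ltW// h.
Qed.

Lemma eps_hasd f z d : (forall e, 0 < e -> exists2 r, 0 < r &
  forall w, N (w - z) < r -> N (f w - f z - d * (w - z)) <= e * N (w - z)) ->
  hasd f z d.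
Proof.
move=> H; exists (fun w => if w == z then d else (f w - f z) / (w - z)).
  split; last by rewrite eqxx.
  move=> e e0; have e20 : 0 < e / 2 by lra.
  have [r r0 h] := H _ e20; exists r => // w wr; rewrite eqxx.
  case: eqVneq => wz; first by rewrite subrr N0.
  have wz0 : 0 < N (w - z) by rewrite N_gt0 subr_eq0.
  have -> : (f w - f z) / (w - z) - d = (f w - f z - d * (w - z)) / (w - z).
    by field; rewrite subr_eq0.
  rewrite NM NV ltr_pdivrMr//; apply: le_lt_trans (h _ wr) _.
  by rewrite ltr_pM2r//; lra.
move=> w; case: eqVneq => [->|wz]; first by rewrite !subrr mulr0.
by rewrite mulfVK// subr_eq0.
Qed.

(** A total function, with default value 0 where [f] has no derivative. *)
Definition dv f z := xget 0 [set d | hasd f z d].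
Lemma dvE f z d : hasd f z d -> dv f z = d.
Proof. by move=> h; apply: (hasd_unique (f := f) (z := z)) => //; rewrite /dv; case: xgetP => // /(_ d). Qed.

End Calculus.

(** * Comparison with the neighbourhoods and derivatives of the library *)

Section Bridge.
Variable R : realType.
Notation C := R[i].
Implicit Types (f g : C -> C) (z w a b d : C) (r e : R).
(** The order of [C] only compares numbers with equal imaginary parts, so a positive one is real.
    This turns radii and tolerances taken in [C] into real numbers. *)
Lemma posC (e : C) : 0 < e -> exists2 r : R, 0 < r & e = r%:C.
Proof.
move=> e0; have := e0; rewrite ltcE /= => /andP[/eqP h1 h2]; exists (Re e) => //.
by apply/eqP; rewrite eq_complex /= h1 !eqxx.
Qed.

Lemma nbhsCP (A : set C) z : nbhs z A <-> exists2 r : R, 0 < r & forall w, N (w - z) < r -> A w.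
Proof.
split.
  move=> /nbhs_ballP[e /= /posC[r r0 ->]] h; exists r => // w wr; apply: h.
  by rewrite /ball /= normCE ltcR NB.
move=> [r r0 h]; apply/nbhs_ballP; exists r%:C => /=; first by rewrite ltcR.
by move=> w; rewrite /ball /= normCE ltcR NB => /h.
Qed.

Lemma cvg_quot_hasd f z d : ((fun h : C => h^-1 *: (f (h + z) - f z)) @ 0^' --> d) <-> hasd f z d.
Proof.
split.
  move=> /cvgrPdist_lt H; apply: eps_hasd => e e0.
  have /H : 0 < e%:C by rewrite ltcR.
  rewrite /dnbhs /within /= => /nbhsCP[r r0 h]; exists r => // w wr.
  have [->|wz] := eqVneq w z; first by rewrite !subrr mulr0 subrr N0 mulr0.
  have /h : N (w - z - 0) < r by rewrite subr0.
  rewrite subr_eq0 => /(_ wz); rewrite subrK normCE ltcR => /ltW hh.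
  have wz' : w - z != 0 by rewrite subr_eq0.
  have -> : f w - f z - d * (w - z) = - ((d - (w - z)^-1 *: (f w - f z)) * (w - z)).
    rewrite /GRing.scale /= mulrBl mulrAC mulVf//; ring.
  by rewrite NN NM ler_wpM2r ?N_ge0.
move=> /hasd_eps H; apply/cvgrPdist_lt => _ /posC[e e0 ->].
have e20 : 0 < e / 2 by lra.
have [r r0 h] := H _ e20; rewrite /dnbhs /within /=; apply/nbhsCP; exists r => // w.
rewrite subr0 => wr w0; rewrite normCE ltcR.
have /h : N (w + z - z) < r by rewrite addrK.
rewrite addrK => hh.
have -> : d - w^-1 *: (f (w + z) - f z) = - ((f (w + z) - f z - d * w) / w).
  by rewrite /GRing.scale /=; field.
have w0' : 0 < N w by rewrite N_gt0.
rewrite NN NM NV ltr_pdivrMr//; apply: le_lt_trans hh _.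
by rewrite ltr_pM2r//; lra.
Qed.

Lemma derivable_hasd f z : derivable f z 1 -> exists d, hasd f z d.
Proof.
move=> /cvg_ex[d H]; exists d; apply/cvg_quot_hasd; move: H.
rewrite (_ : (fun h : C => _) = (fun h : C => h^-1 *: (f (h + z) - f z)))//.
by apply/funext => h /=; rewrite /GRing.scale/= mulr1.
Qed.

Lemma derive1_hasd f z d : hasd f z d -> derive1 f z = d.
Proof. move=> /cvg_quot_hasd H; rewrite /derive1; by apply: (cvg_lim _ H); exact: norm_hausdorff. Qed.
End Bridge.

(** * Compactness in the plane *)

Section Topology.
Variable R : realType.
Notation C := R[i].
Implicit Types (z w a b : C) (r e : R).

Lemma openCP (A : set C) : open A <->
  forall z, A z -> exists2 r : R, 0 < r & forall w, N (w - z) < r -> A w.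
Proof. by rewrite openE; split => h z /h; rewrite /interior => /nbhsCP. Qed.

Lemma closedCP (A : set C) :
  (forall z, (forall r, 0 < r -> exists2 w, N (w - z) < r & A w) -> A z) -> closed A.
Proof.
move=> h z clz; apply: h => r r0.
have [|w [Aw /= wr]] := clz [set w | N (w - z) < r]; last by exists w.
by apply/nbhsCP; exists r.
Qed.

(** A closed subset of the image of a square of half-side [|a| + r] under the continuous bijection
    from the real plane to [C]. *)
Lemma cball_compact a r : compact [set z : C | N (z - a) <= r].
Proof.
pose M := N a + r.
pose S := ([set` `[- M, M]] `*` [set` `[- M, M]] : set (R * R)).
have cS : compact S by apply: compact_setX; exact: segment_compact.
have cf : continuous (fun p : R * R => (p.1 +i* p.2 : C)).
  move=> p; apply/cvgrPdist_lt => _ /posC[e e0 ->].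
  have /cvgrPdist_lt h1 : q.1 @[q --> p] --> p.1 by exact: cvg_fst.
  have /cvgrPdist_lt h2 : q.2 @[q --> p] --> p.2 by exact: cvg_snd.
  have e20 : 0 < e / 2 by lra.
  have : \forall t \near p, `|p.1 - t.1| < e / 2 /\ `|p.2 - t.2| < e / 2.
    by apply: filterI; [exact: h1|exact: h2].
  apply: filterS => -[x y] /= [{}h1 {}h2]; rewrite normCE ltcR.
  apply: le_lt_trans (N_le_ReIm _) _ => /=; lra.
have cI : compact ((fun p : R * R => (p.1 +i* p.2 : C)) @` S).
  by apply: continuous_compact => //; apply: continuous_subspaceT.
apply: (subclosed_compact _ cI).
  apply: closedCP => z h /=; apply/ler_addgt0Pr => e /h[w wz /= wa].
  by have := NDB z a w; rewrite NB in wz; lra.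
move=> z /= za; exists (Re z, Im z); last by case: z {za}.
have Nz : N z <= M by have := NBr z a; rewrite /M; lra.
have := le_Re z; have := le_Im z.
by rewrite /S /= !in_itv /= -!ler_norml; split; lra.
Qed.

(** [Q z d] records what makes the radius [d] good at [z]; the finite list of balls keeps this
    information for each of its members. *)
Lemma compact_fin_cover (K : set C) (Q : C -> R -> Prop) : compact K ->
  (forall z, K z -> exists2 d, 0 < d & Q z d) ->
  exists s : seq (C * R), (forall p, p \in s -> [/\ K p.1, 0 < p.2 & Q p.1 p.2]) /\
   forall z, K z -> exists2 p, p \in s & N (z - p.1) < p.2.
Proof.
move=> cK H; have /choice[d hd] : forall z, exists r, K z -> 0 < r /\ Q z r.
  by move=> z; have [/H[r r0 Qr]|nK] := pselect (K z); [exists r|exists 0].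
move: cK; rewrite compact_cover => /(_ _ K (fun z => [set w | N (w - z) < d z])).
case.
- move=> z _; apply/openCP => w /= wz; exists (d z - N (w - z)); first lra.
  by move=> v vw; have := NDB v z w; lra.
- by move=> z Kz; exists z => //=; rewrite subrr N0; apply: (hd z Kz).1.
move=> D' sD cov; exists [seq (z, d z) | z <- finmap.enum_fset D']; split.
  move=> p /mapP[z zD ->] /=; have Kz : K z by have := sD _ zD; rewrite inE.
  by split => //; have [] := hd z Kz.
move=> z /cov[w /= wD wz]; exists (w, d w) => //; apply/mapP; by exists w.
Qed.

(** The embedding into [C] lets real functions inherit the algebra of [contc]. *)
Definition contr (u : C -> R) z := contc (fun w => (u w)%:C) z.

Lemma contrP (u : C -> R) z : contr u z <-> forall e, 0 < e -> exists2 r, 0 < r &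
  forall w, N (w - z) < r -> `|u w - u z| < e.
Proof.
by split => h e /h[r r0 H]; exists r => // w /H; rewrite -rmorphB Nr.
Qed.

Lemma contrN (f : C -> C) z : contc f z -> contr (fun w => N (f w)) z.
Proof.
move=> cf; apply/contrP => e /cf[r r0 h]; exists r => // w /h.
have := NBr (f w) (f z); have := NBr (f z) (f w); rewrite [N (f z - _)]NB.
rewrite ltr_norml; lra.
Qed.

Lemma contrD u v z : contr u z -> contr v z -> contr (fun w => u w + v w) z.
Proof. by move=> cu cv; have := contcD cu cv; congr contc; apply/funext => w; rewrite rmorphD. Qed.
Lemma contrM u v z : contr u z -> contr v z -> contr (fun w => u w * v w) z.
Proof. by move=> cu cv; have := contcM cu cv; congr contc; apply/funext => w; rewrite rmorphM. Qed.
Lemma contr_cst x z : contr (fun=> x) z.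
Proof. exact: contc_cst. Qed.
Lemma contrB u v z : contr u z -> contr v z -> contr (fun w => u w - v w) z.
Proof. by move=> cu cv; have := contcB cu cv; congr contc; apply/funext => w; rewrite rmorphB. Qed.

Lemma cball_max a r (u : C -> R) : 0 <= r -> (forall z, N (z - a) <= r -> contr u z) ->
  exists2 c, N (c - a) <= r & forall z, N (z - a) <= r -> u z <= u c.
Proof.
move=> r0 cu; have [||c] := @compact_EVT_max _ R u _ _ (@cball_compact a r).
- by exists a; rewrite /= subrr N0.
- apply: continuous_in_subspaceT => z; rewrite inE /= => /cu /contrP h.
  move=> A /nbhs_ballP[e /h[d d0 hd] sA]; apply/nbhsCP; exists d => // w /hd wd.
  by apply: sA; rewrite /ball /= distrC.
by rewrite inE /= => ca h; exists c => // z za; apply: h; rewrite inE.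
Qed.

(** Heine-Cantor, where [w] may lie slightly outside the ball. The radius in [Q] is doubled so that
    a point near [z] is still good for the centre whose ball covers [z]. *)
Lemma cball_unif a r (f : C -> C) : (forall z, N (z - a) <= r -> contc f z) ->
  forall e, 0 < e -> exists2 d, 0 < d & forall z w, N (z - a) <= r -> N (w - z) < d ->
    N (f w - f z) < e.
Proof.
move=> cf e e0; have e20 : 0 < e / 2 by lra.
pose Q z d := forall w, N (w - z) < 2 * d -> N (f w - f z) < e / 2.
have [z /= /cf/(_ _ e20)[d d0 h]|s [sP cov]] := compact_fin_cover (Q := Q) (@cball_compact a r).
  by exists (d / 2); [lra|move=> w wz; apply: h; lra].
have [d d0 hd] : exists2 d, 0 < d & forall p, p \in s -> d <= p.2.
  have {cov} : forall p, p \in s -> 0 < p.2 by move=> p /sP[].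
  elim: s {sP} => [_|p s IH h]; first by exists 1.
  have [|d d0 hd] := IH; first by move=> q qs; apply: h; rewrite inE qs orbT.
  exists (Num.min p.2 d); first by rewrite lt_min d0 h// mem_head.
  by move=> q; rewrite inE => /orP[/eqP ->|/hd]; rewrite ge_min ?lexx// => ->; rewrite orbT.
exists d => // z w /cov[p /[dup] /hd dp /sP[_ _ h]] zp wz.
have h1 : N (f z - f p.1) < e / 2 by apply: h; have := N_ge0 (z - p.1); lra.
have h2 : N (f w - f p.1) < e / 2 by apply: h; have := NDB w p.1 z; lra.
have := NDB (f w) (f z) (f p.1); rewrite [N (f p.1 - _)]NB; lra.
Qed.

(** The image of an ultrafilter is an ultrafilter, hence converges in a compact ball. No subsequence
    is chosen, so one [U] gives limits of all bounded sequences simultaneously and replaces diagonal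
    extraction. *)
Lemma ultra_lim (U : set_system nat) (x : nat -> C) r : UltraFilter U ->
  U [set n | N (x n) <= r] ->
  exists2 l, N l <= r & forall e, 0 < e -> U [set n | N (x n - l) < e].
Proof.
move=> UU Ur; have := @cball_compact 0 r; rewrite compact_ultra => /(_ (x @ U)).
case=> [|/=|l].
- split; first by apply: fmap_proper_filter.
  move=> G PG sG; apply/seteqP; split=> [A GA|]; last exact: sG.
  case: (in_ultra_setVsetC (x @^-1` A) UU) => // h.
  have /sG : (x @ U) (~` A) by [].
  move=> GnA; by have [y /= []] := filter_ex (filterI GA GnA).
- by apply: filterS Ur => n /=; rewrite subr0.
case; rewrite /= subr0 => lr /cvgrPdist_lt h; exists l => // e e0.
have /h : 0 < e%:C by rewrite ltcR.
by apply: filterS => n; rewrite normCE ltcR NB.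
Qed.

Lemma nat_ultra : exists2 U : set_system nat, UltraFilter U & \oo `<=` U.
Proof.
by have [U [UU sU]] := ultraFilterLemma (eventually_filter); exists U.
Qed.

(** Completeness deduced from compactness: a Cauchy sequence is bounded, and it converges to its
    limit along an ultrafilter. *)
Lemma seq_clim (x : nat -> C) :
  (forall e, 0 < e -> exists n0, forall m n, (n0 <= m)%N -> (n0 <= n)%N -> N (x m - x n) <= e) ->
  exists l, forall e, 0 < e -> exists n0, forall n, (n0 <= n)%N -> N (x n - l) <= e.
Proof.
move=> H; have [U UU sU] := nat_ultra.
have inU n0 : U [set n | (n0 <= n)%N] by apply: sU; exists n0.
have [n0 h0] := H 1 ltr01.
have [|l _ hl] := @ultra_lim U x (N (x n0) + 1) UU.
  apply: filterS (inU n0) => n /= n0n; have := NBr (x n) (x n0).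
  have := h0 _ _ n0n (leqnn n0); lra.
exists l => e e0; have e20 : 0 < e / 2 by lra.
have [n1 h1] := H _ e20; exists n1 => n n1n.
have [m /= [mn xm]] := filter_ex (filterI (inU n1) (hl _ e20)).
have := h1 _ _ n1n mn; have := NDB (x n) l (x m); lra.
Qed.

End Topology.

(** * Derivatives along the unit interval *)

Section UnitInterval.
Variable R : realType.
Notation C := R[i].
Implicit Types (u G : R -> C) (t s e r M : R).

Definition in01 t := (0 <= t <= 1).

Definition cont01 u := forall t, in01 t -> forall e, 0 < e -> exists2 r, 0 < r &
  forall s, in01 s -> `|s - t| < r -> N (u s - u t) < e.

(** The derivative relative to [[0, 1]], one-sided at the end points. *)
Definition hasd01 G t (v : C) := forall e, 0 < e -> exists2 r, 0 < r &
  forall s, in01 s -> `|s - t| < r -> N (G s - G t - v * (s - t)%:C) <= e * `|s - t|.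

(** A function with values in [C] has no intermediate point as in Lagrange's theorem. Instead, let
    [t0] be the supremum of the [t] up to which the increment from 0 grows at most at the rate
    [M + e]; then [t0] is reached and equals 1. *)
Lemma mean_value01 G u M : (forall t, in01 t -> hasd01 G t (u t)) ->
  (forall t, in01 t -> N (u t) <= M) -> N (G 1 - G 0) <= M.
Proof.
move=> dG uM; apply/ler_addgt0Pr => e e0.
pose K := M + e.
have loc t : in01 t -> exists2 r, 0 < r & forall s, in01 s -> `|s - t| < r ->
    N (G s - G t) <= K * `|s - t|.
  move=> t01; have [r r0 h] := dG t t01 e e0; exists r => // s s01 /(h s s01) h1.
  have -> : G s - G t = (G s - G t - u t * (s - t)%:C) + u t * (s - t)%:C by ring.
  apply: le_trans (ND _ _) _; rewrite NM Nr /K mulrDl addrC lerD//.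
  by rewrite ler_wpM2r// uM.
pose P s := N (G s - G 0) <= K * s.
pose S := [set t | in01 t /\ forall s, 0 <= s <= t -> P s].
have S0 : S 0.
  split; first by rewrite /in01 lexx ler01.
  by move=> s /le_anti <-; rewrite /P subrr N0 mulr0.
have hS : has_sup S by split; [exists 0|exists 1 => t [/andP[]]].
pose t0 := sup S.
have t01 : in01 t0.
  apply/andP; split; first by exact: (sup_upper_bound hS).
  by apply: ge_sup; [exists 0|move=> t [/andP[]]].
have [r r0 h] := loc _ t01.
have [t1 [t1S1 t1S2] t1t0] := @sup_adherent _ S r r0 hS.
rewrite -/t0 in t1t0.
have t1le : t1 <= t0 by exact: (sup_upper_bound hS).
have Pt1 : P t1 by apply: t1S2; move/andP: t1S1 => [-> _] /=.
(* The bound crosses [t0]: since [t1 <= t0 <= s], the two local increments at [t0] add up to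
   [K (s - t1)], and [P t1] accounts for the rest. *)
have ext s : in01 s -> t0 <= s -> s < t0 + r -> P s.
  move=> s01 t0s sr; rewrite /P.
  have hs : N (G s - G t0) <= K * `|s - t0| by apply: h => //; rewrite ger0_norm; lra.
  have ht1 : N (G t1 - G t0) <= K * `|t1 - t0|.
    by apply: h => //; rewrite ler0_norm; lra.
  rewrite ger0_norm ?subr_ge0// in hs; rewrite ler0_norm ?subr_le0// in ht1.
  have -> : G s - G 0 = (G s - G t0) + (- (G t1 - G t0) + (G t1 - G 0)) by ring.
  apply: le_trans (ND _ _) _; apply: le_trans (lerD hs (ND _ _)) _; rewrite NN.
  have := Pt1; rewrite /P; lra.
have St s : in01 s -> t0 <= s -> s < t0 + r -> S s.
  move=> s01 t0s sr; split => // v /andP[v0 vs].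
  have v01 : in01 v by move: s01; rewrite /in01; lra.
  have [vt|tv] := ltP v t0; last by apply: ext => //; lra.
  have tv0 : 0 < t0 - v by lra.
  have [t2 [_ h2] vt2] := @sup_adherent _ S (t0 - v) tv0 hS.
  by apply: h2; rewrite v0/= ltW//; move: vt2; rewrite -/t0; lra.
have t0E : t0 = 1.
  apply/eqP; rewrite eq_le; have /andP[t00 ->] := t01 => /=; rewrite leNgt; apply/negP => t0lt.
  pose s := Num.min 1 (t0 + r / 2).
  have st : t0 < s by rewrite lt_min t0lt; lra.
  have s1 : s <= 1 by rewrite ge_min lexx.
  have s2 : s <= t0 + r / 2 by rewrite ge_min lexx orbT.
  have : S s by apply: St; rewrite /in01; lra.
  move=> Ss; have : s <= t0 by exact: (sup_upper_bound hS).
  lra.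
have : P 1 by apply: ext; rewrite ?t0E /in01; lra.
by rewrite /P mulr1.
Qed.

Lemma hasd01B G G' t v v' : hasd01 G t v -> hasd01 G' t v' ->
  hasd01 (fun s => G s - G' s) t (v - v').
Proof.
move=> h h' e e0; have e20 : 0 < e / 2 by lra.
have [r r0 k] := h _ e20; have [r' r'0 k'] := h' _ e20.
exists (Num.min r r'); first by rewrite lt_min r0.
move=> s s01; rewrite lt_min => /andP[/(k _ s01) k1 /(k' _ s01) k2].
have -> : G s - G' s - (G t - G' t) - (v - v') * (s - t)%:C =
  (G s - G t - v * (s - t)%:C) - (G' s - G' t - v' * (s - t)%:C) by ring.
apply: le_trans (ND _ _) _; rewrite NN; lra.
Qed.

Lemma real_antiderivative (f : R -> R) : continuous f ->
  exists F : R -> R, forall t, in01 t -> derivable F t 1 /\ derive1 F t = f t.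
Proof.
move=> cf; exists (fun x => \int[@lebesgue_measure R]_(t in `[-1, x]) f t)%R => t /andP[t0 t1].
apply: (@continuous_FTC1_closed R f (-1) t 2).
- lra.
- apply: continuous_compact_integrable; first exact: segment_compact.
  exact: continuous_subspaceT.
- lra.
- exact: cf.
Qed.

Lemma real_derive_eps (F : R -> R) t : derivable F t 1 -> forall e, 0 < e ->
  exists2 r, 0 < r & forall s, `|s - t| < r ->
   `|F s - F t - derive1 F t * (s - t)| <= e * `|s - t|.
Proof.
move=> dF e e0; have : (fun h => h^-1 *: (F (h + t) - F t)) @ 0^' --> derive1 F t.
  have := dF; rewrite /derivable => /cvg_ex[l].
  rewrite (_ : (fun h : R => _) = (fun h => h^-1 *: (F (h + t) - F t))); last first.
    by apply/funext => h /=; rewrite /GRing.scale/= mulr1.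
  move=> H; suff -> : derive1 F t = l by [].
  by rewrite /derive1; apply: cvg_lim H; exact: norm_hausdorff.
move=> /cvgrPdist_lt/(_ e e0); rewrite /dnbhs /within /= => /nbhs_ballP[r /= r0 h].
exists r => // s sr; have [->|st] := eqVneq s t.
  by rewrite !subrr mulr0 subrr normr0 mulr0.
have st' : s - t != 0 by rewrite subr_eq0.
have := h (s - t); rewrite /ball /= sub0r normrN => /(_ sr st') /ltW.
rewrite subrK /GRing.scale /= => hh.
have -> : F s - F t - derive1 F t * (s - t) = - ((derive1 F t - (s - t)^-1 * (F s - F t)) * (s - t)).
  by field.
by rewrite normrN normrM ler_wpM2r.
Qed.

Lemma antiderivative01 u : cont01 u -> exists G, forall t, in01 t -> hasd01 G t (u t).
Proof.
move=> cu.
(* Composition with the 1-Lipschitz retraction onto [[0, 1]] extends [u] continuously to the line;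
   real and imaginary parts are then integrated separately. *)
pose cl t := Num.max 0 (Num.min 1 t).
have cl01 t : in01 (cl t) by rewrite /in01 le_max lexx ge_max ler01 ge_min lexx.
have clid t : in01 t -> cl t = t.
  by move=> /andP[t0 t1]; rewrite /cl (min_idPr t1) (max_idPr t0).
have cllip s t : `|cl s - cl t| <= `|s - t|.
  have n1 := ler_norm (s - t); have n2 := ler_norm (t - s); rewrite distrC in n2.
  rewrite /cl ler_norml.
  have [s1|s1] := leP 1 s; have [t1|t1] := leP 1 t; rewrite ?(max_idPr ler01).
  - by lra.
  - by have [t0|t0] := leP 0 t; lra.
  - by have [s0|s0] := leP 0 s; lra.
  - by have [s0|s0] := leP 0 s; have [t0|t0] := leP 0 t; lra.
have cv (p : C -> R) (pM : forall z w, `|p z - p w| <= N (z - w)) : continuous (p \o u \o cl).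
  move=> t; apply/cvgrPdist_lt => e /(cu _ (cl01 t))[r r0 h].
  apply/nbhs_ballP; exists r => //= s; rewrite /ball /= => st.
  rewrite distrC; apply: le_lt_trans (pM _ _) _; apply: h => //.
  by apply: le_lt_trans (cllip _ _) _; rewrite distrC.
have [F hF] := real_antiderivative (cv (@complex.Re R) (fun z w => ltac:(have := le_Re (z - w); by case: z; case: w))).
have [H hH] := real_antiderivative (cv (@complex.Im R) (fun z w => ltac:(have := le_Im (z - w); by case: z; case: w))).
exists (fun t => F t +i* H t) => t t01 e e0.
have e20 : 0 < e / 2 by lra.
have [dF EF] := hF t t01; have [dH EH] := hH t t01.
have [r r0 h] := real_derive_eps dF e20; have [r' r'0 h'] := real_derive_eps dH e20.
exists (Num.min r r'); first by rewrite lt_min r0.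
move=> s s01; rewrite lt_min => /andP[/h + /h']; rewrite EF EH /= clid//.
case: (u t) => a b k k'; rewrite /= in k k'; apply: le_trans (N_le_ReIm _) _ => /=.
have -> : F s - F t - (a * (s - t) - b * 0) = F s - F t - a * (s - t) by ring.
have -> : H s - H t - (a * 0 + b * (s - t)) = H s - H t - b * (s - t) by ring.
lra.
Qed.

(** This makes the segment integral independent of the primitive that defines it. *)
Lemma hasd01_unique_increment G G' u :
  (forall t, in01 t -> hasd01 G t (u t)) -> (forall t, in01 t -> hasd01 G' t (u t)) ->
  G 1 - G 0 = G' 1 - G' 0.
Proof.
move=> h h'; apply/eqP; rewrite -subr_eq0 -N_eq0; apply/eqP/le_anti.
rewrite N_ge0 andbT.
have -> : G 1 - G 0 - (G' 1 - G' 0) = (G 1 - G' 1) - (G 0 - G' 0) by ring.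
apply: (@mean_value01 (fun s => G s - G' s) (fun t => u t - u t)).
  by move=> t t01; apply: hasd01B; [exact: h|exact: h'].
by move=> t _; rewrite subrr N0.
Qed.

Lemma hasd_hasd01 (F : C -> C) (a b : C) (d : C) t :
  hasd F (a + (b - a) * t%:C) d ->
  hasd01 (fun s => F (a + (b - a) * s%:C)) t (d * (b - a)).
Proof.
move=> /hasd_eps h e e0.
have K0 : 0 < N (b - a) + 1 by have := N_ge0 (b - a); lra.
have [|r r0 k] := h (e / (N (b - a) + 1)); first by rewrite divr_gt0.
exists (r / (N (b - a) + 1)); first by rewrite divr_gt0.
move=> s _ st.
have E : a + (b - a) * s%:C - (a + (b - a) * t%:C) = (b - a) * (s - t)%:C.
  by rewrite rmorphB; ring.
have le1 : N ((b - a) * (s - t)%:C) <= (N (b - a) + 1) * `|s - t|.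
  by rewrite NM Nr ler_wpM2r//; lra.
have := k (a + (b - a) * s%:C); rewrite E => /(_ _).
have lt1 : N ((b - a) * (s - t)%:C) < r.
  by apply: le_lt_trans le1 _; rewrite mulrC -ltr_pdivlMr.
move=> /(_ lt1); rewrite mulrA => hh; apply: le_trans hh _.
apply: le_trans (_ : e / (N (b - a) + 1) * ((N (b - a) + 1) * `|s - t|) <= _).
  by rewrite ler_wpM2l// divr_ge0// ltW.
by rewrite mulrA divfK//; lra.
Qed.

End UnitInterval.

(** * Segment integrals *)

Section Segments.
Variable R : realType.
Notation C := R[i].
Implicit Types (f g F : C -> C) (z w a b c o d : C) (t s e r M : R) (S : set C).

Definition oball (a : C) (r : R) : set C := [set z | N (z - a) < r].
Definition cball (a : C) (r : R) : set C := [set z | N (z - a) <= r].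

Definition cvx S := forall z w t, S z -> S w -> in01 t -> S (z + (w - z) * t%:C).

Lemma norm_cvx a z w t r : in01 t -> N (z - a) <= r -> N (w - a) <= r ->
  N (z + (w - z) * t%:C - a) <= r.
Proof.
move=> /andP[t0 t1] zr wr.
have -> : z + (w - z) * t%:C - a = (z - a) * (1 - t)%:C + (w - a) * t%:C.
  by rewrite rmorphB rmorph1; ring.
apply: le_trans (ND _ _) _; rewrite !NM !Nr (ger0_norm t0) ger0_norm ?subr_ge0//.
have h1 : N (z - a) * (1 - t) <= r * (1 - t) by rewrite ler_wpM2r// subr_ge0.
have h2 : N (w - a) * t <= r * t by rewrite ler_wpM2r.
lra.
Qed.

Lemma cvx_cball a r : cvx (cball a r).
Proof. by move=> z w t /= zr wr t01; exact: norm_cvx. Qed.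

Lemma cvx_oball a r : cvx (oball a r).
Proof.
move=> z w t /= zr wr t01.
apply: le_lt_trans (_ : Num.max (N (z - a)) (N (w - a)) < r).
  by apply: norm_cvx => //; rewrite le_max lexx ?orbT.
by rewrite gt_max zr.
Qed.

Lemma mean_value S f f' M z w : cvx S -> (forall x, S x -> hasd f x (f' x)) ->
  (forall x, S x -> N (f' x) <= M) -> S z -> S w -> N (f w - f z) <= M * N (w - z).
Proof.
move=> cS df fM Sz Sw.
have := @mean_value01 _ (fun s => f (z + (w - z) * s%:C))
  (fun t => f' (z + (w - z) * t%:C) * (w - z)) (M * N (w - z)).
rewrite rmorph1 rmorph0 mulr1 mulr0 addr0 subrKC; apply.
  by move=> t t01; apply: hasd_hasd01; apply: df; exact: cS.
by move=> t t01; rewrite NM ler_wpM2r ?N_ge0// fM//; exact: cS.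
Qed.

Definition is_seg_prim f a b (G : R -> C) :=
  forall t, in01 t -> hasd01 G t (f (a + (b - a) * t%:C) * (b - a)).

(** The integral is the increment of a primitive of the parametrized integrand, so linearity,
    subdivision and bounds become statements about derivatives. The default value is 0 when there is
    no primitive. *)
Definition seg_int f a b := xget 0 [set v | exists2 G, is_seg_prim f a b G & v = G 1 - G 0].

Lemma seg_intE f a b G : is_seg_prim f a b G -> seg_int f a b = G 1 - G 0.
Proof.
move=> hG; rewrite /seg_int; case: xgetP => [v _ [G' hG' ->]|/(_ (G 1 - G 0)) []].
  exact: hasd01_unique_increment hG' hG.
by exists G.
Qed.

Lemma seg_prim_ex S f a b : cvx S -> (forall z, S z -> contc f z) -> S a -> S b ->
  exists G, is_seg_prim f a b G.
Proof.
move=> cS cf Sa Sb; apply: antiderivative01 => t t01 e e0.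
have cg : contc (fun z => f z * (b - a)) (a + (b - a) * t%:C).
  by apply: contcM; [apply: cf; exact: cS|exact: contc_cst].
have [r r0 h] := cg e e0.
have K0 : 0 < N (b - a) + 1 by have := N_ge0 (b - a); lra.
exists (r / (N (b - a) + 1)); first by rewrite divr_gt0.
move=> s _ st; apply: h.
have -> : a + (b - a) * s%:C - (a + (b - a) * t%:C) = (b - a) * (s - t)%:C.
  by rewrite rmorphB; ring.
rewrite NM Nr; apply: le_lt_trans (_ : (N (b - a) + 1) * `|s - t| < _).
  by rewrite ler_wpM2r//; lra.
by rewrite mulrC -ltr_pdivlMr.
Qed.

Lemma seg_int_prim S f F a b : cvx S -> (forall z, S z -> hasd F z (f z)) -> S a -> S b ->
  seg_int f a b = F b - F a.
Proof.
move=> cS dF Sa Sb; rewrite (@seg_intE _ _ _ (fun s => F (a + (b - a) * s%:C))).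
  by rewrite rmorph1 rmorph0 mulr1 mulr0 addr0 subrKC.
by move=> t t01; apply: hasd_hasd01; apply: dF; exact: cS.
Qed.

Lemma is_seg_primB f g a b G H : is_seg_prim f a b G -> is_seg_prim g a b H ->
  is_seg_prim (fun z => f z - g z) a b (fun t => G t - H t).
Proof. by move=> hG hH t t01; rewrite mulrBl; apply: hasd01B; [exact: hG|exact: hH]. Qed.

Lemma seg_intB S f g a b : cvx S -> (forall z, S z -> contc f z) -> (forall z, S z -> contc g z) ->
  S a -> S b -> seg_int (fun z => f z - g z) a b = seg_int f a b - seg_int g a b.
Proof.
move=> cS cf cg Sa Sb; have [G hG] := seg_prim_ex cS cf Sa Sb; have [H hH] := seg_prim_ex cS cg Sa Sb.
rewrite (seg_intE hG) (seg_intE hH) (seg_intE (is_seg_primB hG hH)); ring.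
Qed.

Lemma seg_int_bound S f a b M : cvx S -> (forall z, S z -> contc f z) -> S a -> S b ->
  (forall t, in01 t -> N (f (a + (b - a) * t%:C)) <= M) -> N (seg_int f a b) <= M * N (b - a).
Proof.
move=> cS cf Sa Sb fM; have [G hG] := seg_prim_ex cS cf Sa Sb; rewrite (seg_intE hG).
by apply: mean_value01 hG _ => t t01; rewrite NM ler_wpM2r ?N_ge0// fM.
Qed.

Lemma hasd01_affine G (p q t : R) (v : C) : (forall s, in01 s -> in01 (p + q * s)) ->
  hasd01 G (p + q * t) v -> hasd01 (fun s => G (p + q * s)) t (v * q%:C).
Proof.
move=> pq h e e0; have K0 : 0 < `|q| + 1 by have := normr_ge0 q; lra.
have [|r r0 k] := h (e / (`|q| + 1)); first by rewrite divr_gt0.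
exists (r / (`|q| + 1)); first by rewrite divr_gt0.
move=> s /pq s01 st; have E : p + q * s - (p + q * t) = q * (s - t) by ring.
have le1 : `|q * (s - t)| <= (`|q| + 1) * `|s - t| by rewrite normrM ler_wpM2r//; lra.
have lt1 : `|q * (s - t)| < r by apply: le_lt_trans le1 _; rewrite mulrC -ltr_pdivlMr.
have := k _ s01; rewrite E => /(_ lt1); rewrite rmorphM mulrA => hh.
apply: le_trans hh _.
apply: le_trans (_ : e / (`|q| + 1) * ((`|q| + 1) * `|s - t|) <= _).
  by rewrite ler_wpM2l// divr_ge0// ltW.
by rewrite mulrA divfK//; lra.
Qed.

(** The length [q] may be negative: bisection and reversal of a segment are both instances. *)
Lemma seg_int_subsegment f a b G (p q : R) : in01 p -> in01 (p + q) -> is_seg_prim f a b G ->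
  seg_int f (a + (b - a) * p%:C) (a + (b - a) * (p + q)%:C) = G (p + q) - G p.
Proof.
move=> p01 q01 hG; rewrite (@seg_intE _ _ _ (fun s => G (p + q * s))).
  by rewrite mulr1 mulr0 addr0.
have pq s : in01 s -> in01 (p + q * s).
  by move: p01 q01; rewrite /in01 => /andP[h1 h2] /andP[h3 h4] /andP[h5 h6]; apply/andP; nra.
move=> t t01; have := hasd01_affine pq (hG _ (pq _ t01)); congr (hasd01 _ _ _).
have -> : a + (b - a) * p%:C + (a + (b - a) * (p + q)%:C - (a + (b - a) * p%:C)) * t%:C =
  a + (b - a) * (p + q * t)%:C by rewrite !rmorphD rmorphM; ring.
by rewrite rmorphD; ring.
Qed.

Definition mid a b := (a + b) / 2.
Lemma midE a b : mid a b = a + (b - a) * (2^-1)%:C.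
Proof. by rewrite /mid fmorphV rmorph_nat; field. Qed.

Lemma in01_half : in01 (2^-1 : R). Proof. by rewrite /in01; lra. Qed.

Lemma seg_int_mid S f a b : cvx S -> (forall z, S z -> contc f z) -> S a -> S b ->
  seg_int f a b = seg_int f a (mid a b) + seg_int f (mid a b) b.
Proof.
move=> cS cf Sa Sb; have [G hG] := seg_prim_ex cS cf Sa Sb; rewrite (seg_intE hG).
have h0 : in01 (0 : R) by rewrite /in01; lra.
have h1 : in01 (1 : R) by rewrite /in01; lra.
have E1 := @seg_int_subsegment f a b G 0 2^-1 h0 ltac:(rewrite add0r; exact: in01_half) hG.
have E2 := @seg_int_subsegment f a b G 2^-1 2^-1 in01_half ltac:(rewrite /in01; lra) hG.
have hh : 2^-1 + 2^-1 = 1 :> R by lra.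
move: E1 E2; rewrite add0r hh -midE rmorph0 rmorph1 mulr0 addr0 mulr1 subrKC => -> ->.
ring.
Qed.

Lemma seg_int_rev S f a b : cvx S -> (forall z, S z -> contc f z) -> S a -> S b ->
  seg_int f b a = - seg_int f a b.
Proof.
move=> cS cf Sa Sb; have [G hG] := seg_prim_ex cS cf Sa Sb; rewrite (seg_intE hG).
have := @seg_int_subsegment f a b G 1 (-1) ltac:(rewrite /in01; lra) ltac:(rewrite /in01; lra) hG.
rewrite subrr rmorph0 rmorph1 mulr0 addr0 mulr1 subrKC => ->; ring.
Qed.

End Segments.

(** * Goursat's theorem *)

Section Goursat.
Variable R : realType.
Notation C := R[i].
Implicit Types (f g F : C -> C) (z w a b c o d : C) (t s e r M : R) (S : set C).

Definition tri_int f a b c := seg_int f a b + seg_int f b c + seg_int f c a.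

Definition sides a b c (l : R) := [/\ N (b - a) <= l, N (c - b) <= l & N (a - c) <= l].

Lemma mid_cvx S a b : cvx S -> S a -> S b -> S (mid a b).
Proof. by move=> cS Sa Sb; rewrite midE; apply: cS => //; exact: in01_half. Qed.

(** Each side of the medial triangle is traversed twice, in opposite directions, and cancels. *)
Lemma tri_int_mid S f a b c : cvx S -> (forall z, S z -> contc f z) -> S a -> S b -> S c ->
  tri_int f a b c = tri_int f a (mid a b) (mid c a) + tri_int f (mid a b) b (mid b c) +
   tri_int f (mid c a) (mid b c) c + tri_int f (mid a b) (mid b c) (mid c a).
Proof.
move=> cS cf Sa Sb Sc; rewrite /tri_int.
have Sab := mid_cvx cS Sa Sb; have Sbc := mid_cvx cS Sb Sc; have Sca := mid_cvx cS Sc Sa.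
rewrite (seg_int_mid cS cf Sa Sb) (seg_int_mid cS cf Sb Sc) (seg_int_mid cS cf Sc Sa).
rewrite (seg_int_rev cS cf Sab Sca) (seg_int_rev cS cf Sbc Sab) (seg_int_rev cS cf Sca Sbc).
move: (seg_int f (mid a b) (mid c a)) (seg_int f (mid b c) (mid a b)) (seg_int f (mid c a) (mid b c)) => x y z.
move: (seg_int f a (mid a b)) (seg_int f (mid a b) b) (seg_int f b (mid b c)) (seg_int f (mid b c) c)
  (seg_int f c (mid c a)) (seg_int f (mid c a) a) => x1 x2 x3 x4 x5 x6; ring.
Qed.

Lemma sum4_max (x1 x2 x3 x4 x : C) : x = x1 + x2 + x3 + x4 ->
  [\/ N x <= 4 * N x1, N x <= 4 * N x2, N x <= 4 * N x3 | N x <= 4 * N x4].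
Proof.
move=> ->.
have h := ND (x1 + x2 + x3) x4; have h' := ND (x1 + x2) x3; have h'' := ND x1 x2.
have [|k1] := leP (N (x1 + x2 + x3 + x4)) (4 * N x1); first by move=> ?; exact: Or41.
have [|k2] := leP (N (x1 + x2 + x3 + x4)) (4 * N x2); first by move=> ?; exact: Or42.
have [|k3] := leP (N (x1 + x2 + x3 + x4)) (4 * N x3); first by move=> ?; exact: Or43.
apply: Or44; lra.
Qed.

Lemma Nhalf z : N (z / 2) = N z / 2.
Proof. by rewrite NM NV -[2]/(2%:R) -(rmorph_nat (real_complex R)) Nr ger0_norm. Qed.

(** Keep a quarter that carries at least a fourth of the integral. Instead of nested triangles, the
    argument follows their first vertices; the bound on the displacement makes these a Cauchy
    sequence. *)
Lemma goursat_step S f a b c : cvx S -> (forall z, S z -> contc f z) -> S a -> S b -> S c ->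
  exists p : C * C * C, [/\ S p.1.1, S p.1.2, S p.2,
    N (tri_int f a b c) <= 4 * N (tri_int f p.1.1 p.1.2 p.2) &
    forall l, sides a b c l -> sides p.1.1 p.1.2 p.2 (l / 2) /\ N (p.1.1 - a) <= l].
Proof.
move=> cS cf Sa Sb Sc.
have Sab := mid_cvx cS Sa Sb; have Sbc := mid_cvx cS Sb Sc; have Sca := mid_cvx cS Sc Sa.
have h2 : (2 : C) != 0 by rewrite pnatr_eq0.
have E1 : mid a b - a = (b - a) / 2 by rewrite /mid; field.
have E2 : mid b c - b = (c - b) / 2 by rewrite /mid; field.
have E3 : mid c a - c = (a - c) / 2 by rewrite /mid; field.
have F1 : b - mid a b = (b - a) / 2 by rewrite /mid; field.
have F2 : c - mid b c = (c - b) / 2 by rewrite /mid; field.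
have F3 : a - mid c a = (a - c) / 2 by rewrite /mid; field.
have G1 : mid c a - mid a b = (c - b) / 2 by rewrite /mid; field.
have G2 : mid a b - mid b c = (a - c) / 2 by rewrite /mid; field.
have G3 : mid b c - mid c a = (b - a) / 2 by rewrite /mid; field.
have [h|h|h|h] := sum4_max (tri_int_mid cS cf Sa Sb Sc).
- exists (a, mid a b, mid c a); split => //= l [l1 l2 l3].
  by rewrite /sides subrr N0 E1 G1 F3 !Nhalf; have := N_ge0 (b - a); split; [split|]; lra.
- exists (mid a b, b, mid b c); split => //= l [l1 l2 l3].
  by rewrite /sides F1 E2 G2 E1 !Nhalf; have := N_ge0 (b - a); split; [split|]; lra.
- exists (mid c a, mid b c, c); split => //= l [l1 l2 l3].
  rewrite /sides G3 F2 E3 [N (mid c a - a)]NB F3 !Nhalf.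
  by have := N_ge0 (b - a); split; [split|]; lra.
- exists (mid a b, mid b c, mid c a); split => //= l [l1 l2 l3].
  rewrite /sides [N (mid b c - _)]NB [N (mid c a - _)]NB [N (mid a b - mid c a)]NB G1 G2 G3 E1 !Nhalf.
  by have := N_ge0 (b - a); split; [split|]; lra.
Qed.

Lemma expr_half_lt (x e : R) : 0 < e -> exists n, x / 2 ^+ n < e.
Proof.
move=> e0; pose n := Num.bound `|x / e|; exists n.
have : x / e < n%:R by apply: le_lt_trans (ler_norm _) _; exact: archi_boundP.
rewrite ltr_pdivrMr// ltr_pdivrMr ?exprn_gt0// => h; apply: lt_le_trans h _.
rewrite mulrC ler_pM2l//.
by have := ltn_expl n (leqnn 2) => /ltnW; rewrite -(ler_nat R) natrX.
Qed.

Lemma goursat o r f a b c : (forall z, cball o r z -> exists d, hasd f z d) ->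
  cball o r a -> cball o r b -> cball o r c -> tri_int f a b c = 0.
Proof.
move=> df Sa Sb Sc; have cS := @cvx_cball _ o r.
have cf z : cball o r z -> contc f z by move=> /df[d /hasd_contc].
pose S3 (p : C * C * C) := [/\ cball o r p.1.1, cball o r p.1.2 & cball o r p.2].
pose T3 (p : C * C * C) := tri_int f p.1.1 p.1.2 p.2.
pose sd3 (p : C * C * C) := sides p.1.1 p.1.2 p.2.
have /choice[step hstep] : forall p, exists q, S3 p ->
    [/\ S3 q, N (T3 p) <= 4 * N (T3 q) &
     forall l, sd3 p l -> sd3 q (l / 2) /\ N (q.1.1 - p.1.1) <= l].
  move=> [[x y] z]; have [[/= Sx Sy Sz]|nS] := pselect (S3 (x, y, z)); last by exists 0.
  by have [q [q1 q2 q3 q4 q5]] := goursat_step cS cf Sx Sy Sz; exists q.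
pose l := N (b - a) + N (c - b) + N (a - c).
have l0 : 0 <= l by rewrite /l !addr_ge0 ?N_ge0.
pose p n := iter n step (a, b, c).
have inv n : [/\ S3 (p n), N (tri_int f a b c) <= 4 ^+ n * N (T3 (p n)) & sd3 (p n) (l / 2 ^+ n)].
  elim: n => [|n [S1 h1 h2]].
    split => //; first by rewrite expr0 mul1r.
    rewrite expr0 divr1 /sd3 /= /l /sides.
    by have := N_ge0 (b - a); have := N_ge0 (c - b); have := N_ge0 (a - c); split; lra.
  have [S2 h3 h4] := hstep _ S1; split => //=.
    by apply: le_trans h1 _; rewrite exprSr -mulrA ler_pM2l// exprn_gt0.
  by have [] := h4 _ h2; rewrite exprSr invfM mulrA.
pose x n := (p n).1.1.
have xd n : N (x n.+1 - x n) <= l / 2 ^+ n.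
  by have [S1 _ h2] := inv n; have [_ _ /(_ _ h2)[]] := hstep _ S1.
(* The right-hand side is the exact sum of the geometric series; without the subtracted tail the
   induction on [k] would not close. *)
have xc k n : N (x (n + k)%N - x n) <= 2 * (l / 2 ^+ n) - 2 * (l / 2 ^+ (n + k)).
  elim: k => [|k IH]; first by rewrite addn0 !subrr N0.
  apply: le_trans (NDB _ _ (x (n + k)%N)) _; rewrite addnS.
  apply: le_trans (lerD (xd _) IH) _.
  by rewrite exprSr invfM mulrA; lra.
have xc' n m : (n <= m)%N -> N (x m - x n) <= 2 * (l / 2 ^+ n).
  move=> nm; rewrite -(subnKC nm); apply: le_trans (xc _ _) _.
  by rewrite gerBl mulr_ge0// divr_ge0// exprn_ge0.
have [|q hq] := @seq_clim R x.
  move=> e e0; have [n hn] := expr_half_lt (4 * l) e0; exists n => i j ni nj.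
  have := xc' _ _ ni; have := xc' _ _ nj; have := NDB (x i) (x j) (x n).
  rewrite [N (x n - x j)]NB; lra.
have xq n : N (x n - q) <= 2 * (l / 2 ^+ n).
  apply/ler_addgt0Pr => e /hq[m hm].
  have := hm _ (leq_maxl m n); have := xc' _ _ (leq_maxr m n).
  have := NDB (x n) q (x (maxn m n)); rewrite [N (x n - x _)]NB; lra.
have Sq : cball o r q.
  apply/ler_addgt0Pr => e /hq[m hm]; have [[S1 _ _] _ _] := inv m.
  have := hm _ (leqnn m); have := NDB q o (x m); rewrite [N (q - x _)]NB.
  by move: S1; rewrite /cball /= -/(x m); lra.
have [d hd] := df _ Sq.
(* The 9 is three sides of length at most [ln], times an error [e (3 ln)] on each: points of the
   triangle are within [ln] of its first vertex, which is within [2 ln] of [q]. The factor [4 ^ n]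
   cancels against [ln ^ 2]. *)
suff H e : 0 < e -> N (tri_int f a b c) <= e * (9 * l ^+ 2).
  apply/eqP; rewrite -N_eq0 eq_le N_ge0 andbT; apply/ler_addgt0Pr => e e0; rewrite add0r.
  have K0 : 0 < 9 * l ^+ 2 + 1 by have := sqr_ge0 l; lra.
  apply: le_trans (H (e / (9 * l ^+ 2 + 1)) _) _; first by rewrite divr_gt0.
  by rewrite mulrAC ler_pdivrMr// ler_pM2l//; lra.
move=> e0; have [r1 r10 h] := hasd_eps hd e0.
have [n hn] := expr_half_lt (3 * l) r10.
have [[S1 S2 S3'] h1 h2] := inv n.
set ln := l / 2 ^+ n in h2; have ln0 : 0 <= ln by rewrite divr_ge0// exprn_ge0.
pose L z := f q + d * (z - q).
pose LL z := f q * z + d * ((z - q) ^+ 2 / 2).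
have h2n : (2 : C) != 0 by rewrite pnatr_eq0.
have dLL z : hasd LL z (L z).
  have := hasdD (hasdZ (f q) (hasd_id z)) (hasdZ d (hasdM (hasdX 2 (hasdB (hasd_id z) (hasd_cst q z))) (hasd_cst 2^-1 z))).
  by congr (hasd _ _ _); rewrite /L /=; field.
have dL z : contc L z.
  apply: contcD; first exact: contc_cst.
  by apply: contcM; [exact: contc_cst|apply: contcB; [exact: contc_id|exact: contc_cst]].
have TL : tri_int L (p n).1.1 (p n).1.2 (p n).2 = 0.
  by rewrite /tri_int !(seg_int_prim (F := LL) cS)//; ring.
have bnd u v : cball o r u -> cball o r v -> N (u - x n) <= ln -> N (v - x n) <= ln -> N (v - u) <= ln ->
    N (seg_int f u v - seg_int L u v) <= e * (3 * ln) * ln.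
  move=> Su Sv ux vx uv; rewrite -(seg_intB cS)//.
  apply: le_trans (seg_int_bound (M := e * (3 * ln)) cS _ Su Sv _) _.
  - by move=> z Sz; apply: contcB; [exact: cf|exact: dL].
  - move=> t t01; set w := _ + _ * _.
    have wq : N (w - q) <= 3 * ln.
      have : N (w - x n) <= ln by exact: norm_cvx.
      by have := xq n; have := NDB w q (x n); rewrite -/ln; lra.
    have -> : f w - L w = f w - f q - d * (w - q) by rewrite /L; ring.
    apply: le_trans (h _ _) _; last by rewrite ler_wpM2l// ltW.
    by apply: le_lt_trans wq _; rewrite /ln mulrA.
  - by rewrite ler_wpM2l// !mulr_ge0// ltW.
have [s1 s2 s3] := h2.
have b1 : N ((p n).1.1 - x n) <= ln by rewrite subrr N0.
have b2 : N ((p n).1.2 - x n) <= ln by [].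
have b3 : N ((p n).2 - x n) <= ln by rewrite NB.
have k1 := bnd _ _ S1 S2 b1 b2 s1; have k2 := bnd _ _ S2 S3' b2 b3 s2.
have k3 := bnd _ _ S3' S1 b3 b1 s3.
have hT : N (T3 (p n)) <= 9 * e * ln ^+ 2.
  rewrite -[T3 _]subr0 -TL /T3 /tri_int.
  have -> : seg_int f (p n).1.1 (p n).1.2 + seg_int f (p n).1.2 (p n).2 + seg_int f (p n).2 (p n).1.1 -
   (seg_int L (p n).1.1 (p n).1.2 + seg_int L (p n).1.2 (p n).2 + seg_int L (p n).2 (p n).1.1) =
   (seg_int f (p n).1.1 (p n).1.2 - seg_int L (p n).1.1 (p n).1.2) +
   ((seg_int f (p n).1.2 (p n).2 - seg_int L (p n).1.2 (p n).2) +
   (seg_int f (p n).2 (p n).1.1 - seg_int L (p n).2 (p n).1.1)) by ring.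
  apply: le_trans (ND _ _) _; apply: le_trans (lerD k1 (le_trans (ND _ _) (lerD k2 k3))) _.
  by rewrite le_eqVlt; apply/orP; left; apply/eqP; ring.
apply: le_trans h1 _; apply: le_trans (_ : 4 ^+ n * (9 * e * ln ^+ 2) <= _).
  by rewrite ler_pM2l// exprn_gt0.
rewrite /ln le_eqVlt; apply/orP; left; apply/eqP.
have -> : (4 : R) = 2 ^+ 2 by rewrite expr2; lra.
rewrite exprAC; field; by rewrite expf_neq0.
Qed.

Lemma primitive o r f : (forall z, oball o r z -> exists d, hasd f z d) ->
  exists F, forall z, oball o r z -> hasd F z (f z).
Proof.
move=> df; exists (seg_int f o) => z zB.
pose r' := (N (z - o) + r) / 2.
have zr' : N (z - o) < r' by move: zB; rewrite /oball /= /r'; lra.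
have r'r : r' < r by move: zB; rewrite /oball /= /r'; lra.
have df' w : cball o r' w -> exists d, hasd f w d by move=> h; apply: df; exact: le_lt_trans h r'r.
have cS := @cvx_cball _ o r'.
have cf w : cball o r' w -> contc f w by move=> /df'[d /hasd_contc].
have So : cball o r' o by rewrite /cball /= subrr N0; have := N_ge0 (z - o); lra.
have Sz : cball o r' z by exact: ltW.
apply: eps_hasd => e e0; have [r1 r10 h] := cf _ Sz e e0.
exists (Num.min r1 (r' - N (z - o))); first by rewrite lt_min r10; lra.
move=> w; rewrite lt_min => /andP[w1 w2].
have Sw : cball o r' w by rewrite /cball /=; have := NDB w o z; lra.
have := goursat df' So Sz Sw; rewrite /tri_int (seg_int_rev cS cf So Sw) => E.
have -> : seg_int f o w - seg_int f o z = seg_int f z w.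
  by apply/eqP; rewrite -subr_eq0; apply/eqP; rewrite -[RHS]oppr0 -E; ring.
have <- : seg_int (fun=> f z) z w = f z * (w - z).
  rewrite (seg_int_prim (F := fun x => f z * x) cS)//; first by rewrite mulrBr.
  by move=> x _; have := hasdZ (f z) (hasd_id x); rewrite mulr1.
rewrite -(seg_intB cS)//; last by move=> *; exact: contc_cst.
apply: seg_int_bound cS _ Sz Sw _.
  by move=> x Sx; apply: contcB; [exact: cf|exact: contc_cst].
move=> t t01; apply/ltW/h; apply: le_lt_trans w1.
by apply: norm_cvx => //; rewrite subrr N0 N_ge0.
Qed.

End Goursat.

(** * The maximum principle *)

Section MaximumPrinciple.
Variable R : realType.
Notation C := R[i].
Implicit Types (f g F G : C -> C) (z w a b c o d : C) (t s e r M : R) (S : set C).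

Definition ana (U : set C) f := forall z, U z -> exists d, hasd f z d.

Lemma anaS U V f : U `<=` V -> ana V f -> ana U f.
Proof. by move=> UV fV z /UV/fV. Qed.

Lemma oball_sub a b r s : N (b - a) + s <= r -> oball b s `<=` oball a r.
Proof. by move=> h z /= zs; have := NDB z a b; rewrite /oball /= in zs *; lra. Qed.

Lemma taylor2 G G1 z0 (g2 : C) r : 0 < r -> (forall z, oball z0 r z -> hasd G z (G1 z)) ->
  hasd G1 z0 g2 -> forall e, 0 < e -> exists2 t, 0 < t &
  forall h, N h < t -> N (G (z0 + h) - G z0 - G1 z0 * h - g2 * h ^+ 2 / 2) <= e * N h ^+ 2.
Proof.
move=> r0 dG /hasd_eps dG1 e e0; have [r1 r10 k] := dG1 e e0.
exists (Num.min r r1); first by rewrite lt_min r0.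
move=> h; rewrite lt_min => /andP[hr hr1].
pose K w := G w - (G1 z0 * (w - z0) + g2 * ((w - z0) ^+ 2 / 2)).
pose K1 w := G1 w - G1 z0 - g2 * (w - z0).
have h2n : (2 : C) != 0 by rewrite pnatr_eq0.
have dK z : cball z0 (N h) z -> hasd K z (K1 z).
  move=> zh; have Gz : hasd G z (G1 z) by apply: dG; exact: le_lt_trans zh hr.
  have i := hasdB (hasd_id z) (hasd_cst z0 z).
  have := hasdB Gz (hasdD (hasdZ (G1 z0) i) (hasdZ g2 (hasdM (hasdX 2 i) (hasd_cst 2^-1 z)))).
  by congr (hasd _ _ _); rewrite /K1 /=; field.
have := @mean_value _ (cball z0 (N h)) K K1 (e * N h) z0 (z0 + h) (@cvx_cball _ _ _) dK.
have -> : K (z0 + h) - K z0 = G (z0 + h) - G z0 - G1 z0 * h - g2 * h ^+ 2 / 2.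
  by rewrite /K; field.
have Eh : z0 + h - z0 = h by ring.
have -> : e * N h ^+ 2 = e * N h * N h by ring.
rewrite Eh; apply.
- move=> z zh; apply: le_trans (k _ _) _; first exact: le_lt_trans zh hr1.
  by rewrite ler_wpM2l// ltW.
- by rewrite /cball /= subrr N0 N_ge0.
- by rewrite /cball /= Eh.
Qed.

(** A discrete Parseval identity over the fourth roots of unity: the cross terms vanish because the
    degrees 0, 1 and 2 are distinct modulo 4. *)
Lemma sum4_sqr (g0 g1 g2 : C) t :
  N (g0 + g1 * t%:C + g2 * t%:C ^+ 2 / 2) ^+ 2 +
  N (g0 + g1 * (- t%:C) + g2 * (- t%:C) ^+ 2 / 2) ^+ 2 +
  N (g0 + g1 * ('i * t%:C) + g2 * ('i * t%:C) ^+ 2 / 2) ^+ 2 +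
  N (g0 + g1 * (- ('i * t%:C)) + g2 * (- ('i * t%:C)) ^+ 2 / 2) ^+ 2 =
  4 * N g0 ^+ 2 + 4 * N g1 ^+ 2 * t ^+ 2 + N g2 ^+ 2 * t ^+ 4.
Proof.
have -> : (2 : C)^-1 = (2^-1)%:C by rewrite fmorphV rmorph_nat.
rewrite !Nsq; case: g0 => a b; case: g1 => c d; case: g2 => e f /=; by field.
Qed.

Lemma no_max G G1 z0 (g2 : C) r a e : 0 < r -> (forall z, oball z0 r z -> hasd G z (G1 z)) ->
  hasd G1 z0 g2 -> 0 < e ->
  ~ (forall w, oball z0 r w -> N (G w) ^+ 2 + e * N (w - a) ^+ 2 <=
                           N (G z0) ^+ 2 + e * N (z0 - a) ^+ 2).
Proof.
move=> r0 dG dG1 e0 hmax.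
pose K := N (G z0) + N (G1 z0) + N g2.
have K0 : 0 <= K by rewrite /K !addr_ge0 ?N_ge0.
(* Each of the four Taylor errors then costs at most [e t^2 / 2], in total half of the gain
   [4 e t^2] produced by the term [e |w - a|^2]. *)
pose e1 := e / (4 * (K + 1)).
have e10 : 0 < e1 by rewrite divr_gt0//; lra.
have [t1 t10 h] := taylor2 r0 dG dG1 e10.
pose t := Num.min (Num.min r t1) 1 / 2.
have [t0 tr tt1 tle1] : [/\ 0 < t, t < r, t < t1 & t < 1].
  have m0 : 0 < Num.min (Num.min r t1) 1 by rewrite !lt_min r0 t10 ltr01.
  have m1 : Num.min (Num.min r t1) 1 <= 1 by rewrite ge_min lexx orbT.
  have m2 : Num.min (Num.min r t1) 1 <= r by rewrite !ge_min lexx.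
  have m3 : Num.min (Num.min r t1) 1 <= t1 by rewrite !ge_min lexx orbT.
  by rewrite /t; split; lra.
have tsq : t ^+ 2 <= 1 by rewrite expr2; nra.
pose P x := G z0 + G1 z0 * x + g2 * x ^+ 2 / 2.
have main x : N x = t -> N (P x) ^+ 2 - 2 * K * e1 * t ^+ 2 + e * N (z0 + x - a) ^+ 2 <=
    N (G z0) ^+ 2 + e * N (z0 - a) ^+ 2.
  move=> Nx; have xr : oball z0 r (z0 + x) by rewrite /oball /= addrC addKr Nx.
  apply: le_trans (hmax _ xr); rewrite lerD2r.
  have /h : N x < t1 by rewrite Nx.
  rewrite Nx; set rho := N (_ - _) => hrho.
  have PK : N (P x) <= K.
    apply: le_trans (ND _ _) _; apply: le_trans (lerD (ND _ _) (lexx _)) _.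
    rewrite Nhalf NM [N (g2 * _)]NM NX Nx /K.
    have x10 := N_ge0 (G1 z0); have x20 := N_ge0 g2.
    have h1 : N (G1 z0) * t <= N (G1 z0) by rewrite ler_piMr// ltW.
    have h2 : N g2 * t ^+ 2 <= N g2 by rewrite ler_piMr.
    have h3 : 0 <= N g2 * t ^+ 2 by rewrite mulr_ge0 ?sqr_ge0.
    lra.
  have tri : N (P x) <= N (G (z0 + x)) + rho.
    have -> : P x = G (z0 + x) - (G (z0 + x) - G z0 - G1 z0 * x - g2 * x ^+ 2 / 2).
      by rewrite /P; ring.
    by apply: le_trans (ND _ _) _; rewrite NN.
  have rho0 : 0 <= rho by exact: N_ge0.
  have := N_ge0 (P x); have := N_ge0 (G (z0 + x)).
  move: (N (P x)) (N (G (z0 + x))) PK tri => p g PK tri g0 p0.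
  have : p * rho <= K * (e1 * t ^+ 2) by rewrite ler_pM.
  have [pr|pr] := leP p rho.
    have : p * p <= p * rho by rewrite ler_wpM2l.
    have := sqr_ge0 g; rewrite !expr2; have : 0 <= p * rho by rewrite mulr_ge0.
    lra.
  have : (p - rho) ^+ 2 <= g ^+ 2 by rewrite ler_pXn2r ?nnegrE//; lra.
  have := sqr_ge0 rho; rewrite !expr2; lra.
have Nt : N (t%:C) = t by rewrite Nr gtr0_norm.
have Nit : N ('i * t%:C) = t by rewrite NM Ni mul1r.
have := main t%:C Nt; have := main (- t%:C); rewrite NN => /(_ Nt).
have := main ('i * t%:C) Nit; have := main (- ('i * t%:C)); rewrite NN => /(_ Nit).
have S1 := sum4_sqr (G z0) (G1 z0) g2 t; rewrite -!/(P _) in S1.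
have S2 := sum4_sqr (z0 - a) 1 0 t; rewrite !(mul0r, addr0, mul1r) in S2.
have E x : z0 - a + x = z0 + x - a by ring.
rewrite !E N0 N1 expr0n /= mul0r addr0 expr1n mulr1 in S2.
have p1 : 0 <= 4 * N (G1 z0) ^+ 2 * t ^+ 2.
  by apply: mulr_ge0; rewrite ?sqr_ge0// mulr_ge0 ?sqr_ge0.
have p2 : 0 <= N g2 ^+ 2 * t ^+ 4 by rewrite mulr_ge0 ?sqr_ge0// exprn_ge0// ltW.
have tt0 : 0 < t ^+ 2 by rewrite exprn_gt0.
have p3 : 2 * K * e1 * t ^+ 2 <= e / 2 * t ^+ 2.
  rewrite ler_pM2r// /e1 mulrA ler_pdivrMr; last by lra.
  have -> : e / 2 * (4 * (K + 1)) = 2 * K * e + 2 * e by field.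
  lra.
have p4 : 0 < e * t ^+ 2 by rewrite mulr_gt0.
have S3 := congr1 ( *%R e) S2; rewrite !mulrDr in S3.
clear S2; lra.
Qed.

(* Second derivative test for [|G|^2 + e |z - a|^2]: in [no_max] the linear and
   quadratic Taylor terms cancel over the four increments [t, -t, it, -it]. *)
Lemma max_principle2 G G1 a r R' M : 0 < r -> r < R' -> (forall z, oball a R' z -> hasd G z (G1 z)) ->
  ana (oball a R') G1 -> (forall z, N (z - a) = r -> N (G z) <= M) ->
  forall z, N (z - a) <= r -> N (G z) <= M.
Proof.
move=> r0 rR dG dG1 hM z0 z0r; rewrite leNgt; apply/negP => Mlt.
have M0 : 0 <= M.
  by apply: le_trans (hM (a + r%:C) _); rewrite ?N_ge0// addrC addKr Nr gtr0_norm.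
have lt2 : M ^+ 2 < N (G z0) ^+ 2 by rewrite ltr_pXn2r ?nnegrE ?N_ge0.
(* On the circle the perturbation [e r^2] is half of [|G z0|^2 - M^2], so the perturbed function
   stays below its value at [z0] and its maximum is interior. *)
pose e := (N (G z0) ^+ 2 - M ^+ 2) / (2 * r ^+ 2).
have rr : 0 < 2 * r ^+ 2 by rewrite mulr_gt0// exprn_gt0.
have e0 : 0 < e by rewrite divr_gt0// subr_gt0.
have er : e * r ^+ 2 = (N (G z0) ^+ 2 - M ^+ 2) / 2 by rewrite /e; field; lra.
pose phi z := N (G z) ^+ 2 + e * N (z - a) ^+ 2.
have [z1 z1r hz1] : exists2 c, N (c - a) <= r & forall z, N (z - a) <= r -> phi z <= phi c.
  apply: cball_max => [|z zr]; first lra.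
  have cG : contc G z by apply/hasd_contc/dG; exact: le_lt_trans zr rR.
  have n1 := contrN cG; have n2 : contr (fun w => N (w - a)) z.
    by apply: contrN; apply: contcB; [exact: contc_id|exact: contc_cst].
  by apply: contrD; [|apply: contrM; first exact: contr_cst]; exact: contrM.
have hz0 := hz1 _ z0r.
have [|z1r'] := leP r (N (z1 - a)).
  move=> rz1; have zE : N (z1 - a) = r by lra.
  have : N (G z1) ^+ 2 <= M ^+ 2 by rewrite ler_pXn2r ?nnegrE ?N_ge0// hM.
  move: hz0; rewrite /phi zE er; have : 0 <= e * N (z0 - a) ^+ 2 by rewrite mulr_ge0 ?sqr_ge0// ltW.
  lra.
have z1R : oball a R' z1 by rewrite /oball /=; lra.
have [g2 hg2] := dG1 _ z1R.
apply: (@no_max G G1 z1 g2 (r - N (z1 - a)) a e) => //; first lra.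
  by move=> z zz1; apply: dG; rewrite /oball /= in zz1 *; have := NDB z a z1; lra.
by move=> w ww; apply: hz1; rewrite /oball /= in ww; have := NDB w a z1; lra.
Qed.

(* [f] is the uniform limit of the difference quotients of a primitive, and
   those are twice differentiable. *)
Lemma max_principle f a r R' M : 0 < r -> r < R' -> ana (oball a R') f ->
  (forall z, N (z - a) = r -> N (f z) <= M) -> forall z, N (z - a) <= r -> N (f z) <= M.
Proof.
move=> r0 rR df hM; have [F dF] := primitive df.
suff H e : 0 < e -> forall z, N (z - a) <= r -> N (f z) <= M + e + e.
  move=> z zr; apply/ler_addgt0Pr => e e0.
  have e20 : 0 < e / 2 by lra.
  by have := H _ e20 _ zr; lra.
move=> e0; have cf z : N (z - a) <= r -> contc f z.
  by move=> zr; have [|d /hasd_contc] := df z => //; exact: le_lt_trans zr rR.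
have [d d0 hd] := cball_unif cf e0.
pose R2 := (r + R') / 2.
have rR2 : r < R2 by rewrite /R2; lra.
have RR2 : R2 < R' by rewrite /R2; lra.
pose t := Num.min d (R' - R2) / 2.
have [t0 td tR] : [/\ 0 < t, t < d & t < R' - R2].
  have m0 : 0 < Num.min d (R' - R2) by rewrite lt_min d0; lra.
  have m1 : Num.min d (R' - R2) <= d by rewrite ge_min lexx.
  have m2 : Num.min d (R' - R2) <= R' - R2 by rewrite ge_min lexx orbT.
  by rewrite /t; split; lra.
have Nt : N t%:C = t by rewrite Nr gtr0_norm.
have t0' : t%:C != 0 :> C by rewrite -N_gt0 Nt.
pose q z := (F (z + t%:C) - F z) * t%:C^-1.
pose q1 z := (f (z + t%:C) - f z) * t%:C^-1.
have inR2 z : oball a R2 z -> oball a R' (z + t%:C) /\ oball a R' z.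
  rewrite /oball /= => zr; split; last lra.
  have := NDB (z + t%:C) a z; rewrite (addrC z) addrK Nt; lra.
have shift g z x : hasd g (z + t%:C) x -> hasd (fun w => g (w + t%:C)) z x.
  move=> hg; have := hasd_comp (g := fun w => w + t%:C) (hasdD (hasd_id z) (hasd_cst t%:C z)) hg.
  by rewrite addr0 mulr1.
have dq z : oball a R2 z -> hasd q z (q1 z).
  move=> /inR2[z1 z2]; have := hasdM (hasdB (shift _ _ _ (dF _ z1)) (dF _ z2)) (hasd_cst t%:C^-1 z).
  by rewrite mulr0 addr0.
have dq1 : ana (oball a R2) q1.
  move=> z /inR2[/df[x hx] /df[y hy]]; eexists.
  exact: (hasdM (hasdB (shift _ _ _ hx) hy) (hasd_cst t%:C^-1 z)).
have qf z : N (z - a) <= r -> N (q z - f z) <= e.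
  move=> zr.
  have := @mean_value _ (cball z t) (fun w => F w - f z * w) (fun w => f w - f z) e z (z + t%:C) (@cvx_cball _ _ _).
  have -> : F (z + t%:C) - f z * (z + t%:C) - (F z - f z * z) = (q z - f z) * t%:C.
    by rewrite /q; field.
  rewrite (addrC z) addrK NM Nt ler_pM2r//; apply.
  - move=> w wt; apply: hasdB; last by have := hasdZ (f z) (hasd_id w); rewrite mulr1.
    by apply: dF; rewrite /cball /oball /= in wt *; have := NDB w a z; lra.
  - by move=> w wt; apply/ltW/hd => //; exact: le_lt_trans wt td.
  - by rewrite /cball /= subrr N0 ltW.
  - by rewrite /cball /= addrK Nt.
have hq := @max_principle2 q q1 a r R2 (M + e) r0 rR2 dq dq1.
move=> z zr; have := NBr (f z) (q z); rewrite NB.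
have : N (q z) <= M + e.
  apply: hq zr => w wr; have := NBr (q w) (f w); have wr' : N (w - a) <= r by rewrite wr.
  by have := qf _ wr'; have := hM _ wr; lra.
have := qf _ zr; lra.
Qed.

End MaximumPrinciple.

(** * Schwarz's lemma and Cauchy estimates *)

Section CauchyEstimates.
Variable R : realType.
Notation C := R[i].
Implicit Types (f g F G : C -> C) (z w a b c o d : C) (t s e r M : R) (S U : set C).

Lemma ana_dv U f z : ana U f -> U z -> hasd f z (dv f z).
Proof. by move=> df /df[d hd]; rewrite (dvE hd). Qed.

Lemma anaP U f f' : (forall z, U z -> hasd f z (f' z)) -> ana U f.
Proof. by move=> h z /h; exists (f' z). Qed.

Lemma anaD U f g : ana U f -> ana U g -> ana U (fun z => f z + g z).
Proof. by move=> df dg z Uz; eexists; apply: hasdD; [exact: ana_dv Uz|exact: ana_dv Uz]. Qed.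
Lemma anaB U f g : ana U f -> ana U g -> ana U (fun z => f z - g z).
Proof. by move=> df dg z Uz; eexists; apply: hasdB; [exact: ana_dv Uz|exact: ana_dv Uz]. Qed.
Lemma anaM U f g : ana U f -> ana U g -> ana U (fun z => f z * g z).
Proof. by move=> df dg z Uz; eexists; apply: hasdM; [exact: ana_dv Uz|exact: ana_dv Uz]. Qed.
Lemma ana_cst U c : ana U (fun=> c).
Proof. by move=> z _; exists 0; exact: hasd_cst. Qed.
Lemma anaV U f : ana U f -> (forall z, U z -> f z != 0) -> ana U (fun z => (f z)^-1).
Proof. by move=> df f0 z Uz; eexists; apply: hasdV; [exact: f0|exact: ana_dv Uz]. Qed.
Lemma ana_contc U f z : ana U f -> U z -> contc f z.
Proof. by move=> df /df[d /hasd_contc]. Qed.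

(** Taking [n]-th roots would give [x <= y (r / c)^(1/n)]; Bernoulli's inequality replaces this
    limit. *)
Lemma geometric_le (x y c r : R) : 0 < c -> 0 <= x -> 0 <= y ->
  (forall n, x ^+ n * c <= y ^+ n * r) -> x <= y.
Proof.
move=> c0 x0 y0 h; rewrite leNgt; apply/negP => yx.
have [y00|yn0] := eqVneq y 0.
  by have := h 1%N; rewrite y00 !expr1 mul0r; apply/negP; rewrite -ltNge mulr_gt0//; lra.
have y1 : 0 < y by rewrite lt_neqAle eq_sym yn0.
pose s := x / y - 1.
have s0 : 0 < s by rewrite subr_gt0 ltr_pdivlMr// mul1r.
have bern n : 1 + n%:R * s <= (x / y) ^+ n.
  elim: n => [|n IH]; first by rewrite expr0; lra.
  have xyE : x / y = 1 + s by rewrite /s; ring.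
  rewrite xyE in IH *; rewrite exprS.
  have : (1 + s) * (1 + n%:R * s) <= (1 + s) * (1 + s) ^+ n by rewrite ler_wpM2l//; lra.
  apply: le_trans; rewrite -natr1.
  have : 0 <= n%:R * s * s by rewrite !mulr_ge0// ltW.
  lra.
pose n := Num.bound `|r / (s * c)|.
have hn : `|r / (s * c)| < n%:R by exact: archi_boundP.
have sc : 0 < s * c by rewrite mulr_gt0.
have : r < n%:R * (s * c).
  by rewrite -ltr_pdivrMr//; apply: le_lt_trans (ler_norm _) hn.
have := h n; have yn : 0 < y ^+ n by rewrite exprn_gt0.
have : (1 + n%:R * s) * c <= (x / y) ^+ n * c by rewrite ler_pM2r.
rewrite expr_div_n mulrAC => h1.
rewrite mulrC [y ^+ n * r]mulrC [c * _]mulrC -ler_pdivrMr// => h2 h3; lra.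
Qed.

(* With [phi] the difference quotient at [a], the function [phi^n (z - a)] is
   differentiable even at [a]; apply the maximum principle to it and let [n]
   tend to infinity. *)
Lemma schwarz_circle f a r R' M d : 0 < r -> r < R' -> ana (oball a R') f -> hasd f a d ->
  (forall z, N (z - a) = r -> N (f z - f a) <= M) ->
  (forall z, N (z - a) <= r -> N (f z - f a) <= M / r * N (z - a)) /\ N d <= M / r.
Proof.
move=> r0 rR df [phi [cphi <-] E] hM.
have M0 : 0 <= M.
  by apply: le_trans (hM (a + r%:C) _); rewrite ?N_ge0// addrC addKr Nr gtr0_norm.
have Mr0 : 0 <= M / r by rewrite divr_ge0// ltW.
have phiE w : w != a -> phi w = (f w - f a) / (w - a).
  by move=> wa; rewrite E mulfK// subr_eq0.
pose g n w := phi w ^+ n * (w - a).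
have dg n : ana (oball a R') (g n).
  move=> w wR; have [->|wa] := eqVneq w a.
    (* At [a] the difference quotient of [g n] is [phi ^ n] itself, continuous there by the choice
       of [phi]. *)
    exists (phi a ^+ n); exists (fun w => phi w ^+ n); first by split=> //; exact: contcX.
    by move=> v; rewrite /g subrr mulr0 subr0.
  have [d1 hd] := df _ wR.
  have wa0 : 0 < N (w - a) by rewrite N_gt0 subr_eq0.
  have i := hasdB (hasd_id w) (hasd_cst a w).
  have := hasdM (hasdX n (hasdM (hasdB hd (hasd_cst (f a) w)) (hasdV _ i))) i.
  rewrite subr_eq0 => /(_ wa) h; eexists; apply: (hasd_near wa0 _ h) => v vw.
  rewrite /g phiE//; by apply: contraTneq vw => ->; rewrite NB ltxx.
have gM n w : N (w - a) = r -> N (g n w) <= (M / r) ^+ n * r.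
  move=> wr; have wa : w != a by rewrite -subr_eq0 -N_gt0 wr.
  rewrite /g NM NX wr ler_pM2r// lerXn2r ?nnegrE ?N_ge0//.
  by rewrite phiE// NM NV wr ler_pM2r ?invr_gt0// hM.
have phiM w : w != a -> N (w - a) <= r -> N (phi w) <= M / r.
  move=> wa wr; have wa0 : 0 < N (w - a) by rewrite N_gt0 subr_eq0.
  apply: (geometric_le (c := N (w - a)) (r := r)) => // [|n]; first exact: N_ge0.
  rewrite -NX -NM; exact: (max_principle r0 rR (dg n) (gM n)).
split.
  move=> z zr; have [->|za] := eqVneq z a; first by rewrite !subrr N0 mulr0.
  by rewrite E NM ler_wpM2r ?N_ge0// phiM.
rewrite leNgt; apply/negP => lt.
have [|s s0 hs] := cphi (N (phi a) - M / r); first by rewrite subr_gt0.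
pose t := Num.min s r / 2.
have [t0 ts tr] : [/\ 0 < t, t < s & t <= r].
  have m0 : 0 < Num.min s r by rewrite lt_min s0.
  have m1 : Num.min s r <= s by rewrite ge_min lexx.
  have m2 : Num.min s r <= r by rewrite ge_min lexx orbT.
  by rewrite /t; split; lra.
have Nt : N (a + t%:C - a) = t by rewrite addrC addKr Nr gtr0_norm.
have := hs (a + t%:C); rewrite Nt => /(_ ts).
have := phiM (a + t%:C); rewrite -subr_eq0 -N_gt0 Nt => /(_ t0 tr).
have := NBr (phi a) (phi (a + t%:C)); rewrite NB; lra.
Qed.

(** The passage [t -> r] by which estimates on strictly smaller disks reach a disk on whose closure
    the function need not be defined analytically. *)
Lemma le_lim_mul (x c s r : R) : 0 <= s -> s < r -> (forall t, s < t -> t < r -> x * t <= c) ->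
  x * r <= c.
Proof.
move=> s0 sr h; rewrite leNgt; apply/negP => cx.
have m := h ((s + r) / 2) ltac:(lra) ltac:(lra).
have x0 : 0 < x.
  have : 0 < x * ((r - s) / 2) by lra.
  by rewrite pmulr_lgt0//; lra.
pose t := Num.max ((s + r) / 2) ((c / x + r) / 2).
have cxr : c / x < r by rewrite ltr_pdivrMr// mulrC.
have : x * t <= c by apply: h; rewrite /t ?lt_max ?gt_max; [apply/orP; left|apply/andP; split]; lra.
have : (c / x + r) / 2 <= t by rewrite /t le_max lexx orbT.
move=> h1 h2; have : t <= c / x by rewrite ler_pdivlMr// mulrC.
lra.
Qed.

Lemma schwarz f a r M : 0 < r -> ana (oball a r) f ->
  (forall z, oball a r z -> N (f z - f a) <= M) ->
  (forall z, oball a r z -> N (f z - f a) <= M / r * N (z - a)) /\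
  (forall d, hasd f a d -> N d <= M / r).
Proof.
move=> r0 df fM; have aB : oball a r a by rewrite /oball /= subrr N0.
have ev t : 0 < t -> t < r -> forall z, N (z - a) = t -> N (f z - f a) <= M.
  by move=> t0 tr z zt; apply: fM; rewrite /oball /= zt.
split=> [z zr|d hd].
  have [d hd] := df _ aB.
  rewrite mulrAC ler_pdivlMr//; apply: (le_lim_mul (N_ge0 (z - a)) zr) => t zt tr.
  have t0 : 0 < t by have := N_ge0 (z - a); lra.
  have [h _] := schwarz_circle t0 tr df hd (ev _ t0 tr).
  by rewrite -ler_pdivlMr// mulrAC h// ltW.
rewrite ler_pdivlMr//; apply: (le_lim_mul (lexx 0) r0) => t t0 tr.
have [_ h] := schwarz_circle t0 tr df hd (ev _ t0 tr).
by rewrite -ler_pdivlMr.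
Qed.

(** A Cauchy estimate. The factor 2 comes from bounding [f z - f a] by [2 M] before Schwarz's lemma
    is applied. *)
Lemma schwarz2 f a r M : 0 < r -> ana (oball a r) f -> (forall z, oball a r z -> N (f z) <= M) ->
  (forall z, oball a r z -> N (f z - f a) <= 2 * M / r * N (z - a)) /\
  (forall d, hasd f a d -> N d <= 2 * M / r).
Proof.
move=> r0 df fM; apply: schwarz => // z zr.
apply: le_trans (ND _ _) _; rewrite NN.
have aB : oball a r a by rewrite /oball /= subrr N0.
have := fM _ zr; have := fM _ aB; lra.
Qed.

Lemma ana_lip f a r M z w : 0 < r -> ana (oball a r) f -> (forall z, oball a r z -> N (f z) <= M) ->
  oball a (r / 2) z -> oball a (r / 2) w -> N (f w - f z) <= 4 * M / r * N (w - z).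
Proof.
move=> r0 df fM; have sub x : oball a (r / 2) x -> oball a r x by rewrite /oball /=; lra.
apply: (mean_value (f' := dv f) (@cvx_oball _ _ _)) => x xr.
  by apply: ana_dv df _; exact: sub.
have xs : oball x (r / 2) `<=` oball a r by apply: oball_sub; move: xr; rewrite /oball /=; lra.
have r20 : 0 < r / 2 by lra.
have [_ h] := schwarz2 r20 (anaS xs df) (fun z h => fM z (xs z h)).
have -> : 4 * M / r = 2 * M / (r / 2) by field; lra.
by apply: h; apply: ana_dv df _; exact: sub.
Qed.

Lemma ana_close f g a r e d d' : 0 < r -> ana (oball a r) f -> ana (oball a r) g ->
  (forall z, oball a r z -> N (f z - g z) <= e) -> hasd f a d -> hasd g a d' ->
  N (d - d') <= 2 * e / r.
Proof.
move=> r0 df dg fg hd hd'.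
by have [_] := schwarz2 r0 (anaB df dg) fg; apply; exact: hasdB.
Qed.

(** Weierstrass's theorem at the centre. Applied to the differences of two approximants, Schwarz's
    lemma shows that their derivatives at [a] form a Cauchy sequence and that the increments of
    [f - g k] are at most a small multiple of [|w - a|]. *)
Lemma hasd_unif_limit f a r : 0 < r ->
  (forall e, 0 < e -> exists2 g, ana (oball a r) g & forall z, oball a r z -> N (f z - g z) <= e) ->
  exists d, hasd f a d.
Proof.
move=> r0 H; pose ek k : R := (2 ^+ k)^-1.
have ek0 k : 0 < ek k by rewrite invr_gt0 exprn_gt0.
have /choice[g hg] k : exists g, ana (oball a r) g /\ forall z, oball a r z -> N (f z - g z) <= ek k.
  by have [g h1 h2] := H _ (ek0 k); exists g.
have aB : oball a r a by rewrite /oball /= subrr N0.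
pose d k := dv (g k) a.
have hd k : hasd (g k) a (d k) by apply: ana_dv (hg k).1 aB.
have eks e : 0 < e -> exists n, forall k, (n <= k)%N -> ek k < e.
  move=> e0; have [n hn] := expr_half_lt 1 e0; exists n => k nk.
  apply: le_lt_trans hn; rewrite div1r lef_pV2 ?posrE ?exprn_gt0//.
  by rewrite ler_weXn2l// ler1n.
have gg k m z : oball a r z -> N (g k z - g m z) <= ek k + ek m.
  move=> zB; have := (hg k).2 _ zB; have := (hg m).2 _ zB.
  by have := NDB (g k z) (g m z) (f z); rewrite [N (g k z - f z)]NB; lra.
have dd k m : N (d k - d m) <= 2 * (ek k + ek m) / r.
  exact: ana_close r0 (hg k).1 (hg m).1 (gg k m) (hd k) (hd m).
have [|d0 hd0] := @seq_clim R d.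
  move=> e e0; have [|n hn] := eks (e * r / 4); first by rewrite divr_gt0// mulr_gt0.
  exists n => k m /hn h1 /hn h2; apply: le_trans (dd k m) _.
  by rewrite ler_pdivrMr//; lra.
(* [f - g k] is not known to be analytic, so Schwarz's lemma is used on [g m - g k], and [m] is
   taken so large that replacing [g m] by [f] costs at most [e]. *)
have fg k w : oball a r w -> N ((f w - g k w) - (f a - g k a)) <= 2 * (ek k) / r * N (w - a).
  move=> wB; apply/ler_addgt0Pr => e e0.
  have k0 : 0 < 2 + 2 / r * N (w - a).
    by apply: ltr_pwDl => //; rewrite mulr_ge0 ?N_ge0// divr_ge0// ltW.
  have [|n hn] := eks (e / (2 + 2 / r * N (w - a))); first by rewrite divr_gt0.
  set x := N _; pose m := n.
  have em := hn m (leqnn n).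
  have [h _] := schwarz2 r0 (anaB (hg m).1 (hg k).1) (gg m k).
  have {}h := h _ wB; rewrite /= in h.
  have h1 := (hg m).2 _ wB; have h2 := (hg m).2 _ aB.
  have : x <= N (f w - g m w) + N (f a - g m a) + N (g m w - g k w - (g m a - g k a)).
    rewrite /x; have -> : f w - g k w - (f a - g k a) =
      (f w - g m w) - (f a - g m a) + (g m w - g k w - (g m a - g k a)) by ring.
    by apply: le_trans (ND _ _) _; rewrite lerD2r; apply: le_trans (ND _ _) _; rewrite NN.
  rewrite ltr_pdivlMr// in em.
  have : 2 * (ek m + ek k) / r * N (w - a) = ek m * (2 / r * N (w - a)) + 2 * ek k / r * N (w - a) by ring.
  move=> E; rewrite E in h; move: em; rewrite mulrDr; lra.
exists d0; apply: eps_hasd => e e0.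
have e30 : 0 < e / 3 by lra.
have [n1 hn1] := hd0 _ e30.
have [|n2 hn2] := eks (e / 3 * r / 2); first by rewrite divr_gt0// mulr_gt0.
pose k := maxn n1 n2.
have h1 := hn1 k (leq_maxl _ _); have h2 := hn2 k (leq_maxr _ _).
have [s s0 hs] := hasd_eps (hd k) e30.
exists (Num.min r s); first by rewrite lt_min r0.
move=> w; rewrite lt_min => /andP[wr /hs h3].
have h4 := fg k w wr.
have -> : f w - f a - d0 * (w - a) = (g k w - g k a - d k * (w - a)) +
   (((f w - g k w) - (f a - g k a)) + (d k - d0) * (w - a)) by ring.
apply: le_trans (ND _ _) _; apply: le_trans (lerD h3 (le_trans (ND _ _) (lerD h4 (lexx _)))) _.
rewrite NM.
have : N (d k - d0) * N (w - a) <= e / 3 * N (w - a) by rewrite ler_wpM2r ?N_ge0.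
have : 2 * ek k / r * N (w - a) <= e / 3 * N (w - a).
  by rewrite ler_wpM2r ?N_ge0// ler_pdivrMr//; lra.
lra.
Qed.

(* [f'] is Lipschitz by the estimates for difference quotients, so these
   converge to it uniformly. *)
Lemma hasd_dv f a r : 0 < r -> ana (oball a r) f -> exists d, hasd (dv f) a d.
Proof.
move=> r0 df; have aB : oball a r a by rewrite /oball /= subrr N0.
have [s1 s10 hs1] := contc_bound (ana_contc df aB).
pose s := Num.min r s1; have s0 : 0 < s by rewrite lt_min r0.
have sr : s <= r by rewrite ge_min lexx.
have ss1 : s <= s1 by rewrite ge_min lexx orbT.
pose M := N (f a) + 1.
have fM z : oball a s z -> N (f z) <= M by move=> zs; apply/ltW/hs1; exact: lt_le_trans zs ss1.
have dfs : ana (oball a s) f by apply: anaS df => z zs; exact: lt_le_trans zs sr.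
pose L := 4 * M / s.
have lip z w := @ana_lip f a s M z w s0 dfs fM; rewrite -/L in lip.
have s40 : 0 < s / 4 by lra.
have M0 : 0 <= M by rewrite /M; have := N_ge0 (f a); lra.
have L0 : 0 <= L by apply: divr_ge0; [exact: mulr_ge0|exact: ltW].
pose q t z := (f (z + t%:C) - f z) / t%:C.
have in4 t z : 0 < t -> t < s / 4 -> oball a (s / 4) z -> oball a (s / 2) z /\ oball a (s / 2) (z + t%:C).
  move=> t0 ts zs; rewrite /oball /= in zs *; split; first lra.
  have := NDB (z + t%:C) a z; rewrite (addrC z) addrK Nr gtr0_norm//; lra.
have half_sub z : oball a (s / 2) z -> oball a s z by rewrite /oball /=; lra.
have dq t : 0 < t -> t < s / 4 -> ana (oball a (s / 4)) (q t).
  move=> t0 ts z zs; have [h1 h2] := in4 _ _ t0 ts zs.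
  have [d1 hd1] := dfs _ (half_sub _ h1); have [d2 hd2] := dfs _ (half_sub _ h2).
  have hd2' := hasd_comp (g := fun w => w + t%:C) (hasdD (hasd_id z) (hasd_cst t%:C z)) hd2.
  by eexists; exact: (hasdM (hasdB hd2' hd1) (hasd_cst t%:C^-1 z)).
have qL t : 0 < t -> t < s / 4 -> forall z, oball a (s / 4) z -> N (q t z) <= L.
  move=> t0 ts z zs; have [h1 h2] := in4 _ _ t0 ts zs.
  have := lip _ _ h1 h2; rewrite (addrC z) addrK [t%:C + z]addrC NM NV Nr gtr0_norm// => h.
  by rewrite ler_pdivrMr.
(* A Lipschitz constant for all quotients [q t] that is independent of [t], hence one for [dv f] as
   [t] tends to 0. *)
pose L2 := 4 * L / (s / 4).
have L20 : 0 <= L2 by apply: divr_ge0; [exact: mulr_ge0|exact: ltW].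
have s8E : s / 4 / 2 = s / 8 by field.
have fL z w : oball a (s / 8) z -> oball a (s / 8) w -> N (dv f w - dv f z) <= L2 * N (w - z).
  move=> zs ws; apply/ler_addgt0Pr => e e0.
  have e20 : 0 < e / 2 by lra.
  have sub x : oball a (s / 8) x -> oball a s x by rewrite /oball /=; lra.
  have app x : oball a (s / 8) x -> exists2 t1, 0 < t1 & forall t, 0 < t -> t < t1 ->
      N (q t x - dv f x) <= e / 2.
    move=> /sub xs; have [t1 t10 h] := hasd_eps (ana_dv dfs xs) e20; exists t1 => // t t0 tt1.
    have Nt : N t%:C = t by rewrite Nr gtr0_norm.
    have tn0 : t%:C != 0 :> C by rewrite -N_gt0 Nt.
    have := h (x + t%:C); rewrite (addrC x) addrK [t%:C + x]addrC Nt => /(_ tt1).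
    have -> : f (x + t%:C) - f x - dv f x * t%:C = (q t x - dv f x) * t%:C by rewrite /q; field.
    by rewrite NM Nt ler_pM2r.
  have [t1 t10 h1] := app _ zs; have [t2 t20 h2] := app _ ws.
  pose t := Num.min (Num.min t1 t2) (s / 4) / 2.
  have m0 : 0 < Num.min (Num.min t1 t2) (s / 4) by rewrite !lt_min t10 t20.
  have m1 : Num.min (Num.min t1 t2) (s / 4) <= t1 by rewrite !ge_min lexx.
  have m2 : Num.min (Num.min t1 t2) (s / 4) <= t2 by rewrite !ge_min lexx orbT.
  have m3 : Num.min (Num.min t1 t2) (s / 4) <= s / 4 by rewrite !ge_min lexx orbT.
  have [k1 k2 k3 k4] : [/\ 0 < t, t < t1, t < t2 & t < s / 4] by rewrite /t; split; lra.
  have := @ana_lip (q t) a (s / 4) L z w s40 (dq t k1 k4) (qL t k1 k4).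
  rewrite s8E -/L2 => /(_ zs ws) k5.
  have k6 := h1 _ k1 k2; have k7 := h2 _ k1 k3.
  have := NDB (dv f w) (dv f z) (q t w); have := NDB (q t w) (dv f z) (q t z).
  rewrite [N (dv f w - q t w)]NB; lra.
apply: (@hasd_unif_limit _ _ (s / 16)); first lra.
move=> e e0.
have K0 : 0 < L2 + 1 by lra.
pose t := Num.min (s / 16) (e / (L2 + 1)) / 2.
have m0 : 0 < Num.min (s / 16) (e / (L2 + 1)) by rewrite lt_min; apply/andP; split; [lra|exact: divr_gt0].
have m1 : Num.min (s / 16) (e / (L2 + 1)) <= s / 16 by rewrite ge_min lexx.
have m2 : Num.min (s / 16) (e / (L2 + 1)) <= e / (L2 + 1) by rewrite ge_min lexx orbT.
have [t0 ts te] : [/\ 0 < t, t < s / 16 & t < e / (L2 + 1)] by rewrite /t; split; lra.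
have ts4 : t < s / 4 by lra.
exists (q t).
  by apply: anaS (dq t t0 ts4) => z; rewrite /oball /=; lra.
move=> z zs; have zs8 : oball a (s / 8) z by move: zs; rewrite /oball /=; lra.
have Nt : N t%:C = t by rewrite Nr gtr0_norm.
have tn0 : t%:C != 0 :> C by rewrite -N_gt0 Nt.
have sub w : cball z t w -> oball a (s / 8) w.
  by rewrite /cball /oball /= in zs * => wt; have := NDB w a z; lra.
have := @mean_value _ (cball z t) (fun w => f w - dv f z * w) (fun w => dv f w - dv f z) (L2 * t) z (z + t%:C) (@cvx_cball _ _ _).
have -> : f (z + t%:C) - dv f z * (z + t%:C) - (f z - dv f z * z) = (q t z - dv f z) * t%:C.
  by rewrite /q; field.
rewrite (addrC z) addrK NM Nt ler_pM2r// => h.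
have : N (q t z - dv f z) <= L2 * t.
  apply: h.
  - move=> w /sub ws; apply: hasdB; last by have := hasdZ (dv f z) (hasd_id w); rewrite mulr1.
    by apply: ana_dv dfs _; move: ws; rewrite /oball /=; lra.
  - move=> w wt; apply: le_trans (fL _ _ zs8 (sub _ wt)) _.
    by rewrite ler_wpM2l.
  - by rewrite /cball /= subrr N0 ltW.
  - by rewrite /cball /= addrK Nt.
rewrite NB; rewrite ltr_pdivlMr// in te; lra.
Qed.

Lemma ana_derivative a r f : ana (oball a r) f -> ana (oball a r) (dv f).
Proof.
move=> df z zr; apply: (@hasd_dv _ _ (r - N (z - a))); first by rewrite subr_gt0.
by apply: anaS df; apply: oball_sub; rewrite subrKC.
Qed.

End CauchyEstimates.

(** * Exponential, logarithm and Bloch's theorem *)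

Section ExpLog.
Variable R : realType.
Notation C := R[i].
Implicit Types (f g F G : C -> C) (z w a b c o d : C) (t s e r M : R) (S U : set C).

Lemma oball_center a r : 0 < r -> oball a r a.
Proof. by move=> r0; rewrite /oball /= subrr N0. Qed.

Definition cexp z : C := (expR (Re z))%:C * (cos (Im z) +i* sin (Im z)).

Lemma cexpD z w : cexp (z + w) = cexp z * cexp w.
Proof.
case: z w => a b [c d]; rewrite /cexp /= expRD cosD sinD.
by apply/eqP; rewrite eq_complex /=; apply/andP; split; apply/eqP; ring.
Qed.

Lemma cexp0 : cexp 0 = 1.
Proof. by rewrite /cexp /= expR0 cos0 sin0 mul1r. Qed.

Lemma N_cexp z : N (cexp z) = expR (Re z).
Proof.
rewrite /cexp NM Nr ger0_norm ?expR_ge0//.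
by rewrite /= cos2Dsin2 sqrtr1 mulr1.
Qed.

Lemma cexp_neq0 z : cexp z != 0.
Proof. by rewrite -N_gt0 N_cexp expR_gt0. Qed.

Lemma cexpN z : cexp (- z) = (cexp z)^-1.
Proof.
apply: (mulIf (cexp_neq0 z)); rewrite -cexpD addNr cexp0 mulVf//.
exact: cexp_neq0.
Qed.

Definition period : C := 0 +i* (pi *+ 2).

Lemma N_period : N period = pi *+ 2.
Proof. by rewrite /period /= expr0n add0r sqrtr_sqr ger0_norm// mulrn_wge0// pi_ge0. Qed.

Lemma period_neq0 : period != 0.
Proof. by rewrite -N_gt0 N_period pmulrn_lgt0// pi_gt0. Qed.

Lemma cexp_period z : cexp (z + period) = cexp z.
Proof.
rewrite cexpD [cexp period](_ : _ = 1) ?mulr1//.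
by rewrite /cexp /period /= expR0 cos2pi sin2pi mul1r.
Qed.

Lemma is_derive_eps (F : R -> R) t v : is_derive t 1 F v -> forall e, 0 < e ->
  exists2 r, 0 < r & forall s, `|s - t| < r -> `|F s - F t - v * (s - t)| <= e * `|s - t|.
Proof. by move=> dF e /(real_derive_eps (@ex_derive _ _ _ _ _ _ _ dF)); rewrite derive1E derive_val. Qed.

Lemma hasd_cexp0 : hasd cexp 0 1.
Proof.
(* The four error terms below are at most [n], [3 n], [4 n] and [n] times [|z|], whence the 9. *)
apply: eps_hasd => e e0; pose n := Num.min (e / 9) 1.
have n0 : 0 < n by rewrite lt_min divr_gt0/=.
have ne' : n <= e / 9 by rewrite ge_min lexx.
have ne : 9 * n <= e by rewrite -ler_pdivlMl // mulrC.
have n1 : n <= 1 by rewrite ge_min lexx orbT.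
clearbody n.
have [r1 r10 h1] := is_derive_eps (is_derive_expR 0) n0.
have [r2 r20 h2] := is_derive_eps (is_derive_cos 0) n0.
have [r3 r30 h3] := is_derive_eps (is_derive_sin 0) n0.
exists (Num.min n (Num.min r1 (Num.min r2 r3))); first by rewrite !lt_min n0 r10 r20.
move=> z; rewrite subr0 !lt_min => /and4P[zn zr1 zr2 zr3].
have x0 := le_Re z; have y0 := le_Im z.
have := h1 (Re z); have := h2 (Im z); have := h3 (Im z).
rewrite !subr0 expR0 cos0 sin0 oppr0 mul0r !(subr0, addr0) !mul1r.
move=> /(_ (le_lt_trans y0 zr3)) k3 /(_ (le_lt_trans y0 zr2)) k2 /(_ (le_lt_trans x0 zr1)) k1.
rewrite cexp0; apply: le_trans (N_le_ReIm _) _.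
have Nz := N_ge0 z.
have -> : Re (cexp z - 1 - z) = (expR (Re z) - 1 - Re z) + expR (Re z) * (cos (Im z) - 1).
  by case: z {x0 y0 k1 k2 k3 zn zr1 zr2 zr3 Nz} => x y; rewrite /cexp /=; ring.
have -> : Im (cexp z - 1 - z) = (expR (Re z) - 1) * sin (Im z) + (sin (Im z) - Im z).
  by case: z {x0 y0 k1 k2 k3 zn zr1 zr2 zr3 Nz} => x y; rewrite /cexp /=; ring.
set E := expR (Re z) in k1 *; set c := cos (Im z) in k2 *; set s := sin (Im z) in k3 *.
have nz : n * N z <= N z by rewrite ler_piMl.
have nx : n * `|Re z| <= n * N z by rewrite ler_pM2l.
have ny : n * `|Im z| <= n * N z by rewrite ler_pM2l.
have E1 : `|E - 1| <= 2 * N z.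
  have -> : E - 1 = (E - 1 - Re z) + Re z by ring.
  by apply: le_trans (ler_normD _ _) _; lra.
have E3 : `|E| <= 3.
  have -> : E = (E - 1) + 1 by ring.
  apply: le_trans (ler_normD _ _) _; rewrite normr1; lra.
have s2 : `|s| <= 2 * N z.
  have -> : s = (s - Im z) + Im z by ring.
  by apply: le_trans (ler_normD _ _) _; lra.
have m1 : `|E * (c - 1)| <= 3 * (n * N z).
  by rewrite normrM ler_pM//; apply: le_trans k2 ny.
have m2 : `|(E - 1) * s| <= (2 * N z) * (2 * N z) by rewrite normrM ler_pM.
have m3 : N z * N z <= n * N z by rewrite ler_wpM2r// ltW.
apply: le_trans (lerD (ler_normD _ _) (ler_normD _ _)) _.
have : 9 * n * N z <= e * N z by rewrite ler_wpM2r.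
lra.
Qed.

Lemma hasd_cexp z : hasd cexp z (cexp z).
Proof.
have h : hasd (fun w => w - z) z 1 by have := hasdB (hasd_id z) (hasd_cst z z); rewrite subr0.
have h0 : hasd cexp (z - z) 1 by rewrite subrr; exact: hasd_cexp0.
have := hasdZ (cexp z) (hasd_comp (g := fun w => w - z) h h0); rewrite !mulr1.
by congr hasd; apply/funext => w; rewrite -cexpD addrC subrK.
Qed.

Lemma hasd0_cst S f z w : cvx S -> (forall x, S x -> hasd f x 0) -> S z -> S w -> f w = f z.
Proof.
move=> cS df Sz Sw; apply/eqP; rewrite -subr_eq0 -N_eq0 eq_le N_ge0 andbT.
rewrite -(mul0r (N (w - z))); apply: (mean_value (f' := fun=> 0) cS df) => // x _.
by rewrite N0.
Qed.

Lemma logarithm g a r : 0 < r -> ana (oball a r) g -> (forall z, oball a r z -> g z != 0) ->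
  exists L, [/\ L a = 0, (forall z, oball a r z -> hasd L z (dv g z / g z)) &
     forall z, oball a r z -> g z = g a * cexp (L z)].
Proof.
move=> r0 dg g0; have [L0 dL0] := primitive (anaM (ana_derivative dg) (anaV dg g0)).
pose L z := L0 z - L0 a.
have dL z : oball a r z -> hasd L z (dv g z / g z).
  by move=> /dL0 h; have := hasdB h (hasd_cst (L0 a) z); rewrite subr0.
have La : L a = 0 by rewrite /L subrr.
exists L; split => // z zr.
have aB : oball a r a by rewrite /oball /= subrr N0.
have : g z * cexp (- L z) = g a * cexp (- L a).
  apply: (hasd0_cst (f := fun z => g z * cexp (- L z)) (@cvx_oball _ a r)) => // x xr.
  have := hasdM (ana_dv dg xr) (hasd_comp (g := fun z => - L z) (hasdN (dL _ xr)) (hasd_cexp _)).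
  by congr hasd; have := g0 _ xr => ?; field.
rewrite La oppr0 cexp0 mulr1 => <-; rewrite cexpN mulfVK//; exact: cexp_neq0.
Qed.

(** Minimize [|f - w|] over the closed ball. The minimum is interior, because [f] moves every
    boundary point at least [|c| r / 2] away from [f z1]; if it were positive, a small Newton step
    would decrease it. *)
Lemma local_surj f f' c z1 r : 0 < r -> c != 0 ->
  (forall x, cball z1 r x -> hasd f x (f' x) /\ N (f' x - c) <= N c / 2) ->
  forall w, N (w - f z1) < N c * r / 4 -> exists2 z, oball z1 r z & f z = w.
Proof.
move=> r0 c0 H w wr; have Nc : 0 < N c by rewrite N_gt0.
have Sz1 : cball z1 r z1 by rewrite /cball /= subrr N0 ltW.
have low x : cball z1 r x -> N c / 2 * N (x - z1) <= N (f x - f z1).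
  move=> xr; have := @mean_value _ (cball z1 r) (fun z => f z - c * z) (fun z => f' z - c)
    (N c / 2) z1 x (@cvx_cball _ _ _).
  have -> : f x - c * x - (f z1 - c * z1) = f x - f z1 - c * (x - z1) by ring.
  move=> h; have {}h : N (f x - f z1 - c * (x - z1)) <= N c / 2 * N (x - z1).
    apply: h => // y yr; last exact: (H y yr).2.
    by apply: hasdB (H y yr).1 _; have := hasdZ c (hasd_id y); rewrite mulr1.
  by have := NBr (c * (x - z1)) (f x - f z1); rewrite [N (c * _ - _)]NB NM; lra.
have cf x : cball z1 r x -> contr (fun z => - N (f z - w)) x.
  move=> xr; have := contrB (contr_cst 0 x) (contrN (contcB (hasd_contc (H x xr).1) (contc_cst w x))).
  by congr contr; apply/funext => z; rewrite sub0r.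
have [x xr hx] := cball_max (ltW r0) cf.
have hx' z : cball z1 r z -> N (f x - w) <= N (f z - w) by move=> /hx; rewrite lerN2.
have xint : N (x - z1) < r.
  rewrite ltNge; apply/negP => xe; have xE : N (x - z1) = r by move: xr; lra.
  have := low _ xr; rewrite xE; have := hx' _ Sz1; rewrite [N (f z1 - w)]NB.
  have := NDB (f x) (f z1) w; lra.
exists x => //; apply/eqP; rewrite -subr_eq0; apply/negP => /negP y0.
have [dfx dc] := H _ xr.
have d0 : f' x != 0.
  by apply: contraTneq dc => ->; rewrite sub0r NN -ltNge; lra.
set y := f x - w in y0 hx'.
have Ny : 0 < N y by rewrite N_gt0.
(* The Newton direction: the step [t h] replaces [y] by [(1 - t) y] up to an error of at most
   [t |y| / 2]. *)
pose h := - y / f' x.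
have h0 : 0 < N h by rewrite NM NN NV divr_gt0// N_gt0.
have [|s s0 hs] := hasd_eps dfx (e := N y / (2 * N h)); first by rewrite divr_gt0// mulr_gt0.
pose m := Num.min (Num.min s (r - N (x - z1))) (N h).
have m0 : 0 < m by rewrite !lt_min s0 h0 andbT; lra.
have m1 : m <= s by rewrite !ge_min lexx.
have m2 : m <= r - N (x - z1) by rewrite !ge_min lexx orbT.
have m3 : m <= N h by rewrite !ge_min lexx orbT.
pose t := m / 2 / N h.
have t0 : 0 < t by rewrite !divr_gt0.
have t1 : t <= 1 by rewrite /t ler_pdivrMr//; lra.
have th : t * N h = m / 2 by rewrite /t divfK// gt_eqF.
pose v := x + t%:C * h.
have vx : v - x = t%:C * h by rewrite /v; ring.
have Nvx : N (v - x) = m / 2 by rewrite vx NM Nr gtr0_norm.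
have vr : cball z1 r v by rewrite /cball /=; have := NDB v z1 x; lra.
have := hx' _ vr; have := hs v; rewrite Nvx => /(_ ltac:(lra)).
have -> : f v - f x - f' x * (v - x) = (f v - w) - y * (1 - t)%:C.
  by rewrite vx /h /y rmorphB rmorph1; field.
have -> : N y / (2 * N h) * (m / 2) = N y * t / 2.
  by rewrite -th; field; rewrite gt_eqF.
have := NBr (f v - w) (y * (1 - t)%:C); rewrite NM Nr ger0_norm ?subr_ge0//.
have : 0 < N y * t by rewrite mulr_gt0.
lra.
Qed.

(* Landau's argument: take the point where [|f'| (r - |z - a|)] is largest; near
   it [f] is almost linear. *)
Lemma bloch f a r R' : 0 < r -> r < R' -> ana (oball a R') f ->
  exists w0, forall w, N (w - w0) < N (dv f a) * r / 128 -> exists2 z, oball a r z & f z = w.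
Proof.
move=> r0 rR df.
have [->|f'a] := eqVneq (dv f a) 0.
  by exists 0 => w; rewrite N0 mul0r mul0r => h; have := N_ge0 (w - 0); lra.
have Nf : 0 < N (dv f a) by rewrite N_gt0.
have ddf := ana_derivative df.
have cu z : N (z - a) <= r -> contr (fun z => N (dv f z) * (r - N (z - a))) z.
  move=> zr; have zR : oball a R' z by exact: le_lt_trans zr rR.
  apply: contrM; first exact: contrN (ana_contc ddf zR).
  apply: contrB; first exact: contr_cst.
  by apply: contrN; apply: contcB; [exact: contc_id|exact: contc_cst].
have [z1 z1r hz1] := cball_max (ltW r0) cu.
pose t := (r - N (z1 - a)) / 2; pose m := N (dv f z1).
have ua : N (dv f a) * r <= m * (2 * t).
  have := hz1 a; rewrite subrr N0 subr0 => /(_ (ltW r0)).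
  by have -> : r - N (z1 - a) = 2 * t by rewrite /t; field.
have t0' : 0 <= t by rewrite /t; lra.
have t0 : 0 < t.
  rewrite lt_neqAle t0' andbT; apply/eqP => t00; move: ua; rewrite -t00 !mulr0.
  by apply/negP; rewrite -ltNge mulr_gt0.
have m0' : 0 <= m by exact: N_ge0.
have m0 : 0 < m.
  rewrite lt_neqAle m0' andbT; apply/eqP => m00; move: ua; rewrite -m00 !mul0r.
  by apply/negP; rewrite -ltNge mulr_gt0.
have rz : N (z1 - a) = r - 2 * t by rewrite /t; field.
have sub : oball z1 t `<=` oball a R' by apply: oball_sub; lra.
have f2m z : oball z1 t z -> N (dv f z) <= 2 * m.
  move=> zt; have za : N (z - a) <= r - t by have := NDB z a z1; rewrite /oball /= in zt; lra.
  have := hz1 z; rewrite -/m (_ : r - N (z1 - a) = 2 * t); last by rewrite rz; ring.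
  move=> /(_ ltac:(lra)) h; have : N (dv f z) * t <= N (dv f z) * (r - N (z - a)).
    by rewrite ler_wpM2l ?N_ge0//; lra.
  by move=> h'; rewrite -(ler_pM2r t0); lra.
have lip z w := @ana_lip _ (dv f) z1 t (2 * m) z w t0 (anaS sub ddf) f2m.
have zz1 : oball z1 (t / 2) z1 by rewrite /oball /= subrr N0; lra.
exists (f z1) => w wr.
(* [f'] is Lipschitz with constant [8 m / t] near [z1], so it varies by at most [m / 2] over radius
   [t / 16]. The disk of values then has radius [m t / 64], at least [|f' a| r / 128] by the choice
   of [z1]. *)
have t160 : 0 < t / 16 by lra.
have [|||z zt <-] := @local_surj f (dv f) (dv f z1) z1 (t / 16) t160 _ _ w.
- by rewrite -N_gt0.
- move=> x; rewrite /cball /= => xt; have xr : oball z1 (t / 2) x by rewrite /oball /=; lra.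
  split; first by apply: ana_dv df _; apply: sub; rewrite /oball /=; lra.
  apply: le_trans (lip _ _ zz1 xr) _; rewrite -/m.
  have -> : m / 2 = 4 * (2 * m) / t * (t / 16) by field; rewrite gt_eqF.
  by rewrite ler_wpM2l// divr_ge0// mulr_ge0// mulr_ge0.
- by rewrite -/m; lra.
exists z => //; have := NDB z a z1; rewrite /oball /= in zt *; lra.
Qed.

(** The modulus [2 pi] of the period times the denominator 128 of [bloch]. *)
Definition bloch_const : R := 256 * pi.

Lemma bloch_const_gt0 : 0 < bloch_const.
Proof. by apply: mulr_gt0; [rewrite ltr0n|exact: pi_gt0]. Qed.

(* [L = log ((f - w) / (f z - w))] and its translate by the period of [cexp] have
   disjoint images, so the image of [L] contains no large disk; Bloch's theorem
   then bounds [L']. *)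
Lemma omitted_value f z r w : 0 < r -> ana (oball z r) f -> set_inj (oball z r) f ->
  (forall x, oball z r x -> f x != w) -> N (dv f z) * r <= bloch_const * N (f z - w).
Proof.
move=> r0 df fi fw; have zB : oball z r z by rewrite /oball /= subrr N0.
have dg : ana (oball z r) (fun x => f x - w) by apply: anaB => //; exact: ana_cst.
have g0 x : oball z r x -> f x - w != 0 by move=> /fw; rewrite subr_eq0.
have [L [L0 dL LE]] := logarithm r0 dg g0.
have dgE x : oball z r x -> dv (fun x => f x - w) x = dv f x.
  by move=> xr; apply: dvE; have := hasdB (ana_dv df xr) (hasd_cst w x); rewrite subr0.
have Ng : 0 < N (f z - w) by rewrite N_gt0 g0.
apply: (le_lim_mul (lexx 0) r0) => t t0 tr.
have [w0 hw0] := bloch t0 tr (anaP dL).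
rewrite (dvE (dL _ zB)) dgE// NM NV in hw0.
pose s := N (dv f z) / N (f z - w) * t / 128; rewrite -/s in hw0.
suff : s <= pi *+ 2.
  move=> h; have -> : N (dv f z) * t = s * (128 * N (f z - w)) by rewrite /s; field; rewrite gt_eqF.
  have -> : bloch_const * N (f z - w) = pi *+ 2 * (128 * N (f z - w)) by rewrite /bloch_const mulr2n; ring.
  by rewrite ler_pM2r// mulr_gt0.
rewrite leNgt; apply/negP => sP.
have tr' x : oball z t x -> oball z r x by move=> xt; exact: lt_trans xt tr.
have [|z1 /tr' z1t E1] := hw0 w0; first by rewrite subrr N0 (le_lt_trans _ sP)// mulrn_wge0// pi_ge0.
have [|z2 /tr' z2t E2] := hw0 (w0 + period); first by rewrite addrC addKr N_period.
have : z1 = z2.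
  apply: fi; rewrite ?inE//; apply: (addIr (- w)).
  by rewrite (LE _ z1t) (LE _ z2t) E1 E2 cexp_period.
move=> z12; have := period_neq0; rewrite -(addKr w0 period) -E2 -z12 E1 addNr eqxx; by [].
Qed.

Lemma koebe f z r w : 0 < r -> ana (oball z r) f -> set_inj (oball z r) f ->
  bloch_const * N (w - f z) < N (dv f z) * r -> exists2 x, oball z r x & f x = w.
Proof.
move=> r0 df fi wr; apply: contrapT => nex.
have := @omitted_value f z r w r0 df fi; rewrite [N (f z - w)]NB leNgt wr /=.
have fw x : oball z r x -> f x != w by move=> xr; apply/eqP => E; apply: nex; exists x.
by move=> /(_ fw).
Qed.

(** By [omitted_value], the logarithm of [f - w] has derivative at most [bloch_const / (1 - s)] on
    the disk of radius [s]; integrate from 0. *)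
Lemma growth_omitted f w s z : ana (oball 0 1) f -> set_inj (oball 0 1) f ->
  (forall x, oball 0 1 x -> f x != w) -> s < 1 -> N z < s ->
  N (f z - w) <= N (f 0 - w) * expR (bloch_const / (1 - s)).
Proof.
move=> df fi fw s1 zs.
have dg : ana (oball 0 1) (fun x => f x - w) by apply: anaB => //; exact: ana_cst.
have g0 x : oball 0 1 x -> f x - w != 0 by move=> /fw; rewrite subr_eq0.
have dgE x : oball 0 1 x -> dv (fun x => f x - w) x = dv f x.
  by move=> xr; apply: dvE; have := hasdB (ana_dv df xr) (hasd_cst w x); rewrite subr0.
have [L [L0 dL LE]] := logarithm ltr01 dg g0.
have s0 : 0 < s by apply: le_lt_trans zs; exact: N_ge0.
have Bs x : oball 0 s x -> oball 0 1 x by rewrite /oball /=; lra.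
have Lz : N (L z - L 0) <= bloch_const / (1 - s) * N (z - 0).
  apply: (mean_value (S := oball 0 s) (f' := fun x => dv (fun x => f x - w) x / (f x - w)) (@cvx_oball _ _ _)).
  - by move=> x /Bs/dL.
  - move=> x xs; have x1 := Bs _ xs; rewrite dgE// NM NV.
    rewrite ler_pdivrMr ?N_gt0 ?g0//.
    have rx : 0 < 1 - N x by move: xs; rewrite /oball /= subr0; lra.
    have sub : oball x (1 - N x) `<=` oball 0 1 by apply: oball_sub; rewrite subr0 subrKC.
    have h : N (dv f x) * (1 - N x) <= bloch_const * N (f x - w).
      by apply: omitted_value (anaS sub df) _ _ => // [y v|y /sub/fw//]; rewrite !inE => /sub yr /sub vr; apply: fi; rewrite inE.
    rewrite mulrAC ler_pdivlMr; last lra.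
    apply: le_trans h; rewrite ler_wpM2l ?N_ge0//; move: xs; rewrite /oball /= subr0; lra.
  - exact: oball_center.
  - by rewrite /oball /= subr0.
rewrite (LE z); last by apply: Bs; rewrite /oball /= subr0.
rewrite NM ler_wpM2l ?N_ge0// N_cexp ler_expR.
move: Lz; rewrite L0 !subr0 => Lz.
have := le_Re (L z); rewrite ler_norml => /andP[_ h].
apply: le_trans h _; apply: le_trans Lz _.
rewrite ler_piMr//; last by lra.
by rewrite divr_ge0 ?ltW ?bloch_const_gt0// subr_gt0.
Qed.

End ExpLog.

(** * Hurwitz's theorem and univalent functions *)

Section Univalent.
Variable R : realType.
Notation C := R[i].
Implicit Types (f g F G : C -> C) (z w a b c o d : C) (t s e r M : R) (S U : set C).
Notation A := (bloch_const R).

(* Schwarz's lemma for the Cayley transform of [log (M / k)], whose real part is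
   positive. *)
Lemma harnack k a r M z : 0 < r -> ana (oball a r) k -> (forall x, oball a r x -> k x != 0) ->
  (forall x, oball a r x -> N (k x) < M) -> oball a (r / 2) z -> N (k a) ^+ 3 <= M ^+ 2 * N (k z).
Proof.
move=> r0 dk k0 kM zr.
have [L [L0 dL LE]] := logarithm r0 dk k0.
have aB := oball_center a r0.
have zB : oball a r z by move: zr; rewrite /oball /=; lra.
have Na : 0 < N (k a) by rewrite N_gt0 k0.
have M0 : 0 < M by apply: lt_trans (kM _ aB).
pose x0 := ln (M / N (k a)).
have ex0 : expR x0 = M / N (k a) by rewrite lnK// posrE divr_gt0.
have x00 : 0 < x0 by rewrite ln_gt0// ltr_pdivlMr// mul1r kM.
have ReL x : oball a r x -> Re (L x) < x0.
  move=> xr; rewrite -ltr_expR ex0 ltr_pdivlMr// mulrC -N_cexp -NM -LE//; exact: kM.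
pose U x := x0%:C - L x.
have dU : ana (oball a r) U by apply: anaB (anaP dL); exact: ana_cst.
have ReU x : oball a r x -> 0 < Re (U x).
  by move=> /ReL; rewrite /U; case: (L x) => p q /=; rewrite subr_gt0.
have num x : N (U x - x0%:C) ^+ 2 = N (U x + x0%:C) ^+ 2 - 4 * x0 * Re (U x).
  by rewrite !Nsq; case: (U x) => p q /=; ring.
have den x : oball a r x -> U x + x0%:C != 0.
  move=> /ReU h; apply: contraTneq h => E; have : Re (U x + x0%:C) = 0 by rewrite E.
  by case: (U x) => p q /= h; rewrite -leNgt; lra.
pose q x := (U x - x0%:C) / (U x + x0%:C).
have dq : ana (oball a r) q.
  by apply: anaM; [apply: anaB|apply: anaV; [apply: anaD|]] => //; exact: ana_cst.
have Ua : U a = x0%:C by rewrite /U L0 subr0.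
have qa : q a = 0 by rewrite /q Ua subrr mul0r.
have q1 x : oball a r x -> N (q x - q a) <= 1.
  move=> xr; rewrite qa subr0 /q NM NV ler_pdivrMr ?N_gt0 ?den// mul1r.
  rewrite -(ler_pXn2r (n := 2)) ?nnegrE ?N_ge0// num.
  have : 0 < x0 * Re (U x) by rewrite mulr_gt0// ReU.
  lra.
have [h _] := schwarz r0 dq q1.
have {}h := h z zB; rewrite qa subr0 /q NM NV ler_pdivrMr ?N_gt0 ?den// in h.
have h2 : N (U z - x0%:C) <= 2^-1 * N (U z + x0%:C).
  apply: le_trans h _; rewrite ler_wpM2r ?N_ge0// div1r ler_pdivrMl//.
  by move: zr; rewrite /oball /=; lra.
(* The Cayley transform has modulus at most 1/2 at [z], which forces [Re U <= 3 x0], that is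
   [Re L >= - 2 x0]. This is the origin of the exponents 3 and 2. *)
have u3 : Re (U z) <= 3 * x0.
  rewrite leNgt; apply/negP => u3.
  have : N (U z - x0%:C) ^+ 2 <= (2^-1 * N (U z + x0%:C)) ^+ 2.
    by rewrite lerXn2r ?nnegrE ?N_ge0//; apply: mulr_ge0; rewrite ?N_ge0.
  rewrite exprMn !Nsq; case: (U z) u3 => p v /= u3; rewrite subr0 addr0.
  have := sqr_ge0 v; rewrite !expr2.
  have : (p + x0) * (p + x0) < (2 * (p - x0)) * (2 * (p - x0)) by apply: ltr_pM; lra.
  lra.
have ReLz : - (2 * x0) <= Re (L z).
  by move: u3; rewrite /U; case: (L z) => p v /=; lra.
rewrite (LE z zB) NM N_cexp.
have : expR (- (2 * x0)) <= expR (Re (L z)) by rewrite ler_expR.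
rewrite expRN (expRM_natl 2) ex0 => h3.
have -> : N (k a) ^+ 3 = M ^+ 2 * (N (k a) * (M / N (k a)) ^- 2).
  by field; rewrite !gt_eqF.
by rewrite ler_pM2l ?exprn_gt0// ler_pM2l.
Qed.

(** By [harnack], a zero-free approximant that is not small at [a] is not small at nearby points
    either, and this bound passes to [f]. The step length depends only on [|z|], so finitely many
    steps lead from 0 to [z]. Stating the hypothesis as approximability covers both sequences and
    difference quotients. *)
Lemma hurwitz f : (forall z, oball 0 1 z -> contc f z) ->
  (forall s e, 0 < s -> s < 1 -> 0 < e -> exists g, [/\ ana (oball 0 s) g,
     forall z, oball 0 s z -> g z != 0 & forall z, oball 0 s z -> N (f z - g z) <= e]) ->
  f 0 != 0 -> forall z, oball 0 1 z -> f z != 0.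
Proof.
move=> cf H f0 z z1; have Nz : N z < 1 by move: z1; rewrite /oball /= subr0.
have Nz0 := N_ge0 z.
pose s := (1 + N z) / 2; have [s0 s1 zs] : [/\ 0 < s, s < 1 & N z < s] by rewrite /s; split; lra.
have [m0 m0s hm] : exists2 c, N (c - 0) <= s & forall x, N (x - 0) <= s -> N (f x) <= N (f c).
  by apply: cball_max => [|x xs]; [lra|apply/contrN/cf; rewrite /oball /=; lra].
pose M := N (f m0) + 2.
have M0 : 0 < M by rewrite /M; have := N_ge0 (f m0); lra.
pose r := s - N z.
have r0 : 0 < r by rewrite /r; lra.
have step a b : N a <= N z -> N (b - a) < r / 2 -> f a != 0 -> f b != 0.
  move=> az ba fa; apply/eqP => fb.
  have Nfa : 0 < N (f a) by rewrite N_gt0.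
  (* Small enough that [|g x| < M], [|g a| >= |f a| / 2], and [M^2 |g b| < |g a|^3] if [f b = 0],
     against [harnack]. *)
  pose e := Num.min (Num.min 1 (N (f a) / 2)) ((N (f a) / 2) ^+ 3 / (2 * M ^+ 2)).
  have k0 : 0 < (N (f a) / 2) ^+ 3 / (2 * M ^+ 2).
    by rewrite divr_gt0 ?exprn_gt0 ?mulr_gt0 ?exprn_gt0//; lra.
  have e0 : 0 < e by rewrite !lt_min k0 ltr01/= andbT; lra.
  have e1 : e <= 1 by rewrite !ge_min lexx.
  have e2 : e <= N (f a) / 2 by rewrite !ge_min lexx orbT.
  have e3 : e <= (N (f a) / 2) ^+ 3 / (2 * M ^+ 2) by rewrite !ge_min lexx !orbT.
  have [g [dg g0 fg]] := H s e s0 s1 e0.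
  have sub : oball a r `<=` oball 0 s by apply: oball_sub; rewrite subr0 /r; lra.
  have gM x : oball a r x -> N (g x) < M.
    move=> /sub xs; have := fg x xs; have := hm x (ltW xs); have := NBr (g x) (f x).
    by rewrite NB /M; lra.
  have := harnack r0 (anaS sub dg) (fun x h => g0 x (sub x h)) gM ba.
  have aB : oball 0 s a by apply: sub; exact: oball_center.
  have bB : oball 0 s b by apply: sub; rewrite /oball /=; lra.
  have ga : N (f a) / 2 <= N (g a) by have := fg a aB; have := NBr (f a) (g a); lra.
  have gb : N (g b) <= e by have := fg b bB; rewrite fb sub0r NN.
  apply/negP; rewrite -ltNge.
  have h1 : (N (f a) / 2) ^+ 3 <= N (g a) ^+ 3.
    by rewrite ler_pXn2r ?nnegrE ?N_ge0//; lra.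
  apply: lt_le_trans h1; apply: le_lt_trans (_ : M ^+ 2 * e < _).
    by rewrite ler_pM2l ?exprn_gt0.
  have MM : 0 < 2 * M ^+ 2 by rewrite mulr_gt0 ?exprn_gt0.
  rewrite ler_pdivlMr// in e3; have : 0 < e * M ^+ 2 by rewrite mulr_gt0 ?exprn_gt0.
  lra.
have [n hn] : exists n : nat, N z / n.+1%:R < r / 2.
  exists (Num.bound `|N z / (r / 2)|); rewrite ltr_pdivrMr ?ltr0n// mulrC -ltr_pdivrMr; last lra.
  apply: le_lt_trans (ler_norm _) _; apply: lt_trans (archi_boundP _) _ => //.
  by rewrite ltr_nat.
have n0 : (n.+1%:R : R) != 0 by rewrite pnatr_eq0.
pose p k : C := (k%:R / n.+1%:R : R)%:C * z.
have Np k : N (p k) = k%:R / n.+1%:R * N z.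
  by rewrite NM Nr ger0_norm// divr_ge0// ler0n.
have ind k : (k <= n.+1)%N -> f (p k) != 0.
  elim: k => [_|k IH kn]; first by rewrite /p mul0r rmorph0 mul0r.
  apply: step (IH (ltnW kn)).
    by rewrite Np ler_piMl// ler_pdivrMr ?ltr0n// mul1r ler_nat ltnW.
  have -> : p k.+1 - p k = (n.+1%:R^-1 : R)%:C * z.
    by rewrite /p -mulrBl -rmorphB -mulrBl -natr1 (addrC k%:R) addrK mul1r.
  by rewrite NM Nr ger0_norm ?invr_ge0 ?ler0n// mulrC.
by have := ind n.+1 (leqnn _); rewrite /p divff// rmorph1 mul1r.
Qed.

Lemma unif_diff_quot f s e : ana (oball 0 1) f -> 0 < s -> s < 1 -> 0 < e ->
  exists t, [/\ 0 < t, t < 1 - s & forall z, oball 0 s z ->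
   N (dv f z - (f (z + t%:C) - f z) / t%:C) <= e].
Proof.
move=> df s0 s1 e0; have ddf := ana_derivative df.
have [|d d0 hd] := @cball_unif _ 0 s (dv f) _ e e0.
  by move=> z zs; apply: ana_contc ddf _; rewrite /oball /=; lra.
pose t := Num.min d (1 - s) / 2.
have [t0 td ts] : [/\ 0 < t, t < d & t < 1 - s].
  have m0 : 0 < Num.min d (1 - s) by rewrite lt_min d0; lra.
  have m1 : Num.min d (1 - s) <= d by rewrite ge_min lexx.
  have m2 : Num.min d (1 - s) <= 1 - s by rewrite ge_min lexx orbT.
  by rewrite /t; split; lra.
have Nt : N t%:C = t by rewrite Nr gtr0_norm.
have t0' : t%:C != 0 :> C by rewrite -N_gt0 Nt.
exists t; split => // z zs.
have := @mean_value _ (cball z t) (fun w => f w - dv f z * w) (fun w => dv f w - dv f z) e z (z + t%:C) (@cvx_cball _ _ _).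
have -> : f (z + t%:C) - dv f z * (z + t%:C) - (f z - dv f z * z) =
   ((f (z + t%:C) - f z) / t%:C - dv f z) * t%:C by field.
rewrite (addrC z) addrK NM Nt ler_pM2r// [N (_ / _ - _)]NB; apply.
- move=> w wt; apply: hasdB; last by have := hasdZ (dv f z) (hasd_id w); rewrite mulr1.
  by apply: ana_dv df _; rewrite /cball /oball /= in zs wt *; have := NDB w 0 z; lra.
- by move=> w wt; apply/ltW/hd; [exact: ltW|exact: le_lt_trans wt td].
- by rewrite /cball /= subrr N0 ltW.
- by rewrite /cball /= addrK Nt.
Qed.

(* Hurwitz applied to the difference quotients of [f], which have no zeros. *)
Lemma univalent_dv_neq0 f : ana (oball 0 1) f -> set_inj (oball 0 1) f -> dv f 0 != 0 ->
  forall z, oball 0 1 z -> dv f z != 0.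
Proof.
move=> df fi f'0; have ddf := ana_derivative df.
apply: hurwitz => // [z zB|s e s0 s1 e0]; first exact: ana_contc ddf zB.
have [t [t0 ts ht]] := unif_diff_quot df s0 s1 e0.
have Nt : N t%:C = t by rewrite Nr gtr0_norm.
have t0' : t%:C != 0 :> C by rewrite -N_gt0 Nt.
have sub z : oball 0 s z -> oball 0 1 z /\ oball 0 1 (z + t%:C).
  rewrite /oball /= => zs; split; first lra.
  by have := NDB (z + t%:C) 0 z; rewrite (addrC z) addrK Nt; lra.
exists (fun z => (f (z + t%:C) - f z) / t%:C); split => //.
- move=> z /sub[/df[d1 h1] /df[d2 h2]].
  have h2' := hasd_comp (g := fun w => w + t%:C) (hasdD (hasd_id z) (hasd_cst t%:C z)) h2.
  by eexists; exact: (hasdM (hasdB h2' h1) (hasd_cst t%:C^-1 z)).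
- move=> z /sub[z1 z2]; rewrite mulf_neq0 ?invr_neq0// subr_eq0; apply/eqP => E.
  have : z + t%:C = z by apply: fi; rewrite ?inE.
  by move/eqP; rewrite -subr_eq0 (addrC z) addrK (negPf t0').
Qed.

Definition disk_inv f w := xget 0 [set z | oball 0 1 z /\ f z = w].

Lemma disk_invK f z : set_inj (oball 0 1) f -> oball 0 1 z -> disk_inv f (f z) = z.
Proof.
move=> fi zB; rewrite /disk_inv; case: xgetP => [x _ [xB xE]|/(_ z)[]//].
by apply: fi; rewrite ?inE.
Qed.

(** Koebe's theorem puts the preimages of points close to [f z] in any given ball about [z], so the
    inverse is continuous at [f z]. Its difference quotient is the reciprocal of that of [f]. *)
Lemma hasd_disk_inv f z : ana (oball 0 1) f -> set_inj (oball 0 1) f -> oball 0 1 z -> dv f z != 0 ->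
  hasd (disk_inv f) (f z) (dv f z)^-1.
Proof.
move=> df fi zB f'z.
have Nf : 0 < N (dv f z) by rewrite N_gt0.
have z1 : 0 < 1 - N z by move: zB; rewrite /oball /= subr0; lra.
have A0 := bloch_const_gt0 R.
have loc r : 0 < r -> r <= 1 - N z -> exists2 s, 0 < s & forall w, N (w - f z) < s ->
    exists2 x, oball z r x & oball 0 1 x /\ f x = w.
  move=> r0 rz; exists (N (dv f z) * r / A); first by rewrite divr_gt0// mulr_gt0.
  have sub : oball z r `<=` oball 0 1 by apply: oball_sub; rewrite subr0; lra.
  move=> w; rewrite ltr_pdivlMr// mulrC => wr.
  have [x y|x xr xw] := koebe r0 (anaS sub df) _ wr; last by exists x => //; split => //; exact: sub.
  by rewrite !inE => /sub xr /sub yr; apply: fi; rewrite inE.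
have [phi [cphi phiz] E] := ana_dv df zB.
have cdisk_inv : contc (disk_inv f) (f z).
  move=> e e0; have [|s s0 h] := loc (Num.min e (1 - N z)) _ (ltac:(by rewrite ge_min lexx orbT)).
    by rewrite lt_min e0.
  exists s => // w /h[x xr [x1 <-]]; rewrite !disk_invK//.
  by move: xr; rewrite /oball /= lt_min => /andP[].
have [s s0 h] := loc _ z1 (lexx _).
exists (fun w => if w == f z then (dv f z)^-1 else (disk_inv f w - z) / (w - f z)).
  split; last by rewrite eqxx.
  have cV : contc (fun w => (phi (disk_inv f w))^-1) (f z).
    apply: contcV; first by rewrite disk_invK// phiz.
    by apply: contc_comp => //; rewrite disk_invK.
  apply: (contc_near s0 _ cV) => w /h[x xr [x1 <-]].
  rewrite disk_invK//; case: eqVneq => [fxz|fxz].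
    by rewrite -(disk_invK fi x1) fxz disk_invK// phiz.
  have xz : x - z != 0.
    by rewrite subr_eq0; apply: contraNneq fxz => ->.
  have p0 : phi x != 0.
    by move: fxz; rewrite -subr_eq0 E; apply: contraNneq => ->; rewrite mul0r.
  by rewrite E; field; apply/andP.
move=> w; case: eqVneq => [->|wz]; first by rewrite !subrr mulr0.
by rewrite disk_invK// mulfVK// subr_eq0.
Qed.

End Univalent.

(** * Normalized univalent functions *)

Section Normalized.
Variable R : realType.
Notation C := R[i].
Implicit Types (f g F G : C -> C) (z w a b c o d : C) (t s e r M : R) (S U : set C).
Notation A := (bloch_const R).

(** In the order of [C], the condition [0 < dv f 0] also says that the derivative is real. *)
Definition univalent0 f := [/\ ana (oball 0 1) f, set_inj (oball 0 1) f, f 0 = 0 & 0 < dv f 0].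

Lemma univalent0_dv0 f : univalent0 f -> 0 < N (dv f 0) /\ dv f 0 = (N (dv f 0))%:C.
Proof.
by move=> [_ _ _ /posC[x x0 ->]]; rewrite Nr gtr0_norm.
Qed.

Lemma univalent0_dv f z : univalent0 f -> oball 0 1 z -> dv f z != 0.
Proof.
move=> uf; have [d0 _] := univalent0_dv0 uf; case: uf => df fi _ _.
by apply: univalent_dv_neq0 => //; rewrite -N_gt0.
Qed.

(** Schwarz's lemma for the inverse function, which maps the disk of radius [r] into the unit
    disk. *)
Lemma inner_radius f r : univalent0 f -> 0 < r -> oball 0 r `<=` f @` oball 0 1 -> r <= N (dv f 0).
Proof.
move=> uf r0 sub; have [d0 _] := univalent0_dv0 uf; have [df fi f0 _] := uf.
have dh : ana (oball 0 r) (disk_inv f).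
  move=> w /sub[z zB <-]; exists (dv f z)^-1; apply: hasd_disk_inv => //; exact: univalent0_dv.
have h00 : disk_inv f 0 = 0 by rewrite -{1}f0 disk_invK//; exact: oball_center.
have hM w : oball 0 r w -> N (disk_inv f w - disk_inv f 0) <= 1.
  move=> /sub[z zB <-]; rewrite disk_invK// h00; exact: ltW.
have [_ h] := schwarz r0 dh hM.
have := hasd_disk_inv df fi (oball_center 0 ltr01) (univalent0_dv uf (oball_center 0 ltr01)).
rewrite f0 => /h; rewrite NV div1r lef_pV2 ?posrE//.
Qed.

Lemma koebe0 f : univalent0 f -> oball 0 (N (dv f 0) / A) `<=` f @` oball 0 1.
Proof.
move=> [df fi f0 _] w; rewrite /oball /= ltr_pdivlMr ?bloch_const_gt0// => h.
have [|x xB xw] := koebe (w := w) ltr01 df fi; last by exists x.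
by rewrite f0 mulr1 mulrC.
Qed.

Definition growth_const s : R := 2 * (1 + expR (A / (1 - s))).

(** By [inner_radius] the image does not contain the disk of radius [2 |f'(0)|], so it omits some
    [w] there, and [growth_omitted] applies to this [w]. This is the 2 in [growth_const]. *)
Lemma growth f s z : univalent0 f -> s < 1 -> N z < s -> N (f z) <= N (dv f 0) * growth_const s.
Proof.
move=> uf s1 zs; have [d0 _] := univalent0_dv0 uf; have [df fi f0 _] := uf.
have [w w2 wout] : exists2 w, N w < 2 * N (dv f 0) & forall x, oball 0 1 x -> f x != w.
  apply: contrapT => nex.
  have : 2 * N (dv f 0) <= N (dv f 0); last lra.
  apply: inner_radius => //; first by lra.
  move=> w; rewrite /oball /= subr0 => ww; apply: contrapT => nw; apply: nex; exists w => // x xB.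
  by apply/eqP => xw; apply: nw; exists x.
have := growth_omitted df fi wout s1 zs; rewrite f0 sub0r NN => h.
have := NBr (f z) w; set E := expR _ in h *.
have E0 : 0 < E by exact: expR_gt0.
have : N w * E <= 2 * N (dv f 0) * E by rewrite ler_wpM2r// ltW.
rewrite /growth_const -/E; lra.
Qed.

Lemma image_open f w : univalent0 f -> (f @` oball 0 1) w ->
  exists2 r, 0 < r & oball w r `<=` f @` oball 0 1.
Proof.
move=> uf [z zB <-]; have [df fi f0 _] := uf.
have fz := univalent0_dv uf zB.
have z1 : 0 < 1 - N z by move: zB; rewrite /oball /= subr0; lra.
have sub : oball z (1 - N z) `<=` oball 0 1 by apply: oball_sub; rewrite subr0 subrKC.
exists (N (dv f z) * (1 - N z) / A).
  by rewrite divr_gt0 ?bloch_const_gt0// mulr_gt0// N_gt0.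
move=> v; rewrite /oball /= ltr_pdivlMr ?bloch_const_gt0// mulrC => vv.
have [x y|x xr xv] := koebe z1 (anaS sub df) _ vv; last by exists x => //; exact: sub.
by rewrite !inE => /sub xr /sub yr; apply: fi; rewrite inE.
Qed.

(** If [d] were not zero, a small step [h] with [d h = t f z] and [t > 0] would multiply [f z] by
    [1 + t], up to an error of half the gain. *)
Lemma norm_max_dv f z d r : 0 < r -> hasd f z d -> f z != 0 ->
  (forall w, oball z r w -> N (f w) <= N (f z)) -> d = 0.
Proof.
move=> r0 hd fz hmax; apply/eqP; apply: contrapT => /negP d0.
have Nd : 0 < N d by rewrite N_gt0.
have Nf : 0 < N (f z) by rewrite N_gt0.
have [|s s0 hs] := hasd_eps hd (e := N d / 2); first lra.
pose m := Num.min r s / 2.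
have [m0 mr ms] : [/\ 0 < m, m < r & m < s].
  have k0 : 0 < Num.min r s by rewrite lt_min r0.
  have k1 : Num.min r s <= r by rewrite ge_min lexx.
  have k2 : Num.min r s <= s by rewrite ge_min lexx orbT.
  by rewrite /m; split; lra.
pose t := m * N d / N (f z).
have t0 : 0 < t by rewrite divr_gt0// mulr_gt0.
pose h := t%:C * f z / d.
have Nh : N h = m.
  by rewrite /h !NM NV Nr gtr0_norm// /t; field; rewrite !gt_eqF.
have := hs (z + h); have := hmax (z + h); rewrite /oball /= (addrC z) addrK Nh.
move=> /(_ mr) h1 /(_ ms).
have -> : d * h = t%:C * f z by rewrite /h mulrC divfK.
have := NBr ((1 + t)%:C * f z) (f (h + z)).
have -> : (1 + t)%:C * f z - f (h + z) = - (f (h + z) - f z - t%:C * f z).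
  by rewrite rmorphD rmorph1; ring.
rewrite NN NM Nr ger0_norm; last lra.
have tE : t * N (f z) = m * N d by rewrite /t divfK// gt_eqF.
have : 0 < m * N d by rewrite mulr_gt0.
lra.
Qed.

Lemma disk_inv_comp f g : univalent0 f -> univalent0 g -> f @` oball 0 1 = g @` oball 0 1 ->
  [/\ ana (oball 0 1) (fun z => disk_inv g (f z)), forall z, oball 0 1 z -> oball 0 1 (disk_inv g (f z)),
   forall z, oball 0 1 z -> g (disk_inv g (f z)) = f z & forall z, oball 0 1 z -> N (disk_inv g (f z)) <= N z].
Proof.
move=> uf ug E; have [df fi f0 _] := uf; have [dg gi g0 _] := ug.
have ex z : oball 0 1 z -> exists2 x, oball 0 1 x & g x = f z.
  by move=> /(imageP f); rewrite E => -[x]; exists x.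
have inB z : oball 0 1 z -> oball 0 1 (disk_inv g (f z)).
  by move=> /ex[x xB <-]; rewrite disk_invK.
have dphi : ana (oball 0 1) (fun z => disk_inv g (f z)).
  move=> z zB; have [x xB xz] := ex z zB; exists ((dv g x)^-1 * dv f z).
  apply: hasd_comp; first exact: ana_dv df zB.
  by rewrite -xz; apply: hasd_disk_inv => //; exact: univalent0_dv.
split => //.
  by move=> z /ex[x xB <-]; rewrite disk_invK.
have p0 : disk_inv g (f 0) = 0 by rewrite f0 -{1}g0 disk_invK//; exact: oball_center.
have [|h _] := schwarz (M := 1) ltr01 dphi.
  by move=> z /inB; rewrite p0 subr0 /oball /= subr0 => /ltW.
by move=> z zB; have := h z zB; rewrite p0 !subr0 divr1 mul1r.
Qed.

(* The transition map is a self-map of the disk preserving the modulus. *)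
Lemma univalent0_unique f g : univalent0 f -> univalent0 g -> f @` oball 0 1 = g @` oball 0 1 ->
  forall z, oball 0 1 z -> f z = g z.
Proof.
move=> uf ug E z0 z0B; have [df fi f0 _] := uf; have [dg gi g0 _] := ug.
have [dphi pB pE pN] := disk_inv_comp uf ug E.
have [_ qB qE qN] := disk_inv_comp ug uf (esym E).
pose phi z := disk_inv g (f z); rewrite -/phi in dphi.
have pN' z : oball 0 1 z -> N (phi z) = N z.
  move=> zB; apply/le_anti; rewrite pN//=.
  have := qN _ (pB _ zB); rewrite pE// disk_invK//.
have B00 := oball_center (0 : C) (@ltr01 R).
have p0 : phi 0 = 0 by rewrite /phi f0 -{1}g0 disk_invK.
have dp0 : hasd phi 0 ((dv g 0)^-1 * dv f 0).
  apply: hasd_comp; first exact: ana_dv df B00.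
  rewrite f0 -[X in hasd _ X _]g0; apply: hasd_disk_inv => //; exact: univalent0_dv.
suff : phi z0 = z0 by move=> h; rewrite -{2}h pE.
have [->//|z00] := eqVneq z0 0.
have Nz0 : 0 < N z0 by rewrite N_gt0.
(* The half-open segment from 0 to [z0] is convex and avoids 0. On it [phi x / x] has modulus 1, so
   its derivative vanishes by [norm_max_dv] and it is constant. *)
pose S : set C := [set x | exists2 t, 0 < t <= 1 & x = t%:C * z0].
have cS : cvx S.
  move=> x y t [s /andP[s0 s1] ->] [u /andP[u0 u1] ->] /andP[t0 t1].
  exists (s + (u - s) * t); last by rewrite rmorphD rmorphM rmorphB; ring.
  apply/andP; split; last by nra.
  have [tz|tn] := eqVneq t 0; first by rewrite tz mulr0 addr0.
  have tp : 0 < t by rewrite lt_neqAle eq_sym tn.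
  have ut : 0 < u * t by rewrite mulr_gt0.
  have st : 0 <= s * (1 - t) by apply: mulr_ge0; [exact: ltW|rewrite subr_ge0].
  have -> : s + (u - s) * t = s * (1 - t) + u * t by ring.
  lra.
have SB x : S x -> x != 0 /\ oball 0 1 x.
  move=> [t /andP[t0 t1] ->].
  have tn : t%:C != 0 :> C by rewrite -N_gt0 Nr gtr0_norm.
  split; first by rewrite mulf_neq0.
  rewrite /oball /= subr0 NM Nr gtr0_norm//; apply: le_lt_trans (_ : N z0 < 1).
    by rewrite ler_piMl ?N_ge0.
  by move: z0B; rewrite /oball /= subr0.
pose q x := phi x * x^-1.
have Nq x : oball 0 1 x -> x != 0 -> N (q x) = 1.
  by move=> xB x0; rewrite /q NM NV pN'// divff// N_eq0.
have dq x : S x -> hasd q x 0.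
  move=> /SB[x0 xB]; have Nx : 0 < N x by rewrite N_gt0.
  have [d hd] : exists d, hasd q x d.
    by eexists; exact: (hasdM (ana_dv dphi xB) (hasdV x0 (hasd_id x))).
  have x1 : N x < 1 by move: xB; rewrite /oball /= subr0.
  have -> : 0 = d; last by [].
  apply/esym; apply: (@norm_max_dv q x d (Num.min (N x) (1 - N x))) => //.
  - by rewrite lt_min Nx subr_gt0.
  - by rewrite -N_gt0 Nq.
  move=> w; rewrite /oball /= lt_min => /andP[w1 w2].
  rewrite !Nq//.
  - by rewrite /oball /= subr0; have := NBr w x; lra.
  - by apply: contraTneq w1 => ->; rewrite sub0r NN ltxx.
have Sz0 : S z0 by exists 1; rewrite ?ltr01 ?lexx// rmorph1 mul1r.
have qS x : S x -> q x = q z0 by move=> Sx; exact: (hasd0_cst cS dq Sz0 Sx).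
set c := _ * _ in dp0.
(* Letting [x] tend to 0 along the segment identifies the constant with [f'(0) / g'(0)], which is
   positive and has modulus 1. *)
have cE : c = q z0.
  move: dp0 => [pp [cpp <-] Epp]; apply/eqP; rewrite -subr_eq0 -N_eq0 eq_le N_ge0 andbT.
  apply/ler_addgt0Pr => e e0; rewrite add0r; have [r r0 hr] := cpp e e0.
  pose t := Num.min 1 (r / (2 * N z0)).
  have k0 : 0 < r / (2 * N z0) by rewrite divr_gt0// mulr_gt0.
  have t0 : 0 < t by rewrite lt_min ltr01.
  have t1 : t <= 1 by rewrite ge_min lexx.
  have t2 : t <= r / (2 * N z0) by rewrite ge_min lexx orbT.
  have St : S (t%:C * z0) by exists t; rewrite ?t0.
  have [x0 _] := SB _ St.
  have := Epp (t%:C * z0); rewrite p0 !subr0 => E1.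
  have := qS _ St; rewrite /q E1 mulfK// => E2.
  rewrite -[phi z0 / z0]E2 NB; apply/ltW/hr; rewrite subr0 NM Nr gtr0_norm//.
  apply: le_lt_trans (_ : r / (2 * N z0) * N z0 < r); first by rewrite ler_pM2r.
  have -> : r / (2 * N z0) * N z0 = r / 2 by field; rewrite gt_eqF.
  lra.
have [f'0 f'E] := univalent0_dv0 uf; have [g'0 g'E] := univalent0_dv0 ug.
have c1 : c = 1.
  have cr : c = (N (dv f 0) / N (dv g 0))%:C by rewrite /c f'E g'E !Nr !ger0_norm ?N_ge0// rmorphM fmorphV mulrC.
  have := Nq z0 z0B z00; rewrite -cE cr Nr ger0_norm ?divr_ge0 ?N_ge0// => ->.
  by rewrite rmorph1.
have : q z0 = 1 by rewrite -cE.
by rewrite /q => /(congr1 ( *%R^~ z0)); rewrite mul1r divfK.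
Qed.

End Normalized.

(** * Locally uniform limits *)

Section Limits.
Variable R : realType.
Notation C := R[i].
Implicit Types (f g F G : C -> C) (z w a b c o d v u : C) (t s e r M : R) (S U : set C).
Notation A := (bloch_const R).

Lemma N_le_eps z : (forall e, 0 < e -> N z <= e) -> z = 0.
Proof.
move=> h; apply: ComplexField.Normc.eq0_normc; apply/le_anti; rewrite N_ge0 andbT.
by apply/ler_addgt0Pr => e e0; rewrite add0r; exact: h.
Qed.

(** Locally uniform convergence tested on concentric disks only, with real tolerances. *)
Definition luc (fn : nat -> C -> C) f := forall s e, s < 1 -> 0 < e ->
  exists n0, forall n, (n0 <= n)%N -> forall z, oball 0 s z -> N (fn n z - f z) <= e.

Lemma oball0P r z : oball 0 r z <-> N z < r.
Proof. by rewrite /oball /= subr0. Qed.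

Lemma oball01_nbhs z : oball 0 1 z -> [/\ 0 < (1 - N z) / 2, N z + (1 - N z) / 2 < 1 &
  oball z ((1 - N z) / 2) `<=` oball 0 (N z + (1 - N z) / 2)].
Proof.
by move=> /oball0P z1; split; [lra|lra|apply: oball_sub; rewrite subr0].
Qed.

Lemma luc_ana fn f : (forall n, ana (oball 0 1) (fn n)) -> luc fn f -> ana (oball 0 1) f.
Proof.
move=> dfn h z /oball01_nbhs[r0 s1 sub]; apply: (hasd_unif_limit r0) => e e0.
have [n0 hn] := h _ e s1 e0; exists (fn n0).
  by apply: anaS (dfn n0) => x /sub/oball0P xs; apply/oball0P; lra.
by move=> x /sub xs; rewrite NB; exact: hn.
Qed.

Lemma luc_dv fn f : (forall n, ana (oball 0 1) (fn n)) -> luc fn f ->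
  luc (fun n => dv (fn n)) (dv f).
Proof.
move=> dfn h s e s1 e0; have df := luc_ana dfn h.
pose s' := (1 + s) / 2; pose r := s' - s.
have [s'1 r0] : s' < 1 /\ 0 < r by rewrite /r /s'; split; lra.
have [|n0 hn] := h s' (e * r / 2) s'1; first by rewrite divr_gt0// mulr_gt0.
exists n0 => n nn z /oball0P zs.
have sub : oball z r `<=` oball 0 s' by apply: oball_sub; rewrite subr0 /r; lra.
have sub1 : oball z r `<=` oball 0 1 by move=> x /sub/oball0P xs; apply/oball0P; lra.
have zB : oball 0 1 z by apply/oball0P; lra.
have := ana_close r0 (anaS sub1 (dfn n)) (anaS sub1 df) (fun x h => hn n nn x (sub x h)) (ana_dv (dfn n) zB) (ana_dv df zB).
by have -> : 2 * (e * r / 2) / r = e by field; rewrite gt_eqF.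
Qed.

Lemma luc_pt fn f z : luc fn f -> oball 0 1 z -> forall e, 0 < e ->
  exists n0, forall n, (n0 <= n)%N -> N (fn n z - f z) <= e.
Proof.
move=> h /oball0P z1 e e0; have [|n0 hn] := h ((1 + N z) / 2) e _ e0; first lra.
by exists n0 => n /hn; apply; apply/oball0P; lra.
Qed.

Lemma luc_dv0 fn f : (forall n, univalent0 (fn n)) -> luc fn f ->
  dv f 0 = (N (dv f 0))%:C.
Proof.
move=> ufn h; have dfn n : ana (oball 0 1) (fn n) by case: (ufn n).
apply/eqP; rewrite -subr_eq0 -N_eq0 eq_le N_ge0 andbT; apply/ler_addgt0Pr => e e0.
have e20 : 0 < e / 2 by lra.
have [n0 hn] := luc_pt (luc_dv dfn h) (oball_center 0 ltr01) e20.
have {}hn := hn n0 (leqnn _); have [_ E] := univalent0_dv0 (ufn n0).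
rewrite add0r; set x := dv f 0 in hn *; set y := dv (fn n0) 0 in hn E.
apply: le_trans (NDB _ _ y) _; rewrite [y - (N x)%:C](_ : _ = (N y - N x)%:C); last first.
  by rewrite {1}E rmorphB.
rewrite Nr NB; have := NBr y x; have := NBr x y; rewrite [N (x - y)]NB => h1 h2.
have : `|N y - N x| <= N (y - x) by rewrite ler_norml; lra.
lra.
Qed.

Lemma luc_univalent0 fn f : (forall n, univalent0 (fn n)) -> luc fn f -> dv f 0 != 0 -> univalent0 f.
Proof.
move=> ufn h f'0; have dfn n : ana (oball 0 1) (fn n) by case: (ufn n).
have df := luc_ana dfn h; have hd := luc_dv dfn h; have ddf := ana_derivative df.
have f'z z : oball 0 1 z -> dv f z != 0.
  apply: (hurwitz _ _ f'0) => [x xB|s e s0 s1 e0]; first exact: ana_contc ddf xB.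
  have [n0 hn] := hd s e s1 e0.
  have sub x : oball 0 s x -> oball 0 1 x by move=> /oball0P xs; apply/oball0P; lra.
  exists (dv (fn n0)); split => [|x /sub xB|x xs].
  - exact: anaS sub (ana_derivative (dfn n0)).
  - exact: univalent0_dv.
  - by rewrite NB; exact: hn.
split => //.
- move=> z1 z2; rewrite !inE => z1B z2B E; apply: contrapT => /eqP z12.
  have N12 : 0 < N (z2 - z1) by rewrite N_gt0 subr_eq0 eq_sym.
  have z11 : N z1 < 1 by exact/oball0P.
  pose r := Num.min (N (z2 - z1)) (1 - N z1).
  have r0 : 0 < r by rewrite lt_min N12 subr_gt0.
  have r1 : r <= N (z2 - z1) by rewrite ge_min lexx.
  have r2 : r <= 1 - N z1 by rewrite ge_min lexx orbT.
  have sub : oball z1 r `<=` oball 0 1 by apply: oball_sub; rewrite subr0; lra.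
  (* On the ball of radius [r] about [z1] the function [fn n] omits its own value at [z2]. Since
     [dv f z1] is not zero, the left-hand side stays away from 0 as [n] grows. *)
  have key n : N (dv (fn n) z1) * r <= A * N (fn n z1 - fn n z2).
    have [dn ni _ _] := ufn n.
    apply: omitted_value (anaS sub dn) _ _ => //.
      by move=> x y; rewrite !inE => /sub xB /sub yB; apply: ni; rewrite inE.
    move=> x xr; apply/eqP => xE; have : x = z2 by apply: ni; rewrite ?inE//; exact: sub.
    by move=> xz2; move: xr; rewrite xz2 /oball /=; lra.
  have Nd : 0 < N (dv f z1) by rewrite N_gt0 f'z.
  have A0 := bloch_const_gt0 R.
  pose e := Num.min (N (dv f z1) / 2) (N (dv f z1) * r / (8 * A)).
  have k0 : 0 < N (dv f z1) * r / (8 * A) by rewrite divr_gt0// mulr_gt0.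
  have e0 : 0 < e by rewrite lt_min k0 andbT; lra.
  have e1 : e <= N (dv f z1) / 2 by rewrite ge_min lexx.
  have e2 : e <= N (dv f z1) * r / (8 * A) by rewrite ge_min lexx orbT.
  clearbody e.
  have [n1 h1] := luc_pt h z1B e0; have [n2 h2] := luc_pt h z2B e0.
  have [n3 h3] := luc_pt hd z1B e0.
  pose n := maxn n1 (maxn n2 n3).
  have := h1 n (leq_maxl _ _); have := h2 n (leq_trans (leq_maxl _ _) (leq_maxr _ _)).
  have := h3 n (leq_trans (leq_maxr _ _) (leq_maxr _ _)) => k3 k2 k1.
  have k4 : N (fn n z1 - fn n z2) <= 2 * e.
    by apply: le_trans (NDB _ _ (f z1)) _; rewrite {2}E [N (f z2 - _)]NB; lra.
  have k5 : N (dv f z1) / 2 <= N (dv (fn n) z1).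
    by have := NBr (dv f z1) (dv (fn n) z1); rewrite NB; lra.
  have := key n; apply/negP; rewrite -ltNge.
  apply: lt_le_trans (_ : N (dv f z1) / 2 * r <= _); last by rewrite ler_pM2r.
  apply: le_lt_trans (_ : A * (2 * e) < _); first by rewrite ler_pM2l.
  have A8 : 0 < 8 * A by apply: mulr_gt0.
  rewrite ler_pdivlMr// in e2.
  have : 0 < N (dv f z1) * r by rewrite mulr_gt0.
  lra.
- apply: N_le_eps => e e0.
  have [n0 hn] := luc_pt h (oball_center 0 ltr01) e0.
  have := hn n0 (leqnn _); have [_ _ -> _] := ufn n0; by rewrite sub0r NN.
- by rewrite (luc_dv0 ufn h) ltcR N_gt0.
Qed.

Lemma luc_zero fn f : (forall n, univalent0 (fn n)) -> luc fn f -> dv f 0 = 0 ->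
  forall z, oball 0 1 z -> f z = 0.
Proof.
move=> ufn h f'0 z zB; have dfn n : ana (oball 0 1) (fn n) by case: (ufn n).
have z1 : N z < 1 by exact/oball0P.
pose s := (1 + N z) / 2; have [s1 zs] : s < 1 /\ N z < s by rewrite /s; split; lra.
pose K := growth_const s.
have K0 : 0 < K by rewrite /K /growth_const mulr_gt0// addr_gt0 ?expR_gt0.
apply: N_le_eps => e e0.
have e1 : 0 < e / 2 / K by rewrite !divr_gt0.
have e2 : 0 < e / 2 by lra.
have [n1 h1] := luc_pt (luc_dv dfn h) (oball_center 0 ltr01) e1.
have [n2 h2] := luc_pt h zB e2.
pose n := maxn n1 n2; have k1 := h1 n (leq_maxl _ _); have k2 := h2 n (leq_maxr _ _).
rewrite f'0 subr0 ler_pdivlMr// in k1.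
have := growth (ufn n) s1 zs; rewrite -/K; have := NBr (f z) (fn n z); rewrite NB; lra.
Qed.

End Limits.

(** * Kernels *)

Section Kernels.
Variable R : realType.
Notation C := R[i].
Implicit Types (f g F G : C -> C) (z w a b c o v u : C) (t s e r d M : R) (S U V K : set C).
Notation A := (bloch_const R).

Lemma disk_oball r : disk r = oball (0 : C) r.
Proof.
by apply/seteqP; split => z /=; rewrite /oball /= subr0 => h; exact/diskE.
Qed.

Lemma segment_image_connected (h : R -> C) : cont01 h -> connected (h @` [set t | in01 t]).
Proof.
move=> ch; have -> : [set t : R | in01 t] = [set` `[0, 1]%R].
  by apply/seteqP; split => t /=; rewrite in_itv.
apply: connected_continuous_connected; first exact: segment_connected.
apply/subspace_continuousP => t; rewrite /= in_itv /= => t01 P /nbhsCP[r r0 hr].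
have [d d0 hd] := ch t t01 r r0.
rewrite /nbhs /= /within /=; apply/nbhs_ballP; exists d => //= s; rewrite /ball /= => st s01.
by apply: hr; apply: hd; [move: s01; rewrite in_itv|rewrite distrC].
Qed.

Lemma star_connected (U : set C) c : U c ->
  (forall z, U z -> exists h : R -> C, [/\ cont01 h, h 0 = c, h 1 = z & forall t, in01 t -> U (h t)]) ->
  connected U.
Proof.
move=> Uc H; have -> : U = \bigcup_(A in [set A | [/\ connected A, A c & A `<=` U]]) A.
  apply/seteqP; split => [z /H[h [ch h0 h1 hU]]|z [A [_ _ AU] Az]]; last exact: AU.
  have i0 : in01 (0 : R) by rewrite /in01; lra.
  have i1 : in01 (1 : R) by rewrite /in01; lra.
  exists (h @` [set t | in01 t]); last by exists 1.
  by split; [exact: segment_image_connected|exists 0|move=> _ [t t01 <-]; exact: hU].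
apply: bigcup_connected; last by move=> ? [].
by exists c => A' [].
Qed.

Lemma cont01_ray f z : ana (oball 0 1) f -> oball 0 1 z -> cont01 (fun t => f (t%:C * z)).
Proof.
move=> df zB t t01 e e0; have z1 : N z < 1 by exact/oball0P.
have Bt s : in01 s -> oball 0 1 (s%:C * z).
  move=> /andP[s0 s1]; apply/oball0P; rewrite NM Nr ger0_norm//.
  by apply: le_lt_trans z1; rewrite ler_piMl ?N_ge0.
have [r r0 h] := ana_contc df (Bt t t01) e0; exists r => // s s01 st; apply: h.
rewrite -mulrBl -rmorphB NM Nr; apply: le_lt_trans st.
by rewrite ler_piMr// ltW.
Qed.

Lemma image_domain f : univalent0 f -> domain (f @` oball 0 1).
Proof.
move=> uf; have [df fi f0 _] := uf; split.
- by exists (f 0); exists 0 => //; exact: oball_center.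
- by apply/openCP => z /(image_open uf).
- apply: (@star_connected _ (f 0)); first by exists 0 => //; exact: oball_center.
  move=> _ [z zB <-]; exists (fun t => f (t%:C * z)).
  rewrite rmorph0 rmorph1 mul0r mul1r; split => //; first exact: cont01_ray.
  move=> t /andP[t0 t1]; exists (t%:C * z) => //; apply/oball0P.
  rewrite NM Nr ger0_norm//; apply: le_lt_trans (_ : N z < 1); last exact/oball0P.
  by rewrite ler_piMl ?N_ge0.
Qed.

Lemma compact_sub_ball (K : set C) : compact K -> exists2 M, 0 < M & K `<=` oball 0 M.
Proof.
move=> cK; have [z _|s [sP cov]] := compact_fin_cover (Q := fun _ r => r = 1) cK.
  by exists 1.
have [M M0 hM] : exists2 M, 0 < M & forall p, p \in s -> N p.1 < M.
  elim: s {sP cov} => [|p s [M M0 hM]]; first by exists 1.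
  exists (N p.1 + M + 1); first by have := N_ge0 p.1; lra.
  move=> q; rewrite inE => /orP[/eqP ->|/hM]; first by lra.
  by have := N_ge0 p.1; lra.
exists (M + 1); first lra.
move=> z /cov[p /[dup] /sP[_ _ ->] /hM pM zp]; apply/oball0P.
by have := NBr z p.1; lra.
Qed.

Lemma setT_domain : domain [set: C].
Proof.
split; [by exists 0|exact: openT|apply: (@star_connected _ 0) => // z _].
have z1 : 0 < N z + 1 by have := N_ge0 z; lra.
exists (fun t => t%:C * z); rewrite rmorph0 rmorph1 mul0r mul1r; split => //.
move=> t _ e e0; exists (e / (N z + 1)); first by rewrite divr_gt0.
move=> s _ st; rewrite -mulrBl -rmorphB NM Nr.
apply: le_lt_trans (_ : `|s - t| * (N z + 1) < e); first by rewrite ler_wpM2l//; lra.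
by rewrite -ltr_pdivlMr.
Qed.

Lemma covers_images fn f : (forall n, univalent0 (fn n)) -> luc fn f -> dv f 0 != 0 ->
  eventually_covers_compacts (fun n => fn n @` oball 0 1) (f @` oball 0 1).
Proof.
move=> ufn h f'0 K cK KU; have uf := luc_univalent0 ufn h f'0.
have dfn n : ana (oball 0 1) (fn n) by case: (ufn n).
have hd := luc_dv dfn h; have A0 := bloch_const_gt0 R.
pose Q w d := exists n0, forall n, (n0 <= n)%N -> oball w d `<=` fn n @` oball 0 1.
have [_ /KU[z zB <-]|s [sP cov]] := compact_fin_cover (Q := Q) cK.
  have z1 : N z < 1 by exact/oball0P.
  pose m := N (dv f z); have m0 : 0 < m by rewrite N_gt0 univalent0_dv.
  have r0 : 0 < 1 - N z by rewrite subr_gt0.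
  (* Koebe's radius for [f] at [z] is [m (1 - |z|) / A]; the divisor 8 leaves room for [|fn n'(z)|]
     to drop to [m / 2] and for [fn n z] to lie at distance [d] from [f z]. *)
  pose d := m * (1 - N z) / (8 * A).
  have A8 : 0 < 8 * A by apply: mulr_gt0.
  have mr : 0 < m * (1 - N z) by apply: mulr_gt0.
  have d0 : 0 < d by rewrite divr_gt0.
  have Ad : A * (2 * d) < m / 2 * (1 - N z).
    by rewrite /d (_ : A * _ = m * (1 - N z) / 4); [lra|field; rewrite gt_eqF].
  have m20 : 0 < m / 2 by lra.
  exists d => //; have [n1 h1] := luc_pt h zB d0; have [n2 h2] := luc_pt hd zB m20.
  exists (maxn n1 n2) => n; rewrite geq_max => /andP[/h1 k1 /h2 k2] v vd.
  have [dn ni _ _] := ufn n.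
  have sub : oball z (1 - N z) `<=` oball 0 1 by apply: oball_sub; rewrite subr0 subrKC.
  have k3 : m / 2 <= N (dv (fn n) z) by have := NBr (dv f z) (dv (fn n) z); rewrite NB -/m; lra.
  have [x y||x xr <-] := @koebe _ (fn n) z (1 - N z) v r0 (anaS sub dn).
  - by rewrite !inE => /sub xB /sub yB; apply: ni; rewrite inE.
  - apply: lt_le_trans (_ : m / 2 * (1 - N z) <= _); last by rewrite ler_pM2r.
    apply: le_lt_trans Ad; rewrite ler_pM2l//.
    by have := NDB v (fn n z) (f z); rewrite [N (f z - _)]NB /oball /= in vd *; lra.
  by exists x => //; exact: sub.
have [n0 hn] : exists n0, forall n, (n0 <= n)%N -> forall p, p \in s -> oball p.1 p.2 `<=` fn n @` oball 0 1.
  have {cov} : forall p, p \in s -> Q p.1 p.2 by move=> p /sP[].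
  elim: s {sP} => [_|p s IH hs]; first by exists 0%N.
  have [|n1 h1] := IH; first by move=> q qs; apply: hs; rewrite inE qs orbT.
  have [n2 h2] := hs p (mem_head _ _).
  exists (maxn n1 n2) => n; rewrite geq_max => /andP[nn1 nn2] q.
  by rewrite inE => /orP[/eqP ->|]; [exact: h2|exact: h1].
exists n0 => // n /= nn z /cov[p ps zp]; exact: (hn n nn p ps).
Qed.

Lemma moebius_id a b : N (1 - a^* * b) ^+ 2 - N (b - a) ^+ 2 = (1 - N a ^+ 2) * (1 - N b ^+ 2).
Proof. by rewrite !Nsq; case: a => x y; case: b => p q /=; ring. Qed.

(** Pseudo-hyperbolic distance at most 1/2 from [a] keeps [b] off the unit circle. The Moebius
    identity yields [1 - |b|^2 >= 3/4 (1 - |a|)^2], and removing the square halves the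
    coefficient. *)
Lemma pseudo_hyperbolic a b : N a < 1 -> N b < 1 -> N (b - a) <= 2^-1 * N (1 - a^* * b) ->
  N b <= 1 - 3 / 8 * (1 - N a) ^+ 2.
Proof.
move=> a1 b1 h; have a0 := N_ge0 a; have b0 := N_ge0 b.
have E := moebius_id a b.
have h1 : 1 - N a <= N (1 - a^* * b).
  have := NBr 1 (a^* * b); rewrite N1 NM NJ => h2.
  have : N a * N b <= N a by rewrite ler_piMr// ltW.
  lra.
have h2 : N (b - a) ^+ 2 <= (2^-1 * N (1 - a^* * b)) ^+ 2.
  by rewrite lerXn2r ?nnegrE ?N_ge0//; apply: mulr_ge0; rewrite ?N_ge0.
have h3 : (1 - N a) ^+ 2 <= N (1 - a^* * b) ^+ 2.
  by rewrite lerXn2r ?nnegrE ?N_ge0//; lra.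
rewrite exprMn in h2.
have h4 : (1 - N a ^+ 2) * (1 - N b ^+ 2) <= 1 - N b ^+ 2.
  by rewrite ler_piMl//; rewrite ?expr2; nra.
have h5 : N b ^+ 2 <= 1 - 3 / 4 * (1 - N a) ^+ 2.
  have : (2^-1 : R) ^+ 2 = 4^-1 by rewrite expr2; lra.
  move=> h6; rewrite h6 in h2; lra.
rewrite leNgt; apply/negP => h6.
have h7 : (1 - N a) ^+ 2 <= 1 by rewrite expr2; nra.
move: h5 h6; set x := (1 - N a) ^+ 2 in h7 *; have x0 : 0 <= x by exact: sqr_ge0.
move=> h5 h6; have : (1 - 3 / 8 * x) ^+ 2 < N b ^+ 2 by rewrite ltr_pXn2r ?nnegrE//; lra.
rewrite !expr2 in h5 *; have : 0 <= x * x by rewrite mulr_ge0.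
lra.
Qed.

(* At a boundary point [v] of the image lying in [V], the preimages of [v] under
   [fn n] stay in a compact part of the disk by Schwarz-Pick. *)
Lemma kernel_maximal fn f V : (forall n, univalent0 (fn n)) -> luc fn f -> dv f 0 != 0 ->
  kernel_candidate (fun n => fn n @` oball 0 1) V -> V `<=` f @` oball 0 1.
Proof.
move=> ufn h f'0 [[V0 oV cV] V00 cov]; have uf := luc_univalent0 ufn h f'0.
have [df fi f0 _] := uf.
(* The claim makes the image relatively closed in [V]; it is also open and meets [V] at 0, so
   connectedness of [V] concludes. *)
suff main v : V v -> (forall r, 0 < r -> exists2 u, N (u - v) < r & (f @` oball 0 1) u) -> (f @` oball 0 1) v.
  suff -> : V = V `&` (f @` oball 0 1) by move=> z [].
  apply/esym/cV.
  - by exists 0; split => //; exists 0 => //; exact: oball_center.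
  - by exists (f @` oball 0 1) => //; apply/openCP => z /(image_open uf).
  - exists [set v | forall r, 0 < r -> exists2 u, N (u - v) < r & (f @` oball 0 1) u].
      apply: closedCP => z hz r r0; have r20 : 0 < r / 2 by lra.
      have [w wz hw] := hz _ r20; have [u uw fu] := hw _ r20.
      by exists u => //; have := NDB u z w; lra.
    apply/seteqP; split => z [Vz hz]; split => //; last exact: main.
    by move=> r r0; exists z => //; rewrite subrr N0.
move=> Vv clv; have [r1 r10 hr1] := (openCP V).1 oV v Vv.
pose r := r1 / 2; have r0 : 0 < r by rewrite /r; lra.
have [n1 _ h1] : \forall n \near \oo, cball v r `<=` fn n @` oball 0 1.
  apply: cov; first exact: cball_compact.
  by move=> z zr; apply: hr1; rewrite /cball /= /r in zr; lra.
have r80 : 0 < r / 8 by lra.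
have [u uv [a aB fa]] := clv _ r80.
have a1 : N a < 1 by exact/oball0P.
have [n2 h2] := luc_pt h aB r80.
pose s := 1 - 3 / 8 * (1 - N a) ^+ 2.
have sq0 : 0 < (1 - N a) ^+ 2 by rewrite exprn_gt0// subr_gt0.
have s1 : s < 1 by rewrite /s; lra.
have key n : (n1 <= n)%N -> (n2 <= n)%N -> exists2 b, N b <= s & fn n b = v.
  move=> /h1 sub /h2 k2; have un := ufn n; have [dn ni _ _] := un.
  pose w0 := fn n a.
  have w0v : N (w0 - v) < r / 4.
    by have := NDB w0 v u; rewrite fa -/w0 in k2; lra.
  have subB : oball w0 (r / 2) `<=` cball v r.
    by move=> x xw; rewrite /cball /oball /= in xw *; have := NDB x v w0; lra.
  have inB x : oball w0 (r / 2) x -> oball 0 1 (disk_inv (fn n) x).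
    by move=> /subB/sub[y yB <-]; rewrite disk_invK.
  have dh : ana (oball w0 (r / 2)) (disk_inv (fn n)).
    move=> x /subB/sub[y yB <-]; exists (dv (fn n) y)^-1; apply: hasd_disk_inv => //.
    exact: univalent0_dv.
  have hw0 : disk_inv (fn n) w0 = a by rewrite disk_invK.
  (* The inverse of [fn n] on the ball of radius [r / 2] about [w0], followed by the disk
     automorphism sending [a] to 0. Since [v] is within [r / 4] of [w0], Schwarz's lemma gives
     [|q v| <= 1/2]. *)
  pose q x := (disk_inv (fn n) x - a) / (1 - a^* * disk_inv (fn n) x).
  have den x : oball w0 (r / 2) x -> 1 - a^* * disk_inv (fn n) x != 0.
    move=> /inB/oball0P xB; rewrite -N_gt0; have := NBr 1 (a^* * disk_inv (fn n) x).
    rewrite N1 NM NJ; have : N a * N (disk_inv (fn n) x) < 1.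
      by have := N_ge0 a; have := N_ge0 (disk_inv (fn n) x); nra.
    lra.
  have dq : ana (oball w0 (r / 2)) q.
    apply: anaM; first by apply: anaB => //; exact: ana_cst.
    by apply: anaV => //; apply: anaB; [exact: ana_cst|apply: anaM => //; exact: ana_cst].
  have q0 : q w0 = 0 by rewrite /q hw0 subrr mul0r.
  have r20 : 0 < r / 2 by lra.
  have [|hq _] := @schwarz _ q w0 (r / 2) 1 r20 dq.
    move=> x xw; rewrite q0 subr0 /q NM NV ler_pdivrMr ?N_gt0 ?den// mul1r.
    have /oball0P xB := inB x xw.
    rewrite -(ler_pXn2r (n := 2)) ?nnegrE ?N_ge0// -subr_ge0 moebius_id.
    by apply: mulr_ge0; rewrite subr_ge0 expr_le1 ?N_ge0// ltW.
  have vw0 : oball w0 (r / 2) v by rewrite /oball /= NB; lra.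
  exists (disk_inv (fn n) v); last first.
    by have /sub[y yB <-] := subB _ vw0; rewrite disk_invK.
  apply: pseudo_hyperbolic => //; first by apply/oball0P; exact: inB.
  have := hq v vw0; rewrite q0 subr0 /q NM NV ler_pdivrMr ?N_gt0 ?den// => h3.
  apply: le_trans h3 _; rewrite ler_wpM2r ?N_ge0// NB.
  have -> : 1 / (r / 2) * N (w0 - v) = 2 * N (w0 - v) / r by field; rewrite gt_eqF.
  rewrite ler_pdivrMr//; lra.
pose n0 := maxn n1 n2.
have /choice[b hb] n : exists b, (n0 <= n)%N -> N b <= s /\ fn n b = v.
  case: (leqP n0 n) => [|_]; last by exists 0.
  rewrite geq_max => /andP[k1 k2]; have [b b1 b2] := key n k1 k2; by exists b.
(* The preimages of [v] stay in the closed disk of radius [s < 1]; a limit point [l] of theirs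
   satisfies [f l = v] by uniform convergence. *)
have [UF UU sU] := nat_ultra.
have UFn m : UF [set n | (m <= n)%N] by apply: sU; exists m.
have [|l ls hl] := @ultra_lim R UF b s UU.
  by apply: filterS (UFn n0) => n /= /hb[].
have l1 : N l < 1 by lra.
exists l; first exact/oball0P.
apply/eqP; rewrite -subr_eq0; apply/eqP; apply: N_le_eps => e e0.
have e20 : 0 < e / 2 by lra.
have lB : oball 0 1 l by exact/oball0P.
have [d d0 hd] := ana_contc df lB e20.
pose s' := (1 + s) / 2; have [s'1 ss'] : s' < 1 /\ s < s' by rewrite /s'; split; lra.
have [n3 h3] := h s' (e / 2) s'1 e20.
have [n [/= nl [nn0 nn3]]] := filter_ex (filterI (hl _ d0) (filterI (UFn n0) (UFn n3))).
have [bs bv] := hb n nn0.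
have := h3 n nn3 (b n) ltac:(apply/oball0P; lra); have := hd _ nl; rewrite bv.
have := NDB (f l) v (f (b n)); rewrite [N (f l - f _)]NB [N (f (b n) - v)]NB; lra.
Qed.

Lemma kernel_univalent_limit fn f : (forall n, univalent0 (fn n)) -> luc fn f -> dv f 0 != 0 ->
  is_kernel (fun n => fn n @` oball 0 1) (f @` oball 0 1).
Proof.
move=> ufn h f'0; have uf := luc_univalent0 ufn h f'0; left.
have dfn n : ana (oball 0 1) (fn n) by case: (ufn n).
split; last split.
- have Nf : 0 < N (dv f 0) / 2 by have [] := univalent0_dv0 uf; lra.
  have [n0 hn] := luc_pt (luc_dv dfn h) (oball_center 0 ltr01) Nf.
  (* The first case of the kernel asks for a disk inside every domain: from [n0] on the derivatives
     exceed half of the limit, and the finitely many earlier ones have a positive lower bound. *)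
  have [x x0 hx] : exists2 x, 0 < x & forall n, (n < n0)%N -> x <= N (dv (fn n) 0).
    elim: {hn} n0 => [|n0 [x x0 hx]]; first by exists 1.
    have [N0' _] := univalent0_dv0 (ufn n0).
    exists (Num.min x (N (dv (fn n0) 0))); first by rewrite lt_min x0.
    move=> n; rewrite ltnS leq_eqVlt => /orP[/eqP ->|/hx k]; first by rewrite ge_min lexx orbT.
    by rewrite ge_min k.
  pose y := Num.min x (N (dv f 0) / 2).
  have y0 : 0 < y by rewrite lt_min x0.
  exists (y / A); first by rewrite divr_gt0// bloch_const_gt0.
  move=> n; rewrite disk_oball; apply: subset_trans (koebe0 (ufn n)).
  apply: oball_sub; rewrite subrr N0 add0r ler_pM2r ?invr_gt0 ?bloch_const_gt0//.
  have [nn|/hx k] := leqP n0 n; last by rewrite /y ge_min k.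
  by rewrite /y ge_min; apply/orP; right; have := hn n nn; have := NBr (dv f 0) (dv (fn n) 0); rewrite NB; lra.
- split; [exact: image_domain| |exact: covers_images].
  by have [_ _ f0 _] := uf; exists 0 => //; exact: oball_center.
- by move=> V; exact: kernel_maximal.
Qed.

Lemma kernel_degenerate_limit fn f : (forall n, univalent0 (fn n)) -> luc fn f -> dv f 0 = 0 ->
  is_kernel (fun n => fn n @` oball 0 1) [set 0].
Proof.
move=> ufn h f'0; right; split => // n0 [r r0 hr].
have dfn n : ana (oball 0 1) (fn n) by case: (ufn n).
have r20 : 0 < r / 2 by lra.
have [n1 hn] := luc_pt (luc_dv dfn h) (oball_center 0 ltr01) r20.
pose n := maxn n0.+1 n1.
have := hn n (leq_maxr _ _); rewrite f'0 subr0.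
have := hr n (leq_maxl _ _); rewrite disk_oball => /(inner_radius (ufn n) r0); lra.
Qed.

Lemma kernel_unique (Dn : nat -> set C) (D D' : set C) : is_kernel Dn D -> is_kernel Dn D' -> D = D'.
Proof.
case=> [[[r r0 hr] [kD mD]]|[nD ->]]; case=> [[[r' r'0 hr'] [kD' mD']]|[nD' ->]] //.
- by apply/seteqP; split; [exact: mD'|exact: mD].
- by exfalso; apply: (nD' 0%N); exists r.
- by exfalso; apply: (nD 0%N); exists r'.
Qed.

End Kernels.

(** * Montel's theorem and the kernel theorem *)

Section Montel.
Variable R : realType.
Notation C := R[i].
Implicit Types (f g F G : C -> C) (z w a b c o v u : C) (t s e r d M : R) (S U V K : set C).

Lemma uniform_cvgP (K : set C) (fn : nat -> C -> C) f : {uniform K, fn @ \oo --> f} <->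
  forall e, 0 < e -> exists n0, forall n, (n0 <= n)%N -> forall z, K z -> N (fn n z - f z) < e.
Proof.
split.
  move=> h e e0.
  have /h[n0 _ hn] : nbhs (f : {uniform` K -> C}) [set g : {uniform` K -> C} | forall z, K z -> N (g z - f z) < e].
    apply/uniform_nbhs; exists [set xy | ball xy.1 e%:C xy.2]; split.
      by rewrite -entourage_ballE; exists e%:C => //=; rewrite ltcR.
    by move=> g /= hg z /hg; rewrite /ball /= normCE ltcR NB.
  by exists n0 => n /hn.
move=> H P /uniform_nbhs[E [entE sE]].
have [_ /= /posC[e e0 ->] he] : exists2 e : C, 0 < e & [set xy | ball xy.1 e xy.2] `<=` E.
  by move: entE; rewrite -entourage_ballE => -[e /= e0 h]; exists e.
have [n0 hn] := H e e0; exists n0 => // n /= /hn k; apply: sE => z /k.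
by move=> zz; apply: he; rewrite /ball /= normCE ltcR NB.
Qed.

Lemma locally_uniform_cvgP (fn : nat -> C -> C) f : locally_uniform_cvg (disk 1) fn f <-> luc fn f.
Proof.
rewrite /locally_uniform_cvg disk_oball; split.
  move=> h s e s1 e0.
  have sK : cball 0 s `<=` oball (0 : C) 1 by move=> z zs; apply/oball0P; rewrite /cball /= subr0 in zs; lra.
  have [n0 hn] := (uniform_cvgP _ _ _).1 (h _ (@cball_compact R 0 s) sK) e e0.
  exists n0 => n nn z /oball0P zs; apply/ltW/hn => //; rewrite /cball /= subr0; lra.
move=> h K cK KB; apply/uniform_cvgP => e e0.
have [z /KB/oball0P zB|l [lP cov]] := compact_fin_cover (Q := fun z d => d = (1 - N z) / 2) cK.
  by exists ((1 - N z) / 2) => //; lra.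
have [s s1 hs] : exists2 s, s < 1 & forall p, p \in l -> N p.1 + p.2 <= s.
  have {cov} : forall p, p \in l -> N p.1 + p.2 < 1.
    by move=> p /lP[/KB/oball0P h1 _ ->]; lra.
  elim: l {lP} => [|p l IH hl]; first by exists 0; rewrite ?ltr01.
  have [|s s1 hs] := IH; first by move=> q ql; apply: hl; rewrite inE ql orbT.
  exists (Num.max (N p.1 + p.2) s); first by rewrite gt_max hl ?mem_head.
  by move=> q; rewrite inE => /orP[/eqP ->|/hs k]; rewrite le_max ?lexx// k orbT.
have e20 : 0 < e / 2 by lra.
have [n0 hn] := h s (e / 2) s1 e20.
exists n0 => n nn z /cov[p /hs ps zp].
apply: le_lt_trans (_ : e / 2 < e); last lra.
by apply: hn => //; apply/oball0P; have := NBr z p.1; lra.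
Qed.

Lemma filter_seq (X : Type) (F : set_system X) (I : eqType) (l : seq I) (P : I -> set X) :
  Filter F -> (forall i, i \in l -> F (P i)) -> F [set x | forall i, i \in l -> P i x].
Proof.
move=> FF; elim: l => [_|i l IH h].
  by apply: (filterS _ filterT) => x _ i.
have h1 : F (P i) by apply: h; rewrite mem_head.
have h2 : F [set x | forall i, i \in l -> P i x].
  by apply: IH => j jl; apply: h; rewrite inE jl orbT.
apply: (filterS _ (filterI h1 h2)) => x [x1 x2] j.
by rewrite inE => /orP[/eqP ->|/x2].
Qed.

Lemma choose_subseq (P : nat -> nat -> Prop) : (forall k m, exists2 n, (m < n)%N & P k n) ->
  exists2 phi : nat -> nat, {homo phi : m n / (m < n)%N} & forall k, P k (phi k).
Proof.
move=> H; have /choice[pick hpick] (km : nat * nat) : exists n, (km.2 < n)%N /\ P km.1 n.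
  by have [n n1 n2] := H km.1 km.2; exists n.
pose phi := fix phi k := if k is k'.+1 then pick (k'.+1, phi k') else pick (0, 0)%N.
exists phi.
  by apply: homo_ltn ltn_trans _ => k; have [] := hpick (k.+1, phi k).
by case=> [|k]; [have [] := hpick (0, 0)%N|have [] := hpick (k.+1, phi k)].
Qed.

(** The pointwise limit is taken along one ultrafilter. The growth bound makes the sequence
    equi-Lipschitz on smaller disks, so the convergence along the ultrafilter is uniform there; a
    subsequence is extracted only at the end. *)
Lemma montel (fn : nat -> C -> C) M : (forall n, univalent0 (fn n)) ->
  (forall n, N (dv (fn n) 0) <= M) ->
  exists (phi : nat -> nat) f, {homo phi : m n / (m < n)%N} /\ luc (fun k => fn (phi k)) f.
Proof.
move=> ufn hM; have dfn n : ana (oball 0 1) (fn n) by case: (ufn n).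
have M0 : 0 <= M by apply: le_trans (hM 0%N); exact: N_ge0.
have [U UU sU] := nat_ultra.
have UFn m : U [set n | (m <= n)%N] by apply: sU; exists m.
have bnd s n z : s < 1 -> N z < s -> N (fn n z) <= M * growth_const s.
  move=> s1 zs; apply: le_trans (growth (ufn n) s1 zs) _.
  by rewrite ler_wpM2r// /growth_const mulr_ge0// addr_ge0 ?expR_ge0.
have /choice[f hf] z : exists l, N z < 1 -> forall e, 0 < e -> U [set n | N (fn n z - l) < e].
  have [z1|z1] := ltP (N z) 1; last by exists 0.
  have [|l _ hl] := @ultra_lim R U (fn^~ z) (M * growth_const ((1 + N z) / 2)) UU.
    by apply: (filterS _ filterT) => n _ /=; apply: bnd; lra.
  by exists l.
have unif s e : s < 1 -> 0 < e -> U [set n | forall z, oball 0 s z -> N (fn n z - f z) <= e].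
  move=> s1 e0; pose s' := (1 + s) / 2; pose r := s' - s.
  have [s'1 r0] : s' < 1 /\ 0 < r by rewrite /r /s'; split; lra.
  pose K := M * growth_const s'.
  have K0 : 0 <= K by rewrite /K mulr_ge0// /growth_const mulr_ge0// addr_ge0 ?expR_ge0.
  pose L := 4 * K / r.
  have L0 : 0 <= L by apply: divr_ge0; [exact: mulr_ge0|exact: ltW].
  have lip n z w : N z <= s -> N (w - z) < r / 2 -> N (fn n w - fn n z) <= L * N (w - z).
    move=> zs wz; have sub : oball z r `<=` oball 0 s' by apply: oball_sub; rewrite subr0 /r; lra.
    apply: ana_lip (r0) _ _ _ _.
    - by apply: anaS (dfn n) => x /sub/oball0P xs; apply/oball0P; lra.
    - by move=> x /sub/oball0P xs; exact: bnd.
    - by apply: oball_center; lra.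
    - exact: wz.
  (* With a net of mesh [d], the error at [z] splits into the oscillation of [fn n], at most
     [e / 8], the error at a net point, below [e / 8], and the oscillation of [f], at most
     [3 e / 8]. *)
  pose d := Num.min (r / 2) (e / 8 / (L + 1)).
  have L1 : 0 < L + 1 by lra.
  have k0 : 0 < e / 8 / (L + 1) by rewrite !divr_gt0.
  have d0 : 0 < d by rewrite lt_min k0 andbT; lra.
  have d1 : d <= r / 2 by rewrite ge_min lexx.
  have d2 : d <= e / 8 / (L + 1) by rewrite ge_min lexx orbT.
  clearbody d.
  have Ld : L * d <= e / 8.
    by rewrite ler_pdivlMr// in d2; have := ltW d0; lra.
  have [z _|l [lP cov]] := compact_fin_cover (Q := fun _ x => x = d) (@cball_compact R 0 s).
    by exists d.
  have net : U [set n | forall p, p \in l -> N (fn n p.1 - f p.1) < e / 8].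
    apply: filter_seq => p /lP[ps _ _]; rewrite /= subr0 in ps.
    by apply: hf; lra.
  apply: filterS net => n hn z /oball0P zs.
  have [|p pl] := cov z; first by rewrite /= subr0 ltW.
  have [ps _ ->] := lP _ pl; rewrite /= subr0 in ps => zp.
  have k1 := hn _ pl.
  have lipz m : N (fn m z - fn m p.1) <= e / 8.
    apply: le_trans (lip m _ _ ps _) _; first by lra.
    by apply: le_trans Ld; rewrite ler_wpM2l// ltW.
  have z1 : N z < 1 by lra.
  have p1 : N p.1 < 1 by lra.
  have e40 : 0 < e / 8 by lra.
  (* Nothing is known yet about the regularity of [f]; its values at [z] and [p.1] are compared
     through one index [m] that is good at both points. *)
  have [m [/= m1 m2]] := filter_ex (filterI (hf z z1 _ e40) (hf p.1 p1 _ e40)).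
  have k2 : N (f z - f p.1) <= 3 * (e / 8).
    have := NDB (f z) (f p.1) (fn m z); have := NDB (fn m z) (f p.1) (fn m p.1).
    by rewrite [N (f z - fn m z)]NB; have := lipz m; lra.
  have := NDB (fn n z) (f z) (fn n p.1); have := NDB (fn n p.1) (f z) (f p.1).
  rewrite [N (f p.1 - f z)]NB; have := lipz n; lra.
(* Radius and tolerance are tied to the same [k], so a single sequence of choices exhausts the
   disk. *)
pose Pk k : set nat := [set n | forall z, oball 0 (1 - (2 ^+ k)^-1) z -> N (fn n z - f z) <= (2 ^+ k)^-1].
have i0 k : 0 < (2 ^+ k : R)^-1 by rewrite invr_gt0 exprn_gt0.
have [k m|phi hphi phiP] := @choose_subseq Pk.
  have s1 : 1 - (2 ^+ k)^-1 < 1 :> R by have := i0 k; lra.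
  by have [n [n1 n2]] := filter_ex (filterI (UFn m.+1) (unif _ _ s1 (i0 k))); exists n.
exists phi, f; split => //.
move=> s e s1 e0; have m0 : 0 < Num.min e (1 - s) by rewrite lt_min e0 subr_gt0.
have [n hn] := expr_half_lt 1 m0; exists n => k nk z /oball0P zs.
have kn : (2 ^+ k : R)^-1 <= (2 ^+ n)^-1.
  by rewrite lef_pV2 ?posrE ?exprn_gt0// ler_weXn2l// ler1n.
move: hn; rewrite div1r lt_min => /andP[h1 h2].
apply: le_trans (phiP k z _) _; last by lra.
by apply/oball0P; lra.
Qed.

End Montel.

(** * The two implications of the kernel theorem *)

Section Caratheodory.
Variable R : realType.
Notation C := R[i].
Implicit Types (f g F G : C -> C) (z w a b c o v u : C) (t s e r d M : R) (S U V K : set C).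

Lemma strictly_increasing_ge (phi : nat -> nat) : {homo phi : m n / (m < n)%N} -> forall n, (n <= phi n)%N.
Proof. by move=> h; elim=> // n IH; apply: leq_ltn_trans IH (h _ _ (ltnSn n)). Qed.

Lemma luc_subseq (fn : nat -> C -> C) f (phi : nat -> nat) : {homo phi : m n / (m < n)%N} ->
  luc fn f -> luc (fun k => fn (phi k)) f.
Proof.
move=> hphi h s e s1 e0; have [n0 hn] := h s e s1 e0; exists n0 => n nn; apply: hn.
exact: leq_trans nn (strictly_increasing_ge hphi n).
Qed.

Lemma univalent0_nontrivial f : univalent0 f -> f @` oball 0 1 <> [set 0].
Proof.
move=> uf E; have [df fi f0 _] := uf.
have hB : oball (0 : C) 1 (2^-1)%:C by apply/oball0P; rewrite Nr ger0_norm ?invr_ge0//; lra.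
have : [set (0 : C)] (f (2^-1)%:C) by rewrite -E; exact: imageP.
rewrite /= -f0 => /(fi _ _); rewrite !inE => /(_ hB (oball_center 0 ltr01)) /(congr1 (@Normc.normc R)).
rewrite Nr N0 ger0_norm ?invr_ge0//; lra.
Qed.

(** Schwarz's lemma for the inverse takes the place of Liouville's theorem: the disks about 0 in the
    image have bounded radius. *)
Lemma univalent0_not_onto f : univalent0 f -> f @` oball 0 1 <> setT.
Proof.
move=> uf E; have [d0 _] := univalent0_dv0 uf.
have : N (dv f 0) + 1 <= N (dv f 0); last lra.
by apply: inner_radius => //; [lra|rewrite E].
Qed.

Section Sequence.
Variables (fn : nat -> C -> C) (D : set C).
Hypothesis ufn : forall n, univalent0 (fn n).
Let Dn n := fn n @` oball 0 1.
Hypothesis Dker : is_kernel Dn D.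

(** The limit function alone determines the kernel, and every subsequence has the same limit
    function. *)
Lemma luc_kernel f : luc fn f -> kernel_converges Dn D /\
  ((univalent0 f /\ D = f @` oball 0 1) \/ ((forall z, oball 0 1 z -> f z = 0) /\ D = [set 0])).
Proof.
move=> h; have [f'0|f'0] := eqVneq (dv f 0) 0.
  have kf := kernel_degenerate_limit ufn h f'0; have DE := kernel_unique Dker kf.
  split; last by right; split => //; exact: luc_zero h f'0.
  move=> phi hphi; rewrite DE; exact: (kernel_degenerate_limit (fun k => ufn (phi k)) (luc_subseq hphi h) f'0).
have kf := kernel_univalent_limit ufn h f'0; have DE := kernel_unique Dker kf.
split; last by left; split => //; exact: luc_univalent0 h f'0.
move=> phi hphi; rewrite DE; exact: (kernel_univalent_limit (fun k => ufn (phi k)) (luc_subseq hphi h) f'0).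
Qed.

End Sequence.

(** Along a subsequence whose derivatives at 0 exceed every bound, the Koebe disks exhaust the
    plane. The kernel of that subsequence, which is [D], would be the whole plane. *)
Lemma dv_bounded (fn : nat -> C -> C) (D : set C) : (forall n, univalent0 (fn n)) ->
  kernel_converges (fun n => fn n @` oball 0 1) D -> D <> setT ->
  exists M, forall n, N (dv (fn n) 0) <= M.
Proof.
move=> ufn kD DT; apply: contrapT => nM; apply: DT.
have [k m|phi hphi big] := @choose_subseq (fun k n => k%:R < N (dv (fn n) 0) :> R).
  apply: contrapT => nex; apply: nM.
  have [M hM] : exists M, forall n, (n <= m)%N -> N (dv (fn n) 0) <= M.
    elim: m {nex} => [|m [M hM]]; first by exists (N (dv (fn 0%N) 0)) => n; rewrite leqn0 => /eqP ->.
    exists (Num.max M (N (dv (fn m.+1) 0))) => n; rewrite leq_eqVlt => /orP[/eqP ->|/hM k1].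
      by rewrite le_max lexx orbT.
    by rewrite le_max k1.
  exists (Num.max M k%:R) => n; have [/hM k1|mn] := leqP n m; first by rewrite le_max k1.
  rewrite le_max; apply/orP; right; rewrite leNgt; apply/negP => kn.
  by apply: nex; exists n.
have A0 := bloch_const_gt0 R.
have sub r : exists k0, forall k, (k0 <= k)%N -> oball (0 : C) r `<=` fn (phi k) @` oball 0 1.
  exists (Num.bound `|r * bloch_const R|) => k hk.
  apply: subset_trans (koebe0 (ufn (phi k))); apply: oball_sub.
  rewrite subrr N0 add0r ler_pdivlMr//; apply: le_trans (ler_norm _) _.
  apply: le_trans (ltW (archi_boundP _)) _ => //; apply: le_trans (ltW (big k)).
  by rewrite ler_nat.
have [[_ [_ mD]]|[nD _]] := kD phi hphi.
  apply/seteqP; split => // z _; apply: (mD setT) => //; split => //; first exact: setT_domain.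
  move=> K /compact_sub_ball[M _ KM] _; have [k0 hk] := sub M.
  by exists k0 => // k /= /hk; exact: subset_trans.
exfalso; have [k0 hk] := sub 1; apply: (nD k0); exists 1 => // n /ltnW nn.
by rewrite disk_oball; exact: hk.
Qed.

Lemma kernel_luc (fn : nat -> C -> C) (D : set C) : (forall n, univalent0 (fn n)) ->
  kernel_converges (fun n => fn n @` oball 0 1) D -> D <> setT -> exists f, luc fn f.
Proof.
move=> ufn kD DT; have [M hM] := dv_bounded ufn kD DT.
have [phi [f [hphi hf]]] := montel ufn hM.
exists f; apply: contrapT => nluc.
have [s [e [s1 e0 hse]]] : exists s e, [/\ s < 1, 0 < e & forall m, exists2 n, (m < n)%N &
    exists2 z, oball 0 s z & e < N (fn n z - f z)].
  apply: contrapT => nex; apply: nluc => s e s1 e0; apply: contrapT => nn0; apply: nex.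
  exists s, e; split => // m; apply: contrapT => nn; apply: nn0; exists m.+1 => n mn z zs.
  by rewrite leNgt; apply/negP => ez; apply: nn; exists n => //; exists z.
(* If the full sequence did not converge to [f], a subsequence would stay at distance more than [e]
   from [f] on a fixed disk; its own limit points have the kernel [D] again. *)
have [k m|psi hpsi bad] := @choose_subseq (fun _ n => exists2 z, oball 0 s z & e < N (fn n z - f z)).
  exact: hse.
have [chi [g [hchi hg]]] := montel (fun k => ufn (psi k)) (fun k => hM (psi k)).
have hpc : {homo (fun k => psi (chi k)) : m n / (m < n)%N} by move=> m n /hchi/hpsi.
have [_ cf] := luc_kernel (fun k => ufn (phi k)) (kD phi hphi) hf.
have [_ cg] := luc_kernel (fun k => ufn (psi (chi k))) (kD _ hpc) hg.
(* The mixed cases are void because a univalent image is not a single point; otherwise both limits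
   are normalized maps onto [D], or both vanish. *)
have fg z : oball 0 1 z -> f z = g z.
  case: cf => -[hf1 hf2]; case: cg => -[hg1 hg2].
  - by apply: univalent0_unique => //; rewrite -hf2.
  - by exfalso; apply: (univalent0_nontrivial hf1); rewrite -hf2.
  - by exfalso; apply: (univalent0_nontrivial hg1); rewrite -hg2.
  - by move=> zB; rewrite hf1// hg1.
have [n0 hn] := hg s e s1 e0.
have [z zs] := bad (chi n0); rewrite fg.
  by apply/negP; rewrite -leNgt; exact: hn.
by move/oball0P: zs => zs; apply/oball0P; lra.
Qed.

End Caratheodory.

Theorem theorem3p1p4 (R : realType) (Dn : nat -> set R[i])
    (fn : nat -> R[i] -> R[i]) (D : set R[i])
    (Dn_domain : forall n, domain (Dn n))
    (Dn_sc : forall n, simply_connected (Dn n))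
    (Dn0 : forall n, Dn n 0)
    (fn_analytic : forall n, analytic_on (disk 1) (fn n))
    (fn_univalent : forall n, set_inj (disk 1) (fn n))
    (fn_image : forall n, fn n @` disk 1 = Dn n)
    (fn0 : forall n, fn n 0 = 0)
    (fn'0 : forall n, 0 < derive1 (fn n) 0)
    (D_kernel : is_kernel Dn D) :
  ((exists f : R[i] -> R[i], locally_uniform_cvg (disk 1) fn f) <->
   (kernel_converges Dn D /\ D <> setT)) /\
  (forall f : R[i] -> R[i], locally_uniform_cvg (disk 1) fn f ->
     (D = [set 0] -> forall z, disk 1 z -> f z = 0) /\
     (D <> [set 0] -> f @` disk 1 = D)).
Proof.
have ufn n : univalent0 (fn n).
  have df : ana (oball 0 1) (fn n).
    by move=> z; rewrite -disk_oball => /fn_analytic/derivable_hasd.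
  split => //; first by rewrite -disk_oball.
  have := fn'0 n; rewrite (derive1_hasd (ana_dv df _))//; exact: oball_center.
have DnE : Dn = (fun n => fn n @` oball 0 1).
  by apply/funext => n; rewrite -fn_image disk_oball.
rewrite DnE in D_kernel *; rewrite disk_oball; split; [split|].
- move=> [f hf0]; have {hf0} hf : luc fn f by apply/locally_uniform_cvgP; rewrite disk_oball.
  have [kD cf] := luc_kernel ufn D_kernel hf; split => //.
  case: cf => -[h ->]; first exact: univalent0_not_onto.
  move=> E; have : [set: R[i]] 1 by []. rewrite -E /= => /eqP; by rewrite oner_eq0.
- by move=> [kD DT]; have [f hf] := kernel_luc ufn kD DT; exists f; rewrite -disk_oball; apply/locally_uniform_cvgP.
move=> f hf0; have {hf0} hf : luc fn f by apply/locally_uniform_cvgP; rewrite disk_oball.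
have [_ [[uf DE]|[fz DE]]] := luc_kernel ufn D_kernel hf; split => //.
- by move=> D0; exfalso; apply: (univalent0_nontrivial uf); rewrite -DE.
Qed.
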